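(* Let $\mathcal{A}$ be a pseudo-abelian rigid $K$-category of homological type, provided with a faithful realisation functor $H:\mathcal{A}\to\operatorname{Vec}_L^\pm$, let $F\in\operatorname{Aut}^\otimes(Id_{\mathcal{A}})$, and denote still by $F$ its image in $\operatorname{Aut}^\otimes(Id_{\bar{\mathcal{A}}})$, where $\bar{\mathcal{A}}=\mathcal{A}/\mathcal{N}$. Consider the following conditions: (i) The Tate conjecture holds for $(\bar{\mathcal{A}},F)$. (ii) $\mathcal{A}\to\bar{\mathcal{A}}$ is an equivalence of categories and $H$ induces a fully faithful functor $$\tilde H:\bar{\mathcal{A}}_L\to\operatorname{Rep}_L(F)_{ss}^\pm$$ where the right hand side denotes the $\otimes$-category of $\mathbf{Z}/2$-graded $L$-vector spaces provided with the action of an automorphism $F$, this action being semi-simple. (iii) The sign conjecture holds for any $M\in\mathcal{A}$ (equivalently, $\mathcal{A}$ is a Kimura-O'Sullivan category). (iv) For any $M\in\mathcal{A}$, $H^-(M)^F=0$. Then (iv) $\Rightarrow$ (iii); moreover (ii) $\iff$ (i) + (iii) $\iff$ (i) + (iv). If these conditions are verified, then for any simple object $S\in\mathcal{A}_L^\natural$, $\operatorname{End}(S)$ is commutative.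
   Context: $K$ is a field of characteristic $0$. A rigid $K$-category is an additive $K$-linear symmetric monoidal category with $K$-bilinear tensor product, in which every object has a dual, and such that $\operatorname{End}(\mathbf{1})=K$. $\operatorname{tr}$ denotes the categorical trace. Pseudo-abelian means that idempotents split; $(-)^\natural$ is the idempotent completion; $\mathcal{A}_L=\mathcal{A}\otimes_KL$ has the same objects and Hom spaces tensored with $L$. $\mathcal{A}$ is of homological type if there exist an extension $L/K$ and a ($K$-linear symmetric monoidal) tensor functor $H:\mathcal{A}\to\operatorname{Vec}_L^\pm$ (a realisation), where $\operatorname{Vec}_L^\pm$ is the tensor category of $\mathbf{Z}/2$-graded finite-dimensional $L$-vector spaces with the Koszul rule. Write $H=H^+\oplus H^-$. $\mathcal{N}(M,N)=\{f:M\to N\mid\operatorname{tr}(gf)=0\ \forall g:N\to M\}$. The quotient $\bar{\mathcal{A}}=\mathcal{A}/\mathcal{N}$ is then known to be semi-simple (all endomorphism rings are finite-dimensional semi-simple $K$-algebras) and of integral type (the multiplicities, i.e. the components $\mu_i(M)$ of the unique central element $\mu(M)=\sum_i\mu_i(M)e_i\in\operatorname{End}(M)$ with $\operatorname{tr}(f)=\operatorname{Trd}_{\operatorname{End}(M)}(\mu(M)f)$ for all $f$, are integers; here $e_i$ are the central idempotents of the simple factors, and $\operatorname{Trd}$ is the sum over simple factors of the reduced trace composed with the trace from the centre to $K$). $\operatorname{Aut}^\otimes(Id_{\mathcal{A}})$ is the group of $\otimes$-automorphisms of the identity functor: natural families of automorphisms $F_M\in\operatorname{End}(M)$ with $F_{M\otimes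 N}=F_M\otimes F_N$. $F$ acts on $H(M)$ through $H(F_M)$, and $(-)^F$ denotes invariants. For $\mathcal{B}$ semi-simple of integral type and $F\in\operatorname{Aut}^\otimes(Id_{\mathcal B})$, the Tate conjecture holds for $(\mathcal{B},F)$ if for any $M\in\mathcal{B}$, $K[F_M]$ is the centre of $\operatorname{End}_{\mathcal{B}}(M)$. The sign conjecture holds for $M$ (with respect to $H$) if there exists $p\in\operatorname{End}_{\mathcal{A}}(M)$ such that $H(p)$ is the identity on $H^+(M)$ and $0$ on $H^-(M)$. $\mathcal{A}$ is a Kimura-O'Sullivan category if every object $M$ is finite-dimensional, i.e. $M\simeq M_+\oplus M_-$ with $M_+$ killed by some nonzero exterior power and $M_-$ killed by some nonzero symmetric power.
   Formalization: Morphisms of Rep_L(F)_ss^± are taken to be all F-equivariant L-linear maps, odd ones included; with only degree-0 maps, (ii) ⇒ (i) and (ii) ⇒ (iv) fail, e.g. for A = Vec_K^±, L = K, H = Id, F = id, M = K^{1|1}. *)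

(* Defs.v *)
From HB Require Import structures.
From mathcomp Require Import all_boot all_algebra.
From mathcomp Require Import perm boolp.
From mathcomp Require Import ring_quotient.

Set Implicit Arguments.
Unset Strict Implicit.
Unset Printing Implicit Defensive.

Import GRing.Theory.
Local Open Scope ring_scope.
Local Open Scope quotient_scope.

Record submod (R : pzRingType) (V : lmodType R) := Submod {
  submod_mem : {pred V};
  submod_memP : submod_closed submod_mem
}.

HB.instance Definition _ (R : pzRingType) (V : lmodType R) (S : submod V) :=
  GRing.isSubmodClosed.Build R V (submod_mem S) (submod_memP S).

Section SubLmodule.
Variables (R : pzRingType) (V : lmodType R) (S : submod V).

Record sub_lmod := SubLmod { sub_val : V; _ : sub_val \in submod_mem S }.

HB.instance Definition _ := [isSub for sub_val].
HB.instance Definition _ := [Choice of sub_lmod by <:].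
HB.instance Definition _ := [SubChoice_isSubZmodule of sub_lmod by <:].
HB.instance Definition _ := [SubZmodule_isSubLmodule of sub_lmod by <:].

End SubLmodule.

Section QuotLmodule.
Variables (R : pzRingType) (V : lmodType R) (S : submod V).

Definition quot_lmod := (Quotient.quot (submod_mem S)).
HB.instance Definition _ := Choice.on quot_lmod.
HB.instance Definition _ := GRing.Zmodule.on quot_lmod.

Definition quot_pi (x : V) : quot_lmod := \pi_((Quotient.quot (submod_mem S))) x.
Definition quot_repr (q : quot_lmod) : V := repr (q : (Quotient.quot (submod_mem S))).

Lemma quot_reprK q : quot_pi (quot_repr q) = q.
Proof. exact: reprK. Qed.

Lemma quot_piP x y : quot_pi x = quot_pi y <-> x - y \in submod_mem S.
Proof.
rewrite -Quotient.equivE; split=> [/eqquotP //|H].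
by apply/eqquotP.
Qed.

Lemma quot_piD x y : quot_pi (x + y) = quot_pi x + quot_pi y.
Proof. exact: (raddfD (\pi_((Quotient.quot (submod_mem S))))). Qed.

Definition quot_scale (a : R) (q : quot_lmod) : quot_lmod :=
  quot_pi (a *: quot_repr q).

Lemma quot_scaleE a x : quot_scale a (quot_pi x) = quot_pi (a *: x).
Proof.
apply/quot_piP; rewrite -scalerBr; apply: rpredZ.
by apply/quot_piP; rewrite quot_reprK.
Qed.

Lemma quot_scaleA a b q : quot_scale a (quot_scale b q) = quot_scale (a * b) q.
Proof. by rewrite -(quot_reprK q) !quot_scaleE scalerA. Qed.
Lemma quot_scale1 : left_id 1 quot_scale.
Proof. by move=> q; rewrite -(quot_reprK q) quot_scaleE scale1r. Qed.
Lemma quot_scaleDr : right_distributive quot_scale +%R.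
Proof.
move=> a p q; rewrite -(quot_reprK p) -(quot_reprK q) -quot_piD !quot_scaleE.
by rewrite scalerDr quot_piD.
Qed.
Lemma quot_scaleDl q : {morph quot_scale^~ q : a b / a + b}.
Proof. by move=> a b /=; rewrite -(quot_reprK q) !quot_scaleE scalerDl quot_piD. Qed.

HB.instance Definition _ := GRing.Zmodule_isLmodule.Build R quot_lmod
  quot_scaleA quot_scale1 quot_scaleDr quot_scaleDl.

Lemma quot_pi_linear : linear quot_pi.
Proof. by move=> a x y; rewrite quot_piD -quot_scaleE. Qed.
HB.instance Definition _ := GRing.isLinear.Build R V quot_lmod _ quot_pi
  quot_pi_linear.

End QuotLmodule.

(* V (x)_K L as an L-vector space: formal sums s = sum_i v_i (x) l_i, written as
   lists of pairs (v_i, l_i), two of them being identified when every K-linear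
   map f from V to an L-vector space W gives the same sum_i l_i f(v_i). This is
   equality in the tensor product, by its universal property. *)
Section ExtendScalars.
Variables (K L : fieldType) (iota : {rmorphism K -> L}) (V : lmodType K).

Definition ext_eval (W : lmodType L) (f : {linear V -> W | iota \; *:%R})
  (s : seq (V * L)) : W := \sum_(p <- s) p.2 *: f p.1.

Definition ext_equiv (s t : seq (V * L)) : bool :=
  `[< forall (W : lmodType L) (f : {linear V -> W | iota \; *:%R}),
        ext_eval f s = ext_eval f t >].

Lemma ext_equiv_is_equiv : equiv_class_of ext_equiv.
Proof.
split=> [s|s t|t s u].
- exact/asboolP.
- by apply/asboolP/asboolP=> H W f; rewrite H.
- by move=> /asboolP H1 /asboolP H2; apply/asboolP=> W f; rewrite H1.
Qed.
Canonical ext_equiv_rel := EquivRelPack ext_equiv_is_equiv.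

Definition ext := {eq_quot ext_equiv_rel}.
HB.instance Definition _ := Choice.on ext.
HB.instance Definition _ := EqQuotient.on ext.

Definition ext_pi (s : seq (V * L)) : ext := \pi_ext s.
Lemma ext_piP s t : ext_pi s = ext_pi t <->
  forall (W : lmodType L) (f : {linear V -> W | iota \; *:%R}),
     ext_eval f s = ext_eval f t.
Proof.
split=> [/eqquotP/asboolP //|H]; apply/eqquotP; exact/asboolP.
Qed.
Lemma ext_reprK (x : ext) : ext_pi (repr x) = x.
Proof. exact: reprK. Qed.
Lemma ext_eval_repr W f s : @ext_eval W f (repr (ext_pi s)) = ext_eval f s.
Proof. by move: W f; apply/ext_piP; rewrite ext_reprK. Qed.

Lemma ext_eval_cat W f s t :
  @ext_eval W f (s ++ t) = ext_eval f s + ext_eval f t.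
Proof. by rewrite /ext_eval big_cat. Qed.

Definition ext0 : ext := ext_pi [::].
Definition ext_add (x y : ext) : ext := ext_pi (repr x ++ repr y).
Definition ext_scale (a : L) (x : ext) : ext :=
  ext_pi [seq (p.1, a * p.2) | p <- repr x].

Lemma ext_evalZ W f a s :
  @ext_eval W f [seq (p.1, a * p.2) | p <- s] = a *: ext_eval f s.
Proof.
by rewrite /ext_eval big_map scaler_sumr; apply: eq_bigr => p _; rewrite scalerA.
Qed.

Definition extE := (ext_evalZ, ext_eval_cat, ext_eval_repr).

Lemma ext_addA : associative ext_add.
Proof. by move=> x y z; apply/ext_piP=> W f; rewrite !extE addrA. Qed.
Lemma ext_addC : commutative ext_add.
Proof. by move=> x y; apply/ext_piP=> W f; rewrite !extE addrC. Qed.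
Lemma ext_add0 : left_id ext0 ext_add.
Proof.
move=> x; rewrite -[RHS]ext_reprK; apply/ext_piP=> W f.
by rewrite !extE /ext_eval big_nil add0r.
Qed.
Lemma ext_addN : left_inverse ext0 (ext_scale (-1)) ext_add.
Proof.
move=> x; apply/ext_piP=> W f.
by rewrite !extE scaleN1r addNr /ext_eval big_nil.
Qed.
HB.instance Definition _ := GRing.isZmodule.Build ext
  ext_addA ext_addC ext_add0 ext_addN.

Lemma ext_scaleA a b x : ext_scale a (ext_scale b x) = ext_scale (a * b) x.
Proof. by apply/ext_piP=> W f; rewrite !extE scalerA. Qed.
Lemma ext_scale1 : left_id 1 ext_scale.
Proof.
by move=> x; rewrite -[RHS]ext_reprK; apply/ext_piP=> W f; rewrite !extE scale1r.
Qed.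
Lemma ext_scaleDr : right_distributive ext_scale +%R.
Proof. by move=> a x y; apply/ext_piP=> W f; rewrite !extE scalerDr. Qed.
Lemma ext_scaleDl x : {morph ext_scale^~ x : a b / a + b}.
Proof. by move=> a b; apply/ext_piP=> W f; rewrite !extE scalerDl. Qed.
HB.instance Definition _ := GRing.Zmodule_isLmodule.Build L ext
  ext_scaleA ext_scale1 ext_scaleDr ext_scaleDl.

Definition ext_in (v : V) : ext := ext_pi [:: (v, 1)].

End ExtendScalars.
Reserved Notation "g \oc f" (at level 45, left associativity).
Reserved Notation "X \ox Y" (at level 40, left associativity).
Reserved Notation "f \om g" (at level 40, left associativity).

(* R-linear categories: Hom-spaces are R-vector spaces, composition is bilinear.
   Additivity (zero object and biproducts) is the separate [additive_cat]. *)
Record linCat (R : fieldType) := LinCat {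
  ob :> Type;
  mor : ob -> ob -> lmodType R;
  idm : forall X, mor X X;
  cmp : forall X Y Z, mor Y Z -> mor X Y -> mor X Z;
  cmpA : forall W X Y Z (h : mor Y Z) (g : mor X Y) (f : mor W X),
    cmp h (cmp g f) = cmp (cmp h g) f;
  cmp1m : forall X Y (f : mor X Y), cmp (idm Y) f = f;
  cmpm1 : forall X Y (f : mor X Y), cmp f (idm X) = f;
  cmp_linearl : forall X Y Z (f : mor X Y), linear (fun g : mor Y Z => cmp g f);
  cmp_linearr : forall X Y Z (g : mor Y Z), linear (cmp g : mor X Y -> mor X Z)
}.
Arguments mor {R l} X Y.
Arguments idm {R l} X.
Arguments cmp {R l X Y Z} g f.
Notation "g \oc f" := (cmp g f).

Section LinCatTheory.
Variables (R : fieldType) (C : linCat R).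
Implicit Types X Y Z W : C.

HB.instance Definition _ X Y Z (g : mor Y Z) :=
  GRing.isLinear.Build R (mor X Y) (mor X Z) _ (cmp g) (cmp_linearr g).

Definition cmpr X Y Z (f : mor X Y) (g : mor Y Z) := g \oc f.
HB.instance Definition _ X Y Z (f : mor X Y) :=
  GRing.isLinear.Build R (mor Y Z) (mor X Z) _ (@cmpr X Y Z f) (cmp_linearl f).

Lemma cmpDl X Y Z (g h : mor Y Z) (f : mor X Y) :
  (g + h) \oc f = g \oc f + h \oc f.
Proof. exact: (linearD (@cmpr X Y Z f)). Qed.
Lemma cmpNl X Y Z (g : mor Y Z) (f : mor X Y) : (- g) \oc f = - (g \oc f).
Proof. exact: (linearN (@cmpr X Y Z f)). Qed.
Lemma cmpBl X Y Z (g h : mor Y Z) (f : mor X Y) :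
  (g - h) \oc f = g \oc f - h \oc f.
Proof. exact: (linearB (@cmpr X Y Z f)). Qed.
Lemma cmpZl X Y Z a (g : mor Y Z) (f : mor X Y) :
  (a *: g) \oc f = a *: (g \oc f).
Proof. exact: (linearZ_LR (@cmpr X Y Z f)). Qed.
Lemma cmp0l X Y Z (f : mor X Y) : (0 : mor Y Z) \oc f = 0.
Proof. exact: (linear0 (@cmpr X Y Z f)). Qed.
Lemma cmpDr X Y Z (g : mor Y Z) (f h : mor X Y) :
  g \oc (f + h) = g \oc f + g \oc h.
Proof. exact: linearD. Qed.
Lemma cmpBr X Y Z (g : mor Y Z) (f h : mor X Y) :
  g \oc (f - h) = g \oc f - g \oc h.
Proof. exact: linearB. Qed.
Lemma cmpZr X Y Z a (g : mor Y Z) (f : mor X Y) :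
  g \oc (a *: f) = a *: (g \oc f).
Proof. exact: linearZ_LR. Qed.
Lemma cmp0r X Y Z (g : mor Y Z) : g \oc (0 : mor X Y) = 0.
Proof. exact: linear0. Qed.

Definition is_iso X Y (f : mor X Y) :=
  exists g : mor Y X, g \oc f = idm X /\ f \oc g = idm Y.

Definition is_mono X Y (f : mor X Y) :=
  forall Z (g h : mor Z X), f \oc g = f \oc h -> g = h.

Definition isomorphic X Y := exists f : mor X Y, is_iso f.

Definition is_simple S := idm S <> 0 /\
  forall X (f : mor X S), is_mono f -> f = 0 \/ is_iso f.

Definition is_zero_ob Z := idm Z = 0.

Definition is_biprod X Y S := exists (iX : mor X S) (iY : mor Y S)
    (pX : mor S X) (pY : mor S Y),
  [/\ pX \oc iX = idm X, pY \oc iY = idm Y, pX \oc iY = 0, pY \oc iX = 0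
    & iX \oc pX + iY \oc pY = idm S].

Definition additive_cat := (exists Z, is_zero_ob Z) /\
  forall X Y, exists S, is_biprod X Y S.

Definition pseudo_abelian := forall X (e : mor X X), e \oc e = e ->
  exists Y (r : mor X Y) (s : mor Y X), r \oc s = idm Y /\ s \oc r = e.

Fixpoint end_pow X (f : mor X X) n : mor X X :=
  if n is n'.+1 then f \oc end_pow f n' else idm X.

Definition end_horner X (f : mor X X) (p : {poly R}) : mor X X :=
  \sum_(i < size p) p`_i *: end_pow f i.

Definition is_central X (f : mor X X) :=
  forall g : mor X X, f \oc g = g \oc f.

(* K[F_X] is the centre of End(X), for all X. *)
Definition tate_conjecture (F : forall X, mor X X) := forall X (f : mor X X),
  is_central f <-> exists p : {poly R}, f = end_horner (F X) p.

Lemma cmp_isor X Y Z (f : mor X Y) (g h : mor Y Z) :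
  is_iso f -> g \oc f = h \oc f -> g = h.
Proof.
by case=> f' [_ ff'] e; rewrite -[g]cmpm1 -[h]cmpm1 -ff' !cmpA e.
Qed.
Lemma cmp_isol X Y Z (f : mor Y Z) (g h : mor X Y) :
  is_iso f -> f \oc g = f \oc h -> g = h.
Proof.
by case=> f' [ff' _] e; rewrite -[g]cmp1m -[h]cmp1m -ff' -!cmpA e.
Qed.
Lemma is_iso_cmp X Y Z (f : mor Y Z) (g : mor X Y) :
  is_iso f -> is_iso g -> is_iso (f \oc g).
Proof.
case=> f' [f1 f2] [g' [g1 g2]]; exists (g' \oc f'); split.
  by rewrite -cmpA [f' \oc _]cmpA f1 cmp1m.
by rewrite -cmpA [g \oc _]cmpA g2 cmp1m.
Qed.
Lemma is_iso_id X : is_iso (idm X).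
Proof. by exists (idm X); rewrite !cmp1m. Qed.

Lemma cmp_eqr X Y Y' Z W (a : mor Y Z) (b : mor X Y) (c : mor Y' Z)
  (d : mor X Y') (h : mor W X) :
  a \oc b = c \oc d -> a \oc (b \oc h) = c \oc (d \oc h).
Proof. by move=> e; rewrite !cmpA e. Qed.
Lemma cmp_eqr1 X Y Z W (a : mor Y Z) (b : mor X Y) (c : mor X Z) (h : mor W X) :
  a \oc b = c -> a \oc (b \oc h) = c \oc h.
Proof. by move=> e; rewrite !cmpA e. Qed.

End LinCatTheory.

Section Functors.

Record functor (R S : fieldType) (C : linCat R) (D : linCat S) := Functor {
  fob :> C -> D;
  fmap : forall X Y : C, mor X Y -> mor (fob X) (fob Y);
  fmap_id : forall X, fmap (idm X) = idm (fob X);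
  fmap_cmp : forall (X Y Z : C) (g : mor Y Z) (f : mor X Y),
    fmap (g \oc f) = fmap g \oc fmap f
}.

(* Linearity of a functor from an R-linear to an S-linear category, along a
   field extension iota : R -> S. *)
Definition linear_functor (R S : fieldType) (iota : {rmorphism R -> S})
    (C : linCat R) (D : linCat S) (F : functor C D) :=
  forall X Y : C, linear_for (iota \; *:%R) (@fmap _ _ _ _ F X Y).

Definition faithful (R S : fieldType) (C : linCat R) (D : linCat S)
    (F : functor C D) := forall X Y : C, injective (@fmap _ _ _ _ F X Y).

Definition fully_faithful (R S : fieldType) (C : linCat R) (D : linCat S)
    (F : functor C D) := forall X Y : C, bijective (@fmap _ _ _ _ F X Y).

Definition nat_iso (R S : fieldType) (C : linCat R) (D : linCat S)
    (F G : functor C D) := exists t : forall X : C, mor (F X) (G X),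
  (forall X, is_iso (t X)) /\
  forall (X Y : C) (f : mor X Y), t Y \oc fmap F f = fmap G f \oc t X.

Definition id_functor (R : fieldType) (C : linCat R) : functor C C :=
  @Functor R R C C id (fun X Y f => f) (fun X => erefl)
    (fun X Y Z g f => erefl).

Lemma comp_functor_id (R S T : fieldType) (C : linCat R) (D : linCat S)
    (E : linCat T) (G : functor D E) (F : functor C D) X :
  fmap G (fmap F (idm X)) = idm (G (F X)).
Proof. by rewrite !fmap_id. Qed.
Lemma comp_functor_cmp (R S T : fieldType) (C : linCat R) (D : linCat S)
    (E : linCat T) (G : functor D E) (F : functor C D)
    (X Y Z : C) (g : mor Y Z) (f : mor X Y) :
  fmap G (fmap F (g \oc f)) = fmap G (fmap F g) \oc fmap G (fmap F f).
Proof. by rewrite !fmap_cmp. Qed.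

Definition comp_functor (R S T : fieldType) (C : linCat R) (D : linCat S)
    (E : linCat T) (G : functor D E) (F : functor C D) : functor C E :=
  @Functor _ _ C E (fun X => G (F X)) (fun X Y f => fmap G (fmap F f))
    (comp_functor_id G F) (comp_functor_cmp G F).

Definition is_equivalence (R S : fieldType) (C : linCat R) (D : linCat S)
    (F : functor C D) := exists G : functor D C,
  nat_iso (comp_functor G F) (id_functor C) /\
  nat_iso (comp_functor F G) (id_functor D).

Lemma fmap_iso (R S : fieldType) (C : linCat R) (D : linCat S)
    (F : functor C D) (X Y : C) (f : mor X Y) : is_iso f -> is_iso (fmap F f).
Proof.
by case=> g [gf fg]; exists (fmap F g); rewrite -!fmap_cmp gf fg !fmap_id.
Qed.

End Functors.

Section QuotCat.
Variables (R : fieldType) (C : linCat R).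

Record cat_ideal := CatIdeal {
  ideal_mem : forall X Y : C, {pred mor X Y};
  ideal_submod : forall X Y, submod_closed (@ideal_mem X Y);
  ideal_cmpl : forall X Y Z (g : mor Y Z) (f : mor X Y),
    f \in @ideal_mem X Y -> g \oc f \in @ideal_mem X Z;
  ideal_cmpr : forall X Y Z (g : mor Y Z) (f : mor X Y),
    g \in @ideal_mem Y Z -> g \oc f \in @ideal_mem X Z
}.

Arguments ideal_mem : clear implicits.
Arguments ideal_submod : clear implicits.

Variable I : cat_ideal.
Implicit Types X Y Z W : C.

Definition quot_hom X Y : lmodType R := quot_lmod (Submod (ideal_submod I X Y)).
Definition qpi X Y (f : mor X Y) : quot_hom X Y :=
  quot_pi (Submod (ideal_submod I X Y)) f.
Definition quot_cmp X Y Z (g : quot_hom Y Z) (f : quot_hom X Y) : quot_hom X Z :=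
  qpi (quot_repr g \oc quot_repr f).

Lemma qpiP X Y (f g : mor X Y) : qpi f = qpi g <-> f - g \in ideal_mem I X Y.
Proof. exact: quot_piP. Qed.
Lemma qpi_reprK X Y (f : quot_hom X Y) : qpi (quot_repr f) = f.
Proof. exact: quot_reprK. Qed.
Lemma qpi_linear X Y : linear (@qpi X Y).
Proof. exact: quot_pi_linear. Qed.

Lemma quot_cmpE X Y Z (g : mor Y Z) (f : mor X Y) :
  quot_cmp (qpi g) (qpi f) = qpi (g \oc f).
Proof.
apply: (etrans (y := qpi (g \oc quot_repr (qpi f)))).
  apply/qpiP; rewrite -cmpBl; apply: ideal_cmpr.
  by apply/qpiP; rewrite qpi_reprK.
apply/qpiP; rewrite -cmpBr; apply: ideal_cmpl.
by apply/qpiP; rewrite qpi_reprK.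
Qed.

Lemma quot_cmpA W X Y Z (h : quot_hom Y Z) (g : quot_hom X Y)
  (f : quot_hom W X) : quot_cmp h (quot_cmp g f) = quot_cmp (quot_cmp h g) f.
Proof.
by rewrite -(qpi_reprK h) -(qpi_reprK g) -(qpi_reprK f) !quot_cmpE cmpA.
Qed.
Lemma quot_cmp1m X Y (f : quot_hom X Y) : quot_cmp (qpi (idm Y)) f = f.
Proof. by rewrite -(qpi_reprK f) quot_cmpE cmp1m. Qed.
Lemma quot_cmpm1 X Y (f : quot_hom X Y) : quot_cmp f (qpi (idm X)) = f.
Proof. by rewrite -(qpi_reprK f) quot_cmpE cmpm1. Qed.
Lemma quot_cmp_linearl X Y Z (f : quot_hom X Y) :
  linear (fun g : quot_hom Y Z => quot_cmp g f).
Proof.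
move=> a g h; rewrite -(qpi_reprK f) -(qpi_reprK g) -(qpi_reprK h).
by rewrite -qpi_linear !quot_cmpE cmpDl cmpZl qpi_linear.
Qed.
Lemma quot_cmp_linearr X Y Z (g : quot_hom Y Z) :
  linear (quot_cmp g : quot_hom X Y -> quot_hom X Z).
Proof.
move=> a f h; rewrite -(qpi_reprK f) -(qpi_reprK g) -(qpi_reprK h).
by rewrite -qpi_linear !quot_cmpE cmpDr cmpZr qpi_linear.
Qed.

Definition quot_cat : linCat R := LinCat quot_cmpA quot_cmp1m quot_cmpm1
  quot_cmp_linearl quot_cmp_linearr.

Definition quot_functor : functor C quot_cat :=
  @Functor _ _ C quot_cat id qpi (fun X => erefl)
    (fun X Y Z g f => esym (quot_cmpE g f)).

End QuotCat.

Section ExtCat.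
Variables (K L : fieldType) (iota : {rmorphism K -> L}) (C : linCat K).
Implicit Types X Y Z W : C.

Definition ext_hom X Y : lmodType L := ext iota (mor X Y).

Definition ext_seq_cmp X Y Z (s : seq (mor Y Z * L)) (t : seq (mor X Y * L)) :=
  [seq (g.1 \oc f.1, g.2 * f.2) | g <- s, f <- t].

Definition ext_cmp X Y Z (g : ext_hom Y Z) (f : ext_hom X Y) : ext_hom X Z :=
  ext_pi iota (ext_seq_cmp (repr g) (repr f)).

Lemma ext_eval_seq_cmp X Y Z s t (W : lmodType L)
    (f : {linear mor X Z -> W | iota \; *:%R}) :
  ext_eval f (@ext_seq_cmp X Y Z s t) =
  \sum_(p <- s) p.2 *: (\sum_(q <- t) q.2 *: f (p.1 \oc q.1)).
Proof.
rewrite /ext_eval big_allpairs_dep /=; apply: eq_bigr => p _.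
by rewrite scaler_sumr; apply: eq_bigr => q _; rewrite scalerA.
Qed.

Lemma ext_cmpE X Y Z s t :
  ext_cmp (ext_pi iota s) (ext_pi iota t) = ext_pi iota (@ext_seq_cmp X Y Z s t).
Proof.
apply/ext_piP=> W f; rewrite !ext_eval_seq_cmp.
have lin1 (p : mor Y Z) : linear_for (iota \; *:%R) (fun q : mor X Y => f (p \oc q)).
  by move=> a u v /=; rewrite cmpDr cmpZr linearP.
have lin2 (q : mor X Y) : linear_for (iota \; *:%R) (fun p : mor Y Z => f (p \oc q)).
  by move=> a u v /=; rewrite cmpDl cmpZl linearP.
pose f1 p := HB.pack_for {linear mor X Y -> W | iota \; *:%R}
  (fun q : mor X Y => f (p \oc q)) (GRing.isLinear.Build _ _ _ _ _ (lin1 p)).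
pose f2 q := HB.pack_for {linear mor Y Z -> W | iota \; *:%R}
  (fun p : mor Y Z => f (p \oc q)) (GRing.isLinear.Build _ _ _ _ _ (lin2 q)).
transitivity (\sum_(p <- repr (ext_pi iota s)) p.2 *: ext_eval (f1 p.1) t).
  by apply: eq_bigr => p _; rewrite -ext_eval_repr.
have swap (r : seq (mor Y Z * L)) :
    \sum_(p <- r) p.2 *: (ext_eval (f1 p.1) t) =
    \sum_(q <- t) q.2 *: (ext_eval (f2 q.1) r).
  rewrite /ext_eval; under eq_bigr do rewrite scaler_sumr.
  rewrite exchange_big; apply: eq_bigr => q _ /=; rewrite scaler_sumr.
  by apply: eq_bigr => p _; rewrite !scalerA mulrC.
rewrite swap; under eq_bigr do rewrite ext_eval_repr.
by rewrite -swap.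
Qed.

Lemma ext_cmpA W X Y Z (h : ext_hom Y Z) (g : ext_hom X Y)
  (f : ext_hom W X) : ext_cmp h (ext_cmp g f) = ext_cmp (ext_cmp h g) f.
Proof.
rewrite -(ext_reprK h) -(ext_reprK g) -(ext_reprK f) !ext_cmpE.
apply/ext_piP=> V phi; rewrite !ext_eval_seq_cmp /ext_seq_cmp.
rewrite big_allpairs_dep; apply: eq_bigr => p _ /=.
rewrite big_allpairs_dep scaler_sumr; apply: eq_bigr => q _ /=.
rewrite !scaler_sumr; apply: eq_bigr => r _ /=.
by rewrite !scalerA mulrA cmpA.
Qed.

Definition ext_id X : ext_hom X X := ext_in iota (idm X).

Lemma ext_cmp1m X Y (f : ext_hom X Y) : ext_cmp (ext_id Y) f = f.
Proof.
rewrite -(ext_reprK f) ext_cmpE; apply/ext_piP=> V phi.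
rewrite ext_eval_seq_cmp big_seq1 scale1r.
by apply: eq_bigr => q _; rewrite cmp1m.
Qed.
Lemma ext_cmpm1 X Y (f : ext_hom X Y) : ext_cmp f (ext_id X) = f.
Proof.
rewrite -(ext_reprK f) ext_cmpE; apply/ext_piP=> V phi.
rewrite ext_eval_seq_cmp; apply: eq_bigr => q _.
by rewrite big_seq1 scale1r cmpm1.
Qed.

Lemma ext_pi_linear (V : lmodType K) a s t :
  a *: ext_pi iota s + ext_pi iota t =
  ext_pi iota ([seq ((p.1 : V), a * p.2) | p <- s] ++ t).
Proof. by apply/ext_piP=> W f; rewrite !extE. Qed.

Lemma ext_cmp_linearl X Y Z (f : ext_hom X Y) :
  linear (fun g : ext_hom Y Z => ext_cmp g f).
Proof.
move=> a g h; rewrite -(ext_reprK f) -(ext_reprK g) -(ext_reprK h).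
rewrite ext_pi_linear !ext_cmpE ext_pi_linear; apply/ext_piP=> W phi.
rewrite !extE !ext_eval_seq_cmp big_cat big_map /= scaler_sumr.
by congr (_ + _); apply: eq_bigr => p _; rewrite scalerA.
Qed.
Lemma ext_cmp_linearr X Y Z (g : ext_hom Y Z) :
  linear (ext_cmp g : ext_hom X Y -> ext_hom X Z).
Proof.
move=> a f h; rewrite -(ext_reprK f) -(ext_reprK g) -(ext_reprK h).
rewrite ext_pi_linear !ext_cmpE ext_pi_linear; apply/ext_piP=> W phi.
rewrite !extE !ext_eval_seq_cmp scaler_sumr -big_split.
apply: eq_bigr => p _ /=; rewrite big_cat big_map /= scalerDr; congr (_ + _).
rewrite !scaler_sumr; apply: eq_bigr => q _.
by rewrite !scalerA mulrCA mulrA.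
Qed.

Definition ext_cat : linCat L := LinCat ext_cmpA ext_cmp1m ext_cmpm1
  ext_cmp_linearl ext_cmp_linearr.

Lemma ext_in_cmp X Y Z (g : mor Y Z) (f : mor X Y) :
  ext_in iota (g \oc f) = ext_cmp (ext_in iota g) (ext_in iota f).
Proof. by rewrite ext_cmpE /ext_seq_cmp /= mulr1. Qed.

Definition ext_functor : functor C ext_cat :=
  @Functor _ _ C ext_cat id (fun X Y f => ext_in iota f) (fun X => erefl)
    ext_in_cmp.

End ExtCat.

Section Karoubi.
Variables (R : fieldType) (C : linCat R).

Record kar_ob := KarOb {
  kar_base : C;
  kar_idem : mor kar_base kar_base;
  kar_idemP : kar_idem \oc kar_idem = kar_idem
}.
Implicit Types X Y Z W : kar_ob.

Definition kar_mem X Y : {pred mor (kar_base X) (kar_base Y)} :=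
  [pred f | kar_idem Y \oc f \oc kar_idem X == f].

Arguments kar_mem : clear implicits.

Lemma kar_submod X Y : submod_closed (kar_mem X Y).
Proof.
split=> [|a f g]; rewrite !inE ?cmp0r ?cmp0l // => /eqP fP /eqP gP.
by rewrite cmpDr cmpZr cmpDl cmpZl fP gP.
Qed.

Definition kar_hom X Y : lmodType R := sub_lmod (Submod (kar_submod X Y)).

Lemma kar_homP X Y (f : kar_hom X Y) :
  kar_idem Y \oc sub_val f \oc kar_idem X = sub_val f.
Proof. by case: f => f /= /eqP. Qed.
Lemma kar_homl X Y (f : kar_hom X Y) : kar_idem Y \oc sub_val f = sub_val f.
Proof. by rewrite -{1}kar_homP !cmpA kar_idemP kar_homP. Qed.
Lemma kar_homr X Y (f : kar_hom X Y) : sub_val f \oc kar_idem X = sub_val f.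
Proof. by rewrite -{1}kar_homP -!cmpA kar_idemP cmpA kar_homP. Qed.

Lemma kar_id_mem X : kar_idem X \in kar_mem X X.
Proof. by rewrite inE !kar_idemP. Qed.
Lemma kar_cmp_mem X Y Z (g : kar_hom Y Z) (f : kar_hom X Y) :
  sub_val g \oc sub_val f \in kar_mem X Z.
Proof. by rewrite inE cmpA kar_homl -cmpA kar_homr. Qed.

Definition kar_id X : kar_hom X X :=
  @SubLmod _ _ (Submod (kar_submod X X)) _ (kar_id_mem X).
Definition kar_cmp X Y Z (g : kar_hom Y Z) (f : kar_hom X Y) : kar_hom X Z :=
  @SubLmod _ _ (Submod (kar_submod X Z)) _ (kar_cmp_mem g f).

Lemma kar_cmpA W X Y Z (h : kar_hom Y Z) (g : kar_hom X Y)
  (f : kar_hom W X) : kar_cmp h (kar_cmp g f) = kar_cmp (kar_cmp h g) f.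
Proof. by apply: val_inj => /=; rewrite cmpA. Qed.
Lemma kar_cmp1m X Y (f : kar_hom X Y) : kar_cmp (kar_id Y) f = f.
Proof. by apply: val_inj => /=; rewrite kar_homl. Qed.
Lemma kar_cmpm1 X Y (f : kar_hom X Y) : kar_cmp f (kar_id X) = f.
Proof. by apply: val_inj => /=; rewrite kar_homr. Qed.
Lemma kar_cmp_linearl X Y Z (f : kar_hom X Y) :
  linear (fun g : kar_hom Y Z => kar_cmp g f).
Proof. by move=> a g h; apply: val_inj => /=; rewrite cmpDl cmpZl. Qed.
Lemma kar_cmp_linearr X Y Z (g : kar_hom Y Z) :
  linear (kar_cmp g : kar_hom X Y -> kar_hom X Z).
Proof. by move=> a f h; apply: val_inj => /=; rewrite cmpDr cmpZr. Qed.

Definition kar_cat : linCat R := LinCat kar_cmpA kar_cmp1m kar_cmpm1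
  kar_cmp_linearl kar_cmp_linearr.

End Karoubi.
Record tensorCat (R : fieldType) := TensorCat {
  tcat :> linCat R;
  unit_ob : tcat;
  tens : tcat -> tcat -> tcat;
  tensm : forall X X' Y Y' : tcat,
    mor X X' -> mor Y Y' -> mor (tens X Y) (tens X' Y');
  tensm_id : forall X Y, tensm (idm X) (idm Y) = idm (tens X Y);
  tensm_cmp : forall (X X' X'' Y Y' Y'' : tcat) (f' : mor X' X'')
    (f : mor X X') (g' : mor Y' Y'') (g : mor Y Y'),
    tensm (f' \oc f) (g' \oc g) = tensm f' g' \oc tensm f g;
  tensm_linearl : forall (X X' Y Y' : tcat) (g : mor Y Y'),
    linear (fun f : mor X X' => tensm f g);
  tensm_linearr : forall (X X' Y Y' : tcat) (f : mor X X'),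
    linear (tensm f : mor Y Y' -> _);
  assoc : forall X Y Z, mor (tens (tens X Y) Z) (tens X (tens Y Z));
  associ : forall X Y Z, mor (tens X (tens Y Z)) (tens (tens X Y) Z);
  assocK : forall X Y Z, associ X Y Z \oc assoc X Y Z = idm _;
  associK : forall X Y Z, assoc X Y Z \oc associ X Y Z = idm _;
  assoc_nat : forall (X X' Y Y' Z Z' : tcat) (f : mor X X') (g : mor Y Y')
    (h : mor Z Z'), assoc X' Y' Z' \oc tensm (tensm f g) h =
                    tensm f (tensm g h) \oc assoc X Y Z;
  lunit : forall X, mor (tens unit_ob X) X;
  lunit_iso : forall X, is_iso (lunit X);
  lunit_nat : forall (X Y : tcat) (f : mor X Y),
    lunit Y \oc tensm (idm unit_ob) f = f \oc lunit X;
  runit : forall X, mor (tens X unit_ob) X;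
  runit_iso : forall X, is_iso (runit X);
  runit_nat : forall (X Y : tcat) (f : mor X Y),
    runit Y \oc tensm f (idm unit_ob) = f \oc runit X;
  braid : forall X Y, mor (tens X Y) (tens Y X);
  braid_nat : forall (X X' Y Y' : tcat) (f : mor X X') (g : mor Y Y'),
    braid X' Y' \oc tensm f g = tensm g f \oc braid X Y;
  braidK : forall X Y, braid Y X \oc braid X Y = idm _;
  triangle : forall X Y, tensm (idm X) (lunit Y) \oc assoc X unit_ob Y =
    tensm (runit X) (idm Y);
  pentagon : forall W X Y Z,
    assoc W X (tens Y Z) \oc assoc (tens W X) Y Z =
    tensm (idm W) (assoc X Y Z) \oc assoc W (tens X Y) Z
      \oc tensm (assoc W X Y) (idm Z);
  hexagon : forall X Y Z,
    assoc Y Z X \oc braid X (tens Y Z) \oc assoc X Y Z =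
    tensm (idm Y) (braid X Z) \oc assoc Y X Z \oc tensm (braid X Y) (idm Z)
}.
Arguments unit_ob {R t}.
Arguments tensm {R t X X' Y Y'} f g.
Arguments assoc {R t} X Y Z.
Arguments associ {R t} X Y Z.
Arguments lunit {R t} X.
Arguments runit {R t} X.
Arguments braid {R t} X Y.
Notation "X \ox Y" := (tens X Y).
Notation "f \om g" := (tensm f g).

Record rigidCat (K : fieldType) := RigidCat {
  rcat :> tensorCat K;
  rcat_additive : additive_cat rcat;
  dual : rcat -> rcat;
  coev : forall M : rcat, mor unit_ob (M \ox dual M);
  ev : forall M : rcat, mor (dual M \ox M) unit_ob;
  snake1 : forall M : rcat,
    runit M \oc (idm M \om ev M) \oc assoc M (dual M) M \oc (coev M \om idm M) =
    lunit M;
  snake2 : forall M : rcat,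
    lunit (dual M) \oc (ev M \om idm (dual M)) \oc associ (dual M) M (dual M)
      \oc (idm (dual M) \om coev M) = runit (dual M);
  end_unit : bijective (fun a : K => a *: idm (@unit_ob K rcat))
}.
Arguments dual {K r} M.
Arguments coev {K r} M.
Arguments ev {K r} M.

Section TensorTheory.
Variables (R : fieldType) (C : tensorCat R).
Implicit Types X Y Z W : C.
Local Notation one := (@unit_ob R C).
Local Notation "1_ X" := (idm X) (at level 8, X at level 2, format "1_ X").

Lemma tensm_cmpl X X' X'' Y (f' : mor X' X'') (f : mor X X') :
  (f' \oc f) \om 1_Y = (f' \om 1_Y) \oc (f \om 1_Y).
Proof. by rewrite -tensm_cmp cmp1m. Qed.
Lemma tensm_cmpr X X' X'' Y (f' : mor X' X'') (f : mor X X') :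
  1_Y \om (f' \oc f) = (1_Y \om f') \oc (1_Y \om f).
Proof. by rewrite -tensm_cmp cmp1m. Qed.
Lemma tensm_swap X X' Y Y' (f : mor X X') (g : mor Y Y') :
  (f \om 1_Y') \oc (1_X \om g) = (1_X' \om g) \oc (f \om 1_Y).
Proof. by rewrite -!tensm_cmp !cmp1m !cmpm1. Qed.

Lemma lunit_inj X Y (f g : mor X Y) : 1_one \om f = 1_one \om g -> f = g.
Proof.
move=> e; apply: (cmp_isor (lunit_iso X)).
by rewrite -!lunit_nat e.
Qed.
Lemma runit_inj X Y (f g : mor X Y) : f \om 1_one = g \om 1_one -> f = g.
Proof.
move=> e; apply: (cmp_isor (runit_iso X)).
by rewrite -!runit_nat e.
Qed.

Lemma assoc_iso X Y Z : is_iso (assoc X Y Z).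
Proof. by exists (associ X Y Z); rewrite assocK associK. Qed.

Lemma tensm_iso X X' Y Y' (f : mor X X') (g : mor Y Y') :
  is_iso f -> is_iso g -> is_iso (f \om g).
Proof.
case=> f' [f1 f2] [g' [g1 g2]]; exists (f' \om g').
by rewrite -!tensm_cmp f1 f2 g1 g2 !tensm_id.
Qed.

Lemma lunit_tens X Y :
  lunit (X \ox Y) \oc assoc one X Y = lunit X \om 1_Y.
Proof.
apply: lunit_inj.
have i1 : is_iso (assoc one (one \ox X) Y \oc (assoc one one X \om 1_Y)).
  apply: is_iso_cmp; first exact: assoc_iso.
  by apply: tensm_iso; [exact: assoc_iso | exact: is_iso_id].
apply: (cmp_isor i1); rewrite tensm_cmpr -!cmpA.
rewrite [(_ \om assoc one X Y) \oc _]cmpA -pentagon cmpA triangle.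
rewrite -tensm_id -assoc_nat cmpA -assoc_nat -cmpA -tensm_cmpl.
by rewrite triangle.
Qed.

Lemma runit_tens X Y :
  (1_X \om runit Y) \oc assoc X Y one = runit (X \ox Y).
Proof.
apply: runit_inj; apply: (cmp_isol (assoc_iso X Y one)).
rewrite tensm_cmpl cmpA assoc_nat.
have /(congr1 (cmp (1_X \om (1_Y \om lunit one)))) := pentagon X Y one one.
rewrite !cmpA -assoc_nat -[_ \om _ \oc (_ \om assoc _ _ _)]tensm_cmpr triangle.
by rewrite tensm_id -cmpA triangle => ->.
Qed.

Lemma lunit_runit1 : lunit one = runit one :> mor (one \ox one) one.
Proof.
apply: runit_inj; rewrite -triangle -lunit_tens; congr (_ \oc _).
apply: (cmp_isol (lunit_iso one)); exact/esym/lunit_nat.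
Qed.

End TensorTheory.

Section Rigid.
Variables (K : fieldType) (A : rigidCat K).
Implicit Types M N P : A.
Local Notation one := (@unit_ob K A).
Local Notation "1_ X" := (idm X) (at level 8, X at level 2, format "1_ X").

(* The trace takes its values in End(1), which is K by [end_unit]. *)
Definition tr M (f : mor M M) : mor one one :=
  ev M \oc braid M (dual M) \oc (f \om 1_(dual M)) \oc coev M.


Lemma snake_tens N P :
  (1_N \om (lunit P \oc (ev N \om 1_P) \oc associ (dual N) N P))
    \oc assoc N (dual N) (N \ox P) \oc (coev N \om 1_(N \ox P))
  = lunit (N \ox P).
Proof.
apply: (cmp_isor (assoc_iso one N P)); rewrite lunit_tens -(snake1 N).
rewrite -!cmpA -tensm_id -assoc_nat (cmp_eqr1 _ (pentagon _ _ _ _)).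
rewrite !tensm_cmpl !tensm_cmpr -!cmpA.
rewrite [(_ \om associ _ _ _) \oc (_ \oc _)]cmpA -tensm_cmpr assocK tensm_id.
rewrite cmp1m -(cmp_eqr _ (assoc_nat _ _ _)) [LHS]cmpA triangle.
by [].
Qed.

Lemma transpose_exists M N (f : mor M N) :
  exists ft : mor (dual N) (dual M),
    (1_N \om ft) \oc coev N = (f \om 1_(dual M)) \oc coev M /\
    ev M \oc (ft \om 1_M) = ev N \oc (1_(dual N) \om f).
Proof.
have [r [r1 r2]] := runit_iso (dual N).
set v := (f \om 1_(dual M)) \oc coev M.
pose g := lunit (dual M) \oc (ev N \om 1_(dual M))
            \oc associ (dual N) N (dual M) \oc (1_(dual N) \om v).
exists (g \oc r); split.
  apply: (cmp_isor (runit_iso one)).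
  rewrite -cmpA -runit_nat -runit_tens tensm_cmpr -!cmpA.
  rewrite [(_ \om r) \oc (_ \oc _)]cmpA -tensm_cmpr r1 tensm_id cmp1m.
  rewrite /g tensm_cmpr -!cmpA -(cmp_eqr _ (assoc_nat _ _ _)) tensm_id.
  rewrite -tensm_swap !cmpA snake_tens lunit_nat.
  by rewrite lunit_runit1.
have ir : is_iso (runit (dual N) \om 1_M).
  by apply: tensm_iso; [exact: runit_iso | exact: is_iso_id].
have gr : ((g \oc r) \om 1_M) \oc (runit (dual N) \om 1_M) = g \om 1_M.
  by rewrite -tensm_cmpl -cmpA r1 cmpm1.
apply: (cmp_isor ir); rewrite -[LHS]cmpA gr -!cmpA -triangle {gr ir}.
pose s := (1_M \om ev M) \oc assoc M (dual M) M \oc (coev M \om 1_M).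
have gE : ev M \oc (g \om 1_M) = lunit one \oc (ev N \om 1_one)
    \oc associ (dual N) N one \oc (1_(dual N) \om ((f \om 1_one) \oc s))
    \oc assoc (dual N) one M.
  rewrite /g !tensm_cmpl -!cmpA.
  rewrite -(cmp_eqr1 _ (lunit_tens _ _)) -(cmp_eqr _ (lunit_nat _)).
  rewrite (cmp_eqr _ (assoc_nat _ _ _)) tensm_id.
  rewrite -(cmp_eqr _ (tensm_swap _ _)).
  congr (_ \oc (_ \oc _)); apply: (cmp_isol (assoc_iso _ _ _)).
  rewrite [RHS]cmpA associK cmp1m -tensm_id (cmp_eqr _ (assoc_nat _ _ _)).
  rewrite (cmp_eqr1 _ (pentagon _ _ _ _)) -!cmpA.
  rewrite [((assoc _ _ _) \om _) \oc (_ \oc _)]cmpA -tensm_cmpl associK tensm_id.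
  rewrite cmp1m assoc_nat 2![LHS]cmpA -2!tensm_cmpr; congr ((_ \om _) \oc _).
  rewrite /v tensm_cmpl /s !cmpA; congr (_ \oc _).
  by rewrite tensm_swap -!cmpA assoc_nat tensm_id.
have runitE : lunit one \oc (ev N \om 1_one) \oc associ (dual N) N one =
    ev N \oc (1_(dual N) \om runit N).
  apply: (cmp_isor (assoc_iso _ _ _)).
  rewrite -!cmpA assocK cmpm1 runit_tens lunit_runit1; exact: runit_nat.
rewrite gE runitE -!cmpA; congr (_ \oc _); rewrite !cmpA -!tensm_cmpr.
congr ((_ \om _) \oc _).
by rewrite !cmpA runit_nat -snake1 !cmpA.
Qed.

Lemma tr_cyclic M N (f : mor M N) (g : mor N M) : tr (g \oc f) = tr (f \oc g).
Proof.
have [ft [f1 f2]] := transpose_exists f.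
rewrite /tr !tensm_cmpl -!cmpA -f1 [(g \om _) \oc (_ \oc _)]cmpA tensm_swap.
rewrite -!cmpA (cmp_eqr _ (braid_nat _ _)) [LHS]cmpA f2 -cmpA.
by rewrite -(cmp_eqr _ (braid_nat _ _)).
Qed.

Lemma tr_linear M : linear (@tr M).
Proof.
move=> a f g; rewrite /tr.
by rewrite (tensm_linearl (1_(dual M)) a f g) cmpDr cmpZr cmpDl cmpZl.
Qed.


Definition numtriv M N : {pred mor M N} :=
  [pred f | `[< forall g : mor N M, tr (g \oc f) = 0 >] ].
Arguments numtriv : clear implicits.

Lemma numtrivP M N (f : mor M N) :
  reflect (forall g : mor N M, tr (g \oc f) = 0) (f \in numtriv M N).
Proof. exact: asboolP. Qed.

Lemma trD M (f g : mor M M) : tr (f + g) = tr f + tr g.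
Proof. by have := tr_linear 1 f g; rewrite !scale1r. Qed.
Lemma tr0 M : tr (0 : mor M M) = 0.
Proof. by apply: (addrI (tr (0 : mor M M))); rewrite -trD !addr0. Qed.
Lemma trZ M a (f : mor M M) : tr (a *: f) = a *: tr f.
Proof. by have := tr_linear a f 0; rewrite tr0 !addr0. Qed.

Lemma numtriv_submod M N : submod_closed (numtriv M N).
Proof.
split=> [|a f g /numtrivP fP /numtrivP gP]; apply/numtrivP=> h.
  by rewrite cmp0r tr0.
by rewrite cmpDr cmpZr trD trZ fP gP scaler0 addr0.
Qed.
Lemma numtriv_cmpl M N P (g : mor N P) (f : mor M N) :
  f \in numtriv M N -> g \oc f \in numtriv M P.
Proof. by move=> /numtrivP fP; apply/numtrivP=> h; rewrite cmpA fP. Qed.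
Lemma numtriv_cmpr M N P (g : mor N P) (f : mor M N) :
  g \in numtriv N P -> g \oc f \in numtriv M P.
Proof.
move=> /numtrivP gP; apply/numtrivP=> h.
by rewrite cmpA tr_cyclic cmpA gP.
Qed.

Definition num_ideal : cat_ideal A :=
  CatIdeal numtriv_submod numtriv_cmpl numtriv_cmpr.
Definition num_quot : linCat K := quot_cat num_ideal.
Definition num_proj : functor A num_quot := quot_functor num_ideal.

Record tensor_aut := TensorAut {
  taut :> forall M : A, mor M M;
  taut_nat : forall (M N : A) (f : mor M N), taut N \oc f = f \oc taut M;
  taut_iso : forall M, is_iso (taut M);
  taut_tens : forall M N, taut (M \ox N) = taut M \om taut N
}.

Definition num_aut (F : tensor_aut) : forall M : num_quot, mor M M :=
  fun M => fmap num_proj (F M).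

Lemma num_aut_nat (F : tensor_aut) (M N : num_quot) (f : mor M N) :
  num_aut F N \oc f = f \oc num_aut F M.
Proof.
by rewrite -(qpi_reprK f) /= !quot_cmpE taut_nat.
Qed.

Fixpoint tpow M n : A := if n is n'.+1 then M \ox tpow M n' else one.

Definition swap12 M N P : mor (M \ox (N \ox P)) (N \ox (M \ox P)) :=
  assoc N M P \oc (braid M N \om 1_P) \oc associ M N P.

(* Moves the first tensor factor to position k (counted from 0), the order of
   the others being kept. *)
Fixpoint first_to M n (k : nat) : mor (tpow M n.+1) (tpow M n.+1) :=
  match n, k with
  | n'.+1, k'.+1 => (1_M \om first_to M n' k') \oc swap12 M M (tpow M n')
  | _, _ => idm _
  end.

(* The action of the symmetric group on M^{(x) n} given by the symmetry: s moves
   the i-th factor to position s(i). If s(0) = k, then s = lift_perm ord0 k t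
   for a unique t, which acts on the last factors before the first one is moved
   to position k. *)
Fixpoint perm_act M n : 'S_n -> mor (tpow M n) (tpow M n) :=
  if n is n'.+1 then fun s =>
    let t := odflt 1%g [pick t | s == lift_perm ord0 (s ord0) t] in
    first_to M n' (s ord0) \oc (1_M \om perm_act M t)
  else fun=> 1_one.

(* Projectors onto the exterior and symmetric powers of M in characteristic 0;
   a power vanishes exactly when its projector is 0. *)
Definition alt_proj M n : mor (tpow M n) (tpow M n) :=
  n`!%:R^-1 *: \sum_(s : 'S_n) (-1) ^+ s *: perm_act M s.
Definition sym_proj M n : mor (tpow M n) (tpow M n) :=
  n`!%:R^-1 *: \sum_(s : 'S_n) perm_act M s.

Definition kimura_finite M := exists Mp Mm : A,
  [/\ is_biprod Mp Mm M,
      exists2 n, (0 < n)%N & alt_proj Mp n = 0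
    & exists2 n, (0 < n)%N & sym_proj Mm n = 0].

End Rigid.

(* Symmetric strong monoidal functors, linear along iota. *)
Record tensorFunctor (K L : fieldType) (iota : {rmorphism K -> L})
    (A : tensorCat K) (B : tensorCat L) := TensorFunctor {
  tfun :> functor A B;
  tfun_linear : linear_functor iota tfun;
  tfun_mu : forall M N : A, mor (tfun M \ox tfun N) (tfun (M \ox N));
  tfun_mu_iso : forall M N, is_iso (tfun_mu M N);
  tfun_mu_nat : forall (M M' N N' : A) (f : mor M M') (g : mor N N'),
    tfun_mu M' N' \oc (fmap tfun f \om fmap tfun g) =
    fmap tfun (f \om g) \oc tfun_mu M N;
  tfun_eta : mor unit_ob (tfun unit_ob);
  tfun_eta_iso : is_iso tfun_eta;
  tfun_assoc : forall M N P : A,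
    fmap tfun (assoc M N P) \oc tfun_mu (M \ox N) P
      \oc (tfun_mu M N \om idm (tfun P)) =
    tfun_mu M (N \ox P) \oc (idm (tfun M) \om tfun_mu N P)
      \oc assoc (tfun M) (tfun N) (tfun P);
  tfun_lunit : forall M : A,
    fmap tfun (lunit M) \oc tfun_mu unit_ob M \oc (tfun_eta \om idm (tfun M)) =
    lunit (tfun M);
  tfun_runit : forall M : A,
    fmap tfun (runit M) \oc tfun_mu M unit_ob \oc (idm (tfun M) \om tfun_eta) =
    runit (tfun M);
  tfun_braid : forall M N : A,
    fmap tfun (braid M N) \oc tfun_mu M N =
    tfun_mu N M \oc braid (tfun M) (tfun N)
}.

Section VectTensor.
Variable L : fieldType.
Implicit Types V W : vectType L.

(* Model of V (x) W: matrices of coordinates in the chosen bases of V and W.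
   [vpure x y] is x (x) y and [vlift] extends a bilinear map to V (x) W. *)
Definition vtens V W : vectType L := 'M[L]_(\dim {:V}, \dim {:W}).
Definition vcrd V (i : 'I_(\dim {:V})) (x : V) : L := coord (vbasis {:V}) i x.
Definition vbas V (i : 'I_(\dim {:V})) : V := (vbasis {:V})`_i.
Definition vpure V W (x : V) (y : W) : vtens V W :=
  \matrix_(i, j) (vcrd i x * vcrd j y).

Definition bilin (A B U : lmodType L) (b : A -> B -> U) :=
  (forall y, linear (b^~ y)) /\ (forall x, linear (b x)).

Definition vlift V W (U : lmodType L) (b : V -> W -> U) (t : vtens V W) : U :=
  \sum_i \sum_j t i j *: b (vbas i) (vbas j).

Lemma linear_fun0 (A B : lmodType L) (f : A -> B) : linear f -> f 0 = 0.
Proof. by move=> lf; have := lf (-1) 0 0; rewrite scaler0 addr0 scaleN1r addNr. Qed.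
Lemma linear_funD (A B : lmodType L) (f : A -> B) x y :
  linear f -> f (x + y) = f x + f y.
Proof. by move=> lf; have := lf 1 x y; rewrite !scale1r. Qed.
Lemma linear_funZ (A B : lmodType L) (f : A -> B) a x :
  linear f -> f (a *: x) = a *: f x.
Proof. by move=> lf; have := lf a x 0; rewrite (linear_fun0 lf) !addr0. Qed.
Lemma linear_fun_sum (A B : lmodType L) (f : A -> B) I (r : seq I) (F : I -> A) :
  linear f -> f (\sum_(i <- r) F i) = \sum_(i <- r) f (F i).
Proof.
move=> lf; elim: r => [|i r IH]; first by rewrite !big_nil linear_fun0.
by rewrite !big_cons linear_funD ?IH.
Qed.

Lemma vcrd_linear V (i : 'I_(\dim {:V}))  a u v :
  vcrd i (a *: u + v) = a * vcrd i u + vcrd i v.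
Proof. by rewrite /vcrd linearP. Qed.

Lemma vcrd_bas V (i j : 'I_(\dim {:V})) : vcrd i (vbas j) = (j == i)%:R.
Proof. exact/coord_free/basis_free/vbasisP. Qed.

Lemma vpure_bilin V W : bilin (@vpure V W).
Proof.
split=> [y|x] a u v; apply/matrixP=> i j; rewrite !mxE vcrd_linear.
  by rewrite mulrDl mulrA.
by rewrite mulrDr mulrCA.
Qed.

Lemma vlift_linear V W (U : lmodType L) (b : V -> W -> U) : linear (vlift b).
Proof.
move=> a s t; rewrite /vlift scaler_sumr -big_split; apply: eq_bigr => i _ /=.
rewrite scaler_sumr -big_split; apply: eq_bigr => j _ /=.
by rewrite !mxE scalerDl scalerA.
Qed.

Lemma vect_sum V (x : V) : x = \sum_i vcrd i x *: vbas i.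
Proof. exact/coord_vbasis/memvf. Qed.

Lemma vliftE V W (U : lmodType L) (b : V -> W -> U) x y :
  bilin b -> vlift b (vpure x y) = b x y.
Proof.
case=> b1 b2; rewrite [in RHS](vect_sum x) (linear_fun_sum _ _ (b1 y)).
apply: eq_bigr => i _; rewrite (linear_funZ _ _ (b1 y)).
rewrite [in RHS](vect_sum y) (linear_fun_sum _ _ (b2 _)) scaler_sumr.
apply: eq_bigr => j _; rewrite (linear_funZ _ _ (b2 _)) scalerA.
by rewrite /vpure mxE.
Qed.

Lemma vtens_ext V W (U : lmodType L) (f g : vtens V W -> U) :
  linear f -> linear g -> (forall x y, f (vpure x y) = g (vpure x y)) -> f =1 g.
Proof.
move=> lf lg fg t; rewrite [t]matrix_sum_delta.
rewrite !linear_fun_sum //; apply: eq_bigr => i _.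
rewrite !linear_fun_sum //; apply: eq_bigr => j _.
rewrite !linear_funZ //; congr (_ *: _).
suff -> : delta_mx i j = vpure (vbas i) (vbas j) by [].
apply/matrixP=> k l; rewrite !mxE !vcrd_bas -natrM mulnb.
by rewrite (eq_sym k) (eq_sym l).
Qed.

End VectTensor.

Section SuperVect.
Variable L : fieldType.

(* Z/2-graded finite-dimensional L-vector spaces V = V^+ (+) V^-; morphisms
   [shom] are the linear maps of degree 0, and [stot V] is the total space. *)
Record supervect := SuperVect { svp : vectType L; svm : vectType L }.
Implicit Types U V W : supervect.

Definition stot V : vectType L := (svp V * svm V)%type.

Definition shom V W : lmodType L :=
  ('Hom(svp V, svp W) * 'Hom(svm V, svm W))%type.
Definition sid V : shom V V := (\1%VF, \1%VF).
Definition scmp U V W (g : shom V W) (f : shom U V) : shom U W :=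
  ((g.1 \o f.1)%VF, (g.2 \o f.2)%VF).

Definition sapp V W (f : shom V W) (x : stot V) : stot W := (f.1 x.1, f.2 x.2).

Lemma sapp_linear V W (f : shom V W) : linear (sapp f).
Proof. by move=> a x y; rewrite /sapp !linearP. Qed.
Lemma sapp_id V x : sapp (sid V) x = x.
Proof. by case: x => x y; rewrite /sapp !id_lfunE. Qed.
Lemma sapp_cmp U V W (g : shom V W) (f : shom U V) x :
  sapp (scmp g f) x = sapp g (sapp f x).
Proof. by rewrite /sapp !comp_lfunE. Qed.
Lemma sapp_ext V W (f g : shom V W) : sapp f =1 sapp g -> f = g.
Proof.
move=> e; case: f g e => f0 f1 [g0 g1] e; congr (_, _); apply/lfunP=> x.
  by have [] := e (x, 0).
by have [] := e (0, x).
Qed.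
Lemma sapp_linear2 V W a (f g : shom V W) x :
  sapp (a *: f + g) x = a *: sapp f x + sapp g x.
Proof. by rewrite /sapp /= !add_lfunE !scale_lfunE. Qed.

Lemma scmpA (T U V W : supervect) (h : shom V W) (g : shom U V) (f : shom T U) :
  scmp h (scmp g f) = scmp (scmp h g) f.
Proof. by apply: sapp_ext => x; rewrite !sapp_cmp. Qed.
Lemma scmp1m V W (f : shom V W) : scmp (sid W) f = f.
Proof. by apply: sapp_ext => x; rewrite sapp_cmp sapp_id. Qed.
Lemma scmpm1 V W (f : shom V W) : scmp f (sid V) = f.
Proof. by apply: sapp_ext => x; rewrite sapp_cmp sapp_id. Qed.
Lemma scmp_linearl U V W (f : shom U V) :
  linear (fun g : shom V W => scmp g f).
Proof.
by move=> a g h; apply: sapp_ext => x; rewrite !(sapp_linear2, sapp_cmp).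
Qed.
Lemma scmp_linearr U V W (g : shom V W) :
  linear (scmp g : shom U V -> shom U W).
Proof.
move=> a f h; apply: sapp_ext => x; rewrite !(sapp_linear2, sapp_cmp).
exact: sapp_linear.
Qed.

Definition svect_cat : linCat L :=
  LinCat scmpA scmp1m scmpm1 scmp_linearl scmp_linearr.

Definition stens V W : supervect := SuperVect
  (vtens (svp V) (svp W) * vtens (svm V) (svm W))%type
  (vtens (svp V) (svm W) * vtens (svm V) (svp W))%type.

Definition spure V W (x : stot V) (y : stot W) : stot (stens V W) :=
  ((vpure x.1 y.1, vpure x.2 y.2), (vpure x.1 y.2, vpure x.2 y.1)).

(* Linear map on the total space of V (x) W given by a bilinear map. *)
Definition slift V W (U : lmodType L) (b : stot V -> stot W -> U)
    (t : stot (stens V W)) : U :=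
    vlift (fun x y => b (x, 0) (y, 0)) t.1.1
  + vlift (fun x y => b (0, x) (0, y)) t.1.2
  + vlift (fun x y => b (x, 0) (0, y)) t.2.1
  + vlift (fun x y => b (0, x) (y, 0)) t.2.2.

(* The degree 0 part of a linear map between total spaces. *)
Definition seven V W (g : stot V -> stot W) : shom V W :=
  (linfun (fun x => (g (x, 0)).1), linfun (fun y => (g (0, y)).2)).

Definition spar (p : bool) V (x : stot V) := if p then x.1 = 0 else x.2 = 0.

Lemma linfun_apply (A B : vectType L) (f : A -> B) :
  linear f -> linfun f =1 f.
Proof.
move=> lf; pose g := HB.pack_for {linear A -> B} f
  (GRing.isLinear.Build _ _ _ _ _ lf).
exact: (lfunE g).
Qed.

Lemma inl_linear V : linear (fun x : svp V => (x, 0) : stot V).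
Proof. by move=> a u v; congr (_, _); rewrite /= scaler0 addr0. Qed.
Lemma inr_linear V : linear (fun x : svm V => (0, x) : stot V).
Proof. by move=> a u v; congr (_, _); rewrite /= scaler0 addr0. Qed.

Lemma seven_apply V W (g : stot V -> stot W) x : linear g ->
  sapp (seven g) x = ((g (x.1, 0)).1, (g (0, x.2)).2).
Proof.
move=> lg; congr (_, _); rewrite linfun_apply // => a u v.
  by rewrite inl_linear lg.
by rewrite inr_linear lg.
Qed.

Lemma stot_split V (x : stot V) : x = (x.1, 0) + (0, x.2) :> stot V.
Proof. by case: x => x y; congr (_, _); rewrite /= ?addr0 ?add0r. Qed.

Lemma sevenE V W (g : stot V -> stot W) x : linear g ->
  (forall p y, spar p y -> spar p (g y)) -> sapp (seven g) x = g x.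
Proof.
move=> lg pg; rewrite seven_apply // [x in RHS]stot_split linear_funD //.
have := pg false (x.1, 0) erefl; have := pg true (0, x.2) erefl => /=.
case: (g _) => a b /= ->; case: (g _) => c d /= ->.
by congr (_, _); rewrite /= ?addr0 ?add0r.
Qed.

Lemma bilin_pair V W (U : lmodType L) (b : stot V -> stot W -> U)
  (A B : lmodType L) (f : A -> stot V) (g : B -> stot W) :
  linear f -> linear g -> bilin b -> bilin (fun x y => b (f x) (g y)).
Proof.
move=> lf lg [b1 b2]; split=> [y|x] a u v; first by rewrite lf b1.
by rewrite lg b2.
Qed.

Lemma slift_linear V W (U : lmodType L) (b : stot V -> stot W -> U) : linear (slift b).
Proof.
move=> a s t; rewrite /slift.
have -> : (a *: s + t).1.1 = a *: s.1.1 + t.1.1 by [].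
have -> : (a *: s + t).1.2 = a *: s.1.2 + t.1.2 by [].
have -> : (a *: s + t).2.1 = a *: s.2.1 + t.2.1 by [].
have -> : (a *: s + t).2.2 = a *: s.2.2 + t.2.2 by [].
rewrite !vlift_linear !scalerDr.
by rewrite (AC (2*2*2*2) ((1*3*5*7)*(2*4*6*8))).
Qed.

Lemma sliftE V W (U : lmodType L) (b : stot V -> stot W -> U) x y :
  bilin b -> slift b (spure x y) = b x y.
Proof.
move=> bb; rewrite /slift !vliftE; first last.
1-4: by apply: bilin_pair bb => //; (exact: inl_linear || exact: inr_linear).
case: bb => b1 b2; rewrite [x in RHS]stot_split [y in RHS]stot_split.
rewrite (linear_funD _ _ (b1 _)) !(linear_funD _ _ (b2 _)) -!addrA; congr (_ + _).
by rewrite addrC -!addrA.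
Qed.

Lemma slift_par d V W U (b : stot V -> stot W -> stot U) :
  (forall p q x y, spar p x -> spar q y -> spar (p (+) q (+) d) (b x y)) ->
  forall p t, spar p t -> spar (p (+) d) (slift b t).
Proof.
move=> pb p [[t1 t2] [t3 t4]].
have par0 e : spar e (0 : stot U) by case: e.
have parD e (x y : stot U) : spar e x -> spar e y -> spar e (x + y).
  by case: e => /= ->; rewrite add0r.
have parZ e a (x : stot U) : spar e x -> spar e (a *: x).
  by case: e => /= ->; rewrite scaler0.
have parL e (A B : vectType L) (c : A -> B -> stot U) t :
    (forall x y, spar e (c x y)) -> spar e (vlift c t).
  move=> H; apply: (big_ind (@spar e U)) => [||i _]; [exact: par0|exact: parD|].
  apply: (big_ind (@spar e U)) => [||k _]; [exact: par0|exact: parD|].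
  exact/parZ/H.
have lift0 (A B : vectType L) (c : A -> B -> stot U) : vlift c 0 = 0.
  exact: linear_fun0 (vlift_linear _).
case: p => /= -[-> ->]; rewrite /slift /= !lift0 ?addr0 ?add0r.
  by apply: parD; apply: parL => x y;
    [apply: (pb false true) | apply: (pb true false)].
by apply: parD; apply: parL => x y;
  [apply: (pb false false) | apply: (pb true true)].
Qed.

Lemma spure_bilin V W : bilin (@spure V W).
Proof.
have v1 (A B : vectType L) a u v (y : B) :
  @vpure L A B (a *: u + v) y = a *: vpure u y + vpure v y.
  exact: (vpure_bilin A B).1.
have v2 (A B : vectType L) a u v (x : A) :
  @vpure L A B x (a *: u + v) = a *: vpure x u + vpure x v.
  exact: (vpure_bilin A B).2.
by split=> [y|x] a u v; rewrite /spure /= ?v1 ?v2.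
Qed.

Lemma vpure0l (A B : vectType L) y : @vpure L A B 0 y = 0.
Proof. exact: linear_fun0 ((vpure_bilin A B).1 y). Qed.
Lemma vpure0r (A B : vectType L) x : @vpure L A B x 0 = 0.
Proof. exact: linear_fun0 ((vpure_bilin A B).2 x). Qed.

Lemma spure_par V W p q (x : stot V) (y : stot W) :
  spar p x -> spar q y -> spar (p (+) q) (spure x y).
Proof.
by case: p q => [] [] /= ex ey; rewrite ?ex ?ey ?vpure0l ?vpure0r.
Qed.

Lemma stens_ext V W (U : lmodType L) (f g : stot (stens V W) -> U) :
  linear f -> linear g -> (forall x y, f (spure x y) = g (spure x y)) -> f =1 g.
Proof.
move=> lf lg fg [[t1 t2] [t3 t4]].
pose j1 t : stot (stens V W) := ((t, 0), (0, 0)).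
pose j2 t : stot (stens V W) := ((0, t), (0, 0)).
pose j3 t : stot (stens V W) := ((0, 0), (t, 0)).
pose j4 t : stot (stens V W) := ((0, 0), (0, t)).
have l1 : linear j1 by move=> a u v; rewrite /j1; do ![congr (_, _)];
  rewrite /= ?scaler0 ?addr0.
have l2 : linear j2 by move=> a u v; rewrite /j2; do ![congr (_, _)];
  rewrite /= ?scaler0 ?addr0.
have l3 : linear j3 by move=> a u v; rewrite /j3; do ![congr (_, _)];
  rewrite /= ?scaler0 ?addr0.
have l4 : linear j4 by move=> a u v; rewrite /j4; do ![congr (_, _)];
  rewrite /= ?scaler0 ?addr0.
have -> : ((t1, t2), (t3, t4)) = j1 t1 + j2 t2 + j3 t3 + j4 t4 :> stot (stens V W).
  by do ![congr (_, _)]; rewrite /= ?addr0 ?add0r.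
have lc (A : lmodType L) (h : stot (stens V W) -> U) (j : A -> _) :
  linear h -> linear j -> linear (h \o j) by move=> lh lj a u v /=; rewrite lj lh.
rewrite !linear_funD //; congr (_ + _ + _ + _).
- apply: (vtens_ext (lc _ f j1 lf l1) (lc _ g j1 lg l1)) => x y /=.
  have -> : j1 (vpure x y) = spure ((x, 0) : stot V) ((y, 0) : stot W).
    by rewrite /spure /= !(vpure0l, vpure0r).
  exact: fg.
- apply: (vtens_ext (lc _ f j2 lf l2) (lc _ g j2 lg l2)) => x y /=.
  have -> : j2 (vpure x y) = spure ((0, x) : stot V) ((0, y) : stot W).
    by rewrite /spure /= !(vpure0l, vpure0r).
  exact: fg.
- apply: (vtens_ext (lc _ f j3 lf l3) (lc _ g j3 lg l3)) => x y /=.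
  have -> : j3 (vpure x y) = spure ((x, 0) : stot V) ((0, y) : stot W).
    by rewrite /spure /= !(vpure0l, vpure0r).
  exact: fg.
- apply: (vtens_ext (lc _ f j4 lf l4) (lc _ g j4 lg l4)) => x y /=.
  have -> : j4 (vpure x y) = spure ((0, x) : stot V) ((y, 0) : stot W).
    by rewrite /spure /= !(vpure0l, vpure0r).
  exact: fg.
Qed.

Lemma linear_comp (A B C : lmodType L) (f : B -> C) (g : A -> B) :
  linear f -> linear g -> linear (fun x => f (g x)).
Proof. by move=> lf lg a u v; rewrite lg lf. Qed.

Lemma spure_linl V W (y : stot W) : linear (fun x : stot V => spure x y).
Proof. exact: (spure_bilin V W).1. Qed.
Lemma spure_linr V W (x : stot V) : linear (@spure V W x).
Proof. exact: (spure_bilin V W).2. Qed.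

Lemma sapp_ext2 V W U (f g : shom (stens V W) U) :
  (forall x y, sapp f (spure x y) = sapp g (spure x y)) -> f = g.
Proof.
move=> e; apply: sapp_ext; apply: stens_ext e; exact: sapp_linear.
Qed.
Lemma sapp_ext3l V W X U (f g : shom (stens (stens V W) X) U) :
  (forall x y z, sapp f (spure (spure x y) z) = sapp g (spure (spure x y) z)) ->
  f = g.
Proof.
move=> e; apply: sapp_ext2 => t z; move: t.
apply: stens_ext => [||x y]; last exact: e;
  by apply: linear_comp; [exact: sapp_linear | exact: spure_linl].
Qed.
Lemma sapp_ext3r V W X U (f g : shom (stens V (stens W X)) U) :
  (forall x y z, sapp f (spure x (spure y z)) = sapp g (spure x (spure y z))) ->
  f = g.
Proof.
move=> e; apply: sapp_ext2 => x.
apply: stens_ext => [||y z]; last exact: e;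
  by apply: linear_comp; [exact: sapp_linear | exact: spure_linr].
Qed.
Lemma sapp_ext4l V W X Y U (f g : shom (stens (stens (stens V W) X) Y) U) :
  (forall x y z t, sapp f (spure (spure (spure x y) z) t) =
                   sapp g (spure (spure (spure x y) z) t)) -> f = g.
Proof.
move=> e; apply: sapp_ext3l => s z t; move: s.
apply: stens_ext => [||x y]; last exact: e;
  exact: (linear_comp (sapp_linear _)
    (linear_comp (spure_linl t) (spure_linl z))).
Qed.

Definition stensm V V' W W' (f : shom V V') (g : shom W W') :
    shom (stens V W) (stens V' W') :=
  seven (slift (fun x y => spure (sapp f x) (sapp g y))).

Definition sassoc U V W : shom (stens (stens U V) W) (stens U (stens V W)) :=
  seven (slift (fun t z => slift (fun x y => spure x (spure y z)) t)).

Definition sassoci U V W : shom (stens U (stens V W)) (stens (stens U V) W) :=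
  seven (slift (fun x t => slift (fun y z => spure (spure x y) z) t)).

Definition sone : supervect := SuperVect L^o 'rV[L]_0.

Definition slunit V : shom (stens sone V) V :=
  seven (slift (fun (a : stot sone) (x : stot V) => (a.1 : L) *: x)).

Definition srunit V : shom (stens V sone) V :=
  seven (slift (fun (x : stot V) (a : stot sone) => (a.1 : L) *: x)).

(* Koszul rule: x (x) y is sent to (-1)^{|x||y|} y (x) x. *)
Definition sbraid V W : shom (stens V W) (stens W V) :=
  seven (slift (fun (x : stot V) (y : stot W) =>
    spure ((y.1, 0) : stot W) x + spure ((0, y.2) : stot W) ((x.1, - x.2) : stot V))).

Lemma seven_sliftE V W U (b : stot V -> stot W -> stot U) x y : bilin b ->
  (forall p q x y, spar p x -> spar q y -> spar (p (+) q) (b x y)) ->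
  sapp (seven (slift b)) (spure x y) = b x y.
Proof.
move=> bb pb; rewrite sevenE; first exact: sliftE.
  exact: slift_linear.
move=> p t pt; rewrite -[p]addbF; apply: slift_par pt => q r u v pu pv.
by rewrite addbF; apply: pb.
Qed.

Lemma sapp_par V W (f : shom V W) p x : spar p x -> spar p (sapp f x).
Proof. by case: p => /= ->; rewrite linear0. Qed.

Lemma stensmE V V' W W' (f : shom V V') (g : shom W W') x y :
  sapp (stensm f g) (spure x y) = spure (sapp f x) (sapp g y).
Proof.
rewrite seven_sliftE //.
  by apply: bilin_pair (spure_bilin _ _); exact: sapp_linear.
by move=> p q u v pu pv; apply: spure_par; exact: sapp_par.
Qed.

Lemma slift_linear_b V W (U : lmodType L) a (b c : stot V -> stot W -> U) t :
  slift (fun x y => a *: b x y + c x y) t = a *: slift b t + slift c t.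
Proof.
have H (A B : vectType L) (b' c' : A -> B -> U) s :
    vlift (fun x y => a *: b' x y + c' x y) s = a *: vlift b' s + vlift c' s.
  rewrite /vlift scaler_sumr -big_split; apply: eq_bigr => i _ /=.
  rewrite scaler_sumr -big_split; apply: eq_bigr => j _ /=.
  by rewrite scalerDr !scalerA mulrC.
rewrite /slift !H !scalerDr.
by rewrite (AC (2*2*2*2) ((1*3*5*7)*(2*4*6*8))).
Qed.

Lemma eq_slift V W (U : lmodType L) (b c : stot V -> stot W -> U) t :
  (forall x y, b x y = c x y) -> slift b t = slift c t.
Proof.
move=> e; rewrite /slift /vlift.
by do ! congr (_ + _); apply: eq_bigr => i _; apply: eq_bigr => j _; rewrite e.
Qed.

Lemma sassocE U V W x y z :
  sapp (sassoc U V W) (spure (spure x y) z) = spure x (spure y z).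
Proof.
have bz w : bilin (fun (u : stot U) (v : stot V) => spure u (spure v w)).
  split=> [v|u] a s t; first by rewrite spure_linl.
  by rewrite spure_linl spure_linr.
rewrite seven_sliftE; first by rewrite sliftE.
  split=> [w|t] a u v; first exact: slift_linear.
  by rewrite -slift_linear_b; apply: eq_slift => s r; rewrite !spure_linr.
move=> p q s w ps pw; apply: slift_par ps => p' q' u v pu pv.
by rewrite -addbA; apply: spure_par => //; apply: spure_par.
Qed.

Lemma sassociE U V W x y z :
  sapp (sassoci U V W) (spure x (spure y z)) = spure (spure x y) z.
Proof.
have bz w : bilin (fun (u : stot V) (v : stot W) => spure (spure (w : stot U) u) v).
  split=> [v|u] a s t; first by rewrite spure_linr spure_linl.
  by rewrite spure_linr.
rewrite seven_sliftE; first by rewrite sliftE.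
  split=> [w|t] a u v; last exact: slift_linear.
  by rewrite -slift_linear_b; apply: eq_slift => s r; rewrite !spure_linl.
move=> p q s w ps pw; rewrite addbC; apply: slift_par pw => p' q' u v pu pv.
by rewrite addbC addbA; apply: spure_par => //; apply: spure_par.
Qed.

Lemma slunitE V (a : stot sone) x : sapp (slunit V) (spure a x) = (a.1 : L) *: x.
Proof.
rewrite seven_sliftE //.
  split=> [y|b] c u v; first by rewrite /= scalerDl scalerA.
  by rewrite scalerDr !scalerA mulrC.
case=> q u v /= pu pv; last by case: q pv => /= ->; rewrite scaler0.
by rewrite pu; case: q {pv}; rewrite /= scale0r.
Qed.

Lemma srunitE V (a : stot sone) x : sapp (srunit V) (spure x a) = (a.1 : L) *: x.
Proof.
rewrite seven_sliftE //.
  split=> [b|y] c u v; last by rewrite /= scalerDl scalerA.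
  by rewrite scalerDr !scalerA mulrC.
move=> p [] u v /= pu pv; last by case: p pu => /= ->; rewrite scaler0.
by rewrite pv; case: p {pu}; rewrite /= scale0r.
Qed.

Lemma sbraidE V W (x : stot V) (y : stot W) : sapp (sbraid V W) (spure x y) =
  spure ((y.1, 0) : stot W) x + spure ((0, y.2) : stot W) ((x.1, - x.2) : stot V).
Proof.
have l1 : linear (fun y : stot W => (y.1, 0) : stot W).
  by move=> a u v; rewrite inl_linear.
have l2 : linear (fun y : stot W => (0, y.2) : stot W).
  by move=> a u v; rewrite inr_linear.
have l3 : linear (fun x : stot V => (x.1, - x.2) : stot V).
  by move=> a u v; congr (_, _); rewrite /= opprD scalerN.
rewrite seven_sliftE //.
  split=> [v|u] a s t; rewrite ?(spure_linr, l3, l1, l2, spure_linl) scalerDr;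
  by rewrite addrACA.
move=> p q u v pu pv; rewrite [p (+) q]addbC.
have parD e (s t : stot (stens W V)) : spar e s -> spar e t -> spar e (s + t).
  by case: e => /= ->; rewrite add0r.
apply: parD; first by apply: spure_par => //; case: q pv => //= ->.
apply: spure_par; first by case: q pv => //= ->.
by case: p pu => //= ->; rewrite oppr0.
Qed.

Lemma spure_p V W (y : stot V) (z : stot W) :
  ((spure y z).1, 0) = spure ((y.1, 0) : stot V) ((z.1, 0) : stot W)
    + spure ((0, y.2) : stot V) ((0, z.2) : stot W) :> stot (stens V W).
Proof.
by rewrite /spure /= !(vpure0l, vpure0r); do ![congr (_, _)];
   rewrite /= ?addr0 ?add0r.
Qed.
Lemma spure_m V W (y : stot V) (z : stot W) :
  (0, (spure y z).2) = spure ((y.1, 0) : stot V) ((0, z.2) : stot W)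
    + spure ((0, y.2) : stot V) ((z.1, 0) : stot W) :> stot (stens V W).
Proof.
by rewrite /spure /= !(vpure0l, vpure0r); do ![congr (_, _)];
   rewrite /= ?addr0 ?add0r.
Qed.

#[local] Opaque stens sid scmp stensm sassoc sassoci slunit srunit sbraid.

Lemma stensm_id V W : stensm (sid V) (sid W) = sid (stens V W).
Proof. by apply: sapp_ext2 => x y; rewrite stensmE !sapp_id. Qed.
Lemma stensm_cmp V V' V'' W W' W'' (f' : shom V' V'') (f : shom V V')
  (g' : shom W' W'') (g : shom W W') :
  stensm (scmp f' f) (scmp g' g) = scmp (stensm f' g') (stensm f g).
Proof. by apply: sapp_ext2 => x y; rewrite !(sapp_cmp, stensmE). Qed.
Lemma stensm_linearl V V' W W' (g : shom W W') :
  linear (fun f : shom V V' => stensm f g).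
Proof.
move=> a f h; apply: sapp_ext2 => x y.
apply: (etrans (stensmE _ _ _ _)); rewrite sapp_linear2 spure_linl.
apply: esym; apply: (etrans (sapp_linear2 _ _ _ _)).
by apply: (congr2 (fun u v => a *: u + v)); apply: stensmE.
Qed.
Lemma stensm_linearr V V' W W' (f : shom V V') :
  linear (stensm f : shom W W' -> _).
Proof.
move=> a g h; apply: sapp_ext2 => x y.
apply: (etrans (stensmE _ _ _ _)); rewrite sapp_linear2 spure_linr.
apply: esym; apply: (etrans (sapp_linear2 _ _ _ _)).
by apply: (congr2 (fun u v => a *: u + v)); apply: stensmE.
Qed.
Lemma sassocK U V W : scmp (sassoci U V W) (sassoc U V W) = sid _.
Proof.
by apply: sapp_ext3l => x y z; rewrite sapp_cmp sapp_id sassocE sassociE.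
Qed.
Lemma sassociK U V W : scmp (sassoc U V W) (sassoci U V W) = sid _.
Proof.
by apply: sapp_ext3r => x y z; rewrite sapp_cmp sapp_id sassociE sassocE.
Qed.
Lemma sassoc_nat U U' V V' W W' (f : shom U U') (g : shom V V') (h : shom W W') :
  scmp (sassoc U' V' W') (stensm (stensm f g) h) =
  scmp (stensm f (stensm g h)) (sassoc U V W).
Proof.
by apply: sapp_ext3l => x y z; rewrite !(sapp_cmp, stensmE, sassocE).
Qed.
Lemma slunit_iso V : @is_iso L svect_cat (stens sone V) V (slunit V).
Proof.
pose e : stot sone := (1, 0).
have le : linear (fun x : stot V => spure e x) by exact: spure_linr.
have ee x : sapp (seven (fun x : stot V => spure e x)) x = spure e x.
  by rewrite sevenE // => p y py; apply: (@spure_par _ _ false p).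
exists (seven (fun x : stot V => spure e x)); split.
  apply: sapp_ext2 => a x; rewrite sapp_cmp sapp_id slunitE ee.
  case: a => a b; have {b}-> : (a, b) = (a : L) *: e.
    by congr (_, _); [exact: esym (mulr1 _) | rewrite !thinmx0].
  have -> : (((a : L) *: e).1 : L) = a by exact: mulr1.
  by rewrite (linear_funZ _ _ (spure_linr e)) (linear_funZ _ _ (spure_linl x)).
by apply: sapp_ext => x; rewrite sapp_cmp sapp_id ee slunitE scale1r.
Qed.
Lemma slunit_nat V W (f : shom V W) :
  scmp (slunit W) (stensm (sid sone) f) = scmp f (slunit V).
Proof.
apply: sapp_ext2 => x y; rewrite !(sapp_cmp, stensmE, slunitE) sapp_id.
by rewrite (linear_funZ _ _ (sapp_linear f)).
Qed.
Lemma srunit_iso V : @is_iso L svect_cat (stens V sone) V (srunit V).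
Proof.
pose e : stot sone := (1, 0).
have le : linear (fun x : stot V => spure x e) by exact: spure_linl.
have ee x : sapp (seven (fun x : stot V => spure x e)) x = spure x e.
  rewrite sevenE // => p y py; rewrite -[p]addbF.
  exact: spure_par.
exists (seven (fun x : stot V => spure x e)); split.
  apply: sapp_ext2 => x a; rewrite sapp_cmp sapp_id srunitE ee.
  case: a => a b; have {b}-> : (a, b) = (a : L) *: e.
    by congr (_, _); [exact: esym (mulr1 _) | rewrite !thinmx0].
  have -> : (((a : L) *: e).1 : L) = a by exact: mulr1.
  by rewrite (linear_funZ _ _ (spure_linr x)) (linear_funZ _ _ (spure_linl e)).
by apply: sapp_ext => x; rewrite sapp_cmp sapp_id ee srunitE scale1r.
Qed.
Lemma srunit_nat V W (f : shom V W) :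
  scmp (srunit W) (stensm f (sid sone)) = scmp f (srunit V).
Proof.
apply: sapp_ext2 => x y; rewrite !(sapp_cmp, stensmE, srunitE) sapp_id.
by rewrite (linear_funZ _ _ (sapp_linear f)).
Qed.
Lemma sbraid_nat V V' W W' (f : shom V V') (g : shom W W') :
  scmp (sbraid V' W') (stensm f g) = scmp (stensm g f) (sbraid V W).
Proof.
apply: sapp_ext2 => x y; rewrite !(sapp_cmp, stensmE, sbraidE).
rewrite (linear_funD _ _ (sapp_linear _)) !stensmE.
by congr (spure (_, _) _ + spure (_, _) (_, _)); rewrite /= ?linear0 ?linearN.
Qed.
Lemma sbraidK V W : scmp (sbraid W V) (sbraid V W) = sid _.
Proof.
apply: sapp_ext2 => x y; rewrite sapp_cmp sapp_id sbraidE.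
rewrite (linear_funD _ _ (sapp_linear _)) !sbraidE /= oppr0.
rewrite [x in RHS]stot_split [y in RHS]stot_split.
rewrite (linear_funD _ _ (spure_linl _)) !(linear_funD _ _ (spure_linr _)).
rewrite -!addrA; congr (_ + _); rewrite addrCA; congr (_ + _); congr (_ + _).
have -> : (0, - x.2) = -1 *: ((0, x.2) : stot V).
  by congr (_, _); rewrite /= ?scaler0 ?scaleN1r.
have -> : (0, - y.2) = -1 *: ((0, y.2) : stot W).
  by congr (_, _); rewrite /= ?scaler0 ?scaleN1r.
rewrite (linear_funZ _ _ (spure_linl _)) (linear_funZ _ _ (spure_linr _)).
by rewrite scalerA mulrNN mulr1 scale1r.
Qed.
Lemma striangle V W :
  scmp (stensm (sid V) (slunit W)) (sassoc V sone W) =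
  stensm (srunit V) (sid W).
Proof.
apply: sapp_ext3l => x a y.
rewrite !(sapp_cmp, stensmE, sassocE, sapp_id, slunitE, srunitE).
by rewrite (linear_funZ _ _ (spure_linr x)) (linear_funZ _ _ (spure_linl y)).
Qed.
Lemma spentagon U V W X :
  scmp (sassoc U V (stens W X)) (sassoc (stens U V) W X) =
  scmp (scmp (stensm (sid U) (sassoc V W X)) (sassoc U (stens V W) X))
    (stensm (sassoc U V W) (sid X)).
Proof.
apply: sapp_ext4l => x y z t; apply: (etrans (y := spure x (spure y (spure z t)))).
  apply: (etrans (sapp_cmp _ _ _)); apply: etrans (sassocE x y (spure z t)).
  exact: congr1 (sassocE (spure x y) z t).
symmetry; apply: (etrans (sapp_cmp _ _ _)).
apply: (etrans (congr1 (sapp _) (stensmE _ _ _ _))).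
apply: (etrans (congr1 (sapp _) (congr2 (@spure _ _) (sassocE x y z) (sapp_id t)))).
apply: (etrans (sapp_cmp _ _ _)).
apply: (etrans (congr1 (sapp _) (sassocE x (spure y z) t))).
apply: (etrans (stensmE _ _ _ _)).
exact: congr2 (sapp_id x) (sassocE y z t).
Qed.
Lemma shexagon U V W :
  scmp (scmp (sassoc V W U) (sbraid U (stens V W))) (sassoc U V W) =
  scmp (scmp (stensm (sid V) (sbraid U W)) (sassoc V U W))
    (stensm (sbraid U V) (sid W)).
Proof.
apply: sapp_ext3l => x y z.
pose x' : stot U := (x.1, - x.2).
pose y0 : stot V := (y.1, 0); pose y1 : stot V := (0, y.2).
pose z0 : stot W := (z.1, 0); pose z1 : stot W := (0, z.2).
have D A B (f : shom A B) s t : sapp f (s + t) = sapp f s + sapp f t.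
  exact: linear_funD (sapp_linear f).
have Dl A B (s t : stot A) (u : stot B) : spure (s + t) u = spure s u + spure t u.
  exact: linear_funD (spure_linl u).
have Dr A B (s t : stot B) (u : stot A) : spure u (s + t) = spure u s + spure u t.
  exact: linear_funD (spure_linr u).
have -> : sapp (scmp (scmp (sassoc V W U) (sbraid U (stens V W))) (sassoc U V W))
      (spure (spure x y) z) =
    spure y0 (spure z0 x) + spure y1 (spure z1 x) +
    (spure y0 (spure z1 x') + spure y1 (spure z0 x')).
  rewrite !sapp_cmp sassocE sbraidE.
  rewrite spure_p spure_m -/y0 -/y1 -/z0 -/z1.
  by rewrite !Dl !D !sassocE.
symmetry; apply: (etrans (sapp_cmp _ _ _)).
apply: (etrans (congr1 (sapp _) (stensmE _ _ _ _))).
apply: (etrans (congr1 (sapp _) (congr2 (@spure _ _) (sbraidE x y) (sapp_id z)))).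
apply: (etrans (sapp_cmp _ _ _)); rewrite -/x' -/y0 -/y1 Dl !D.
have R (a : stot V) (b : stot U) :
    sapp (stensm (sid V) (sbraid U W)) (sapp (sassoc V U W) (spure (spure a b) z)) =
    spure a (spure z0 b) + spure a (spure z1 ((b.1, - b.2) : stot U)).
  apply: (etrans (congr1 (sapp _) (sassocE a b z))).
  apply: (etrans (stensmE _ _ _ _)).
  apply: (etrans (congr2 (@spure _ _) (sapp_id a) (sbraidE b z))).
  exact: Dr.
apply: (etrans (congr2 +%R (R y0 x) (R y1 x'))) => /=.
have -> : (x.1, - - x.2) = x by rewrite opprK; case: (x).
by rewrite -/x' (AC (2*2) (1*4*(2*3))).
Qed.

(* Vec_L^{+-} *)
Definition svect : tensorCat L := @TensorCat L svect_cat sone stens stensm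
  stensm_id stensm_cmp stensm_linearl stensm_linearr sassoc sassoci
  sassocK sassociK sassoc_nat slunit slunit_iso slunit_nat
  srunit srunit_iso srunit_nat sbraid sbraid_nat sbraidK
  striangle spentagon shexagon.

End SuperVect.

(* Semi-simplicity of the action of f: stable subspaces have stable complements. *)
Definition semisimple_end (L : fieldType) (V : vectType L) (f : 'End(V)) :=
  forall U : {vspace V}, (f @: U <= U)%VS ->
  exists U' : {vspace V},
    [/\ (f @: U' <= U')%VS, (U + U')%VS = fullv & (U :&: U')%VS = 0%VS].

Section FRep.
Variable L : fieldType.

Definition stot_map (V W : supervect L) (f : shom V W) :
  'Hom(stot V, stot W) := linfun (sapp f).

Lemma stot_mapE V W (f : shom V W) x : stot_map f x = sapp f x.
Proof. exact/linfun_apply/sapp_linear. Qed.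

Record frep := FRep {
  frep_space : supervect L;
  frep_aut : shom frep_space frep_space;
  frep_iso : @is_iso L (svect L) frep_space frep_space frep_aut;
  frep_ss : semisimple_end (stot_map frep_aut)
}.
Implicit Types U V W : frep.

Definition frep_tot V : vectType L := stot (frep_space V).
Definition frep_act V : 'End(frep_tot V) := stot_map (frep_aut V).

(* The morphisms of Rep_L(F)_ss^{+-} are all the F-equivariant linear maps
   between total spaces, not only those of degree 0: Hom(V, W) is the whole
   space Hom_L(V, W)^F, odd part included, just as
   H(M)^F = H^+(M)^F (+) H^-(M)^F.
   Restricting to degree 0 gives a different notion of full faithfulness. Let A
   be the category of finite-dimensional super vector spaces over K = L, with
   F = id and H = id: H would then be fully faithful, although K[F_M] = K is
   not the centre K x K of End(M) for M = K^{1|1}, and H^-(M)^F <> 0. *)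
Definition frep_mem V W : {pred 'Hom(frep_tot V, frep_tot W)} :=
  [pred g | (g \o frep_act V == frep_act W \o g)%VF].
Arguments frep_mem : clear implicits.

Lemma frep_submod V W : submod_closed (frep_mem V W).
Proof.
split=> [|a f g]; rewrite !inE ?comp_lfun0l ?comp_lfun0r //.
move=> /eqP fP /eqP gP.
by rewrite comp_lfunDl comp_lfunDr -comp_lfunZl -comp_lfunZr fP gP.
Qed.

Definition frep_hom V W : lmodType L := sub_lmod (Submod (frep_submod V W)).

Lemma frep_homP V W (f : frep_hom V W) :
  (sub_val f \o frep_act V = frep_act W \o sub_val f)%VF.
Proof. by case: f => f /= /eqP. Qed.

Lemma frep_id_mem V : \1%VF \in frep_mem V V.
Proof. by rewrite inE comp_lfun1l comp_lfun1r. Qed.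
Lemma frep_cmp_mem U V W (g : frep_hom V W) (f : frep_hom U V) :
  (sub_val g \o sub_val f)%VF \in frep_mem U W.
Proof. by rewrite inE -comp_lfunA frep_homP comp_lfunA frep_homP comp_lfunA. Qed.

Definition frep_id V : frep_hom V V :=
  @SubLmod _ _ (Submod (frep_submod V V)) _ (frep_id_mem V).
Definition frep_cmp U V W (g : frep_hom V W) (f : frep_hom U V) : frep_hom U W :=
  @SubLmod _ _ (Submod (frep_submod U W)) _ (frep_cmp_mem g f).

Lemma frep_cmpA T U V W (h : frep_hom V W) (g : frep_hom U V)
  (f : frep_hom T U) : frep_cmp h (frep_cmp g f) = frep_cmp (frep_cmp h g) f.
Proof. by apply: val_inj => /=; rewrite comp_lfunA. Qed.
Lemma frep_cmp1m V W (f : frep_hom V W) : frep_cmp (frep_id W) f = f.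
Proof. by apply: val_inj => /=; rewrite comp_lfun1l. Qed.
Lemma frep_cmpm1 V W (f : frep_hom V W) : frep_cmp f (frep_id V) = f.
Proof. by apply: val_inj => /=; rewrite comp_lfun1r. Qed.
Lemma frep_cmp_linearl U V W (f : frep_hom U V) :
  linear (fun g : frep_hom V W => frep_cmp g f).
Proof.
by move=> a g h; apply: val_inj => /=; rewrite comp_lfunDl -comp_lfunZl.
Qed.
Lemma frep_cmp_linearr U V W (g : frep_hom V W) :
  linear (frep_cmp g : frep_hom U V -> frep_hom U W).
Proof.
by move=> a f h; apply: val_inj => /=; rewrite comp_lfunDr -comp_lfunZr.
Qed.

Definition frep_cat : linCat L := LinCat frep_cmpA frep_cmp1m frep_cmpm1
  frep_cmp_linearl frep_cmp_linearr.

End FRep.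

Section Realisation.
Variables (K L : fieldType) (iota : {rmorphism K -> L}) (A : rigidCat K).
Variables (H : tensorFunctor iota A (svect L)) (F : tensor_aut A).

Definition frob (M : A) : shom (H M) (H M) := fmap H (F M).

(* H^-(M)^F *)
Definition odd_invariants (M : A) : {vspace svm (H M)} :=
  fixedSpace (frob M).2.

Definition sign_conjecture (M : A) :=
  exists p : mor M M, fmap H p = (\1%VF, 0) :> shom (H M) (H M).

Section RepFunctor.
Hypothesis ss : forall M, semisimple_end (stot_map (frob M)).

Definition rep_ob (M : A) : frep_cat L :=
  FRep (fmap_iso H (taut_iso F M)) (@ss M).

Lemma rep_mor_mem (M N : A) (f : mor M N) :
  stot_map (fmap H f : shom (H M) (H N)) \in @frep_mem L (rep_ob M) (rep_ob N).
Proof.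
rewrite inE; apply/eqP/lfunP=> x; rewrite !comp_lfunE !stot_mapE.
have e : scmp (fmap H f) (frob M) = scmp (frob N) (fmap H f).
  by rewrite -[LHS](fmap_cmp H) -(taut_nat F) (fmap_cmp H).
by rewrite -!sapp_cmp e.
Qed.

Definition rep_mor (M N : A) (f : mor M N) : mor (rep_ob M) (rep_ob N) :=
  @SubLmod _ _ (Submod (frep_submod (rep_ob M) (rep_ob N))) _ (rep_mor_mem f).

Lemma rep_mor_id (M : A) : rep_mor (idm M) = idm (rep_ob M).
Proof.
apply: val_inj; apply/lfunP=> x; rewrite /= stot_mapE id_lfunE (fmap_id H).
exact: sapp_id.
Qed.
Lemma rep_mor_cmp (M N P : A) (g : mor N P) (f : mor M N) :
  rep_mor (g \oc f) = rep_mor g \oc rep_mor f.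
Proof.
apply: val_inj; apply/lfunP=> x; rewrite /= comp_lfunE !stot_mapE (fmap_cmp H).
exact: sapp_cmp.
Qed.

Definition rep_functor : functor A (frep_cat L) := Functor rep_mor_id rep_mor_cmp.

End RepFunctor.

(* F acts semi-simply on each H(M), and A -> Rep_L(F)_ss^{+-} factors (uniquely)
   through an L-linear functor from (A/N)_L, which is fully faithful. *)
Definition induces_fully_faithful :=
  exists (ss : forall M, semisimple_end (stot_map (frob M)))
         (Ht : functor (ext_cat iota (num_quot A)) (frep_cat L)),
    [/\ linear_functor idfun Ht,
        nat_iso (comp_functor Ht
                  (comp_functor (ext_functor iota (num_quot A)) (num_proj A)))
                (rep_functor ss)
      & fully_faithful Ht].

End Realisation.

(* Main.v *)
From HB Require Import structures.
Require Import Defs.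
From mathcomp Require Import all_boot all_algebra.
From mathcomp Require Import fingroup perm generic_quotient fieldext separable boolp.

Set Implicit Arguments.
Unset Strict Implicit.
Unset Printing Implicit Defensive.

Import GRing.Theory.
Local Open Scope ring_scope.

(** The realisation H turns the categorical trace into the supertrace
    ([happ_tr]), and an F-equivariant linear map H(M) -> H(N) is the same as an
    F-invariant of H(N (x) M^v) ([transpose_vec]). All implications rest on
    these two facts.

    Full faithfulness says that equivariant maps are L-combinations of
    realisations of morphisms, which are even; so there are no odd invariants
    ([fully_faithful_odd_invariants]). A central endomorphism commutes with all
    equivariant maps, hence is a polynomial in F by the bicommutant theorem for
    a semisimple endomorphism ([bicommutant]). Its coefficients can be taken in
    K, since linear relations between realisations descend from L to K when the
    trace form is nondegenerate ([numtriv0_descent]).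

    If there are no odd invariants, the even and the odd part of H(M) have no
    common eigenvalue of F, because a common eigenvalue would give an odd
    equivariant endomorphism. The traces of the powers of F are then signed
    power sums that lie in K; the multiplicity of an eigenvalue is an integer,
    positive on one part and negative on the other, and is the value at this
    eigenvalue of a polynomial over K ([integral_multiplicity_descent]). So the
    projector onto the even part is a polynomial in F over K
    ([odd_invariants_sign]).

    Conversely, assume the Tate and the sign conjecture. The sign conjecture
    makes N a nil ideal ([numtriv_nilpotent]). If no copy of the unit object
    splits off X, the projector onto 1 is central in the endomorphisms of
    X (+) 1 modulo N, so it is P(F) with P(1) = 1 and P(F) nilpotent on X: there
    are no invariants in H(X) and no morphisms between X and 1. Splitting copies
    of 1 off an arbitrary X, one finds that H(X)^F is spanned by morphisms
    1 -> X and that none of these is numerically trivial ([tate_unit_part]).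
    By duality N = 0 ([tate_numtriv0]) and equivariant maps are combinations of
    morphisms ([tate_equivariant_comb]). Then a nilpotent polynomial in F is
    central, hence numerically trivial, hence 0, so that F is semisimple
    ([frob_semisimple]), and full faithfulness follows.

    The sign conjecture is Kimura finiteness because on the tensor powers of a
    purely even or odd space the symmetric group acts by permutation of the
    factors, with signs in the odd case ([happ_perm_act]). Finally, a simple
    object of the idempotent completion realises as a cyclic module over the
    polynomials in F, whose equivariant endomorphisms commute
    ([simple_end_commutative]). *)

(** * Splitting fields and traces of powers of a matrix *)

Lemma irreducible_factor (F : fieldType) (p : {poly F}) :
  (1 < size p)%N -> exists2 q, irreducible_poly q & q %| p.
Proof.
have [n] := ubnP (size p); elim: n p => // n IHn p; rewrite ltnS => le_p_n p1.
have [irr_p|/existsNP[q]] := pselect (forall q : {poly F}, size q != 1 -> q %| p -> q %= p).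
  by exists p.
move=> /not_implyP[q1 /not_implyP[q_p /negP qNp]].
have p0 : p != 0 by rewrite -size_poly_gt0 ltnW.
have lt_q_p : (size q < size p)%N.
  by rewrite ltn_neqAle dvdp_leq // andbT dvdp_size_eqp.
have q_gt1 : (1 < size q)%N.
  have q0 : q != 0 by apply: contraTneq q_p => ->; rewrite dvd0p.
  by rewrite ltn_neqAle eq_sym q1 size_poly_gt0.
have [|r irr_r r_q] := IHn q _ q_gt1; first exact: leq_trans lt_q_p _.
by exists r => //; apply: dvdp_trans q_p.
Qed.

(** Adjoin a root of an irreducible factor, divide by the linear factor that it
    gives, and repeat. *)
Lemma splitting_field_exists (F : fieldType) (p : {poly F}) : p != 0 ->
  exists (E : fieldType) (phi : {rmorphism F -> E}) (s : seq E),
    map_poly phi p %= \prod_(x <- s) ('X - x%:P).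
Proof.
have [n] := ubnP (size p); elim: n F p => // n IHn F p; rewrite ltnS => le_p_n p0.
have [p1|p1] := leqP (size p) 1.
  exists F, idfun, [::]; rewrite big_nil map_poly_id // -size_poly_eq1.
  by rewrite eqn_leq p1 size_poly_gt0.
have [q irr_q q_p] := irreducible_factor p1.
have [E _ [z qz _]] := irredp_FAdjoin irr_q.
have /factor_theorem[r pE] : root (map_poly (in_alg E) p) z.
  move: qz; rewrite !root_factor_theorem => /dvdp_trans; apply; rewrite dvdp_map //.
have pE0 : map_poly (in_alg E) p != 0 by rewrite map_poly_eq0.
have r0 : r != 0 by apply: contraNneq pE0 => r0; rewrite pE r0 mul0r.
have [|E' [phi [s rs]]] := IHn E r _ r0.
  suff rp : (size r).+1 = size p by rewrite rp.
  rewrite -(size_map_poly (in_alg E) p) pE size_mul ?polyXsubC_eq0 //.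
  by rewrite size_XsubC addn2.
exists E', (phi \o in_alg E), (phi z :: s).
rewrite map_poly_comp [map_poly (in_alg E) p]pE rmorphM /= big_cons mulrC.
rewrite rmorphB /= map_polyX map_polyC; exact: eqp_mull.
Qed.

Lemma char_poly_conj (F : fieldType) n (P A B : 'M[F]_n) :
  P \in unitmx -> P *m A = B *m P -> char_poly A = char_poly B.
Proof.
move=> uP PA; have dP : \det (map_mx polyC P) != 0.
  by rewrite det_map_mx polyC_eq0 -unitfE -unitmxE.
apply: (mulfI dP); rewrite [RHS]mulrC -!det_mulmx; congr (\det _).
rewrite mulmxBr mulmxBl -!map_mxM PA; congr (_ - _).
by rewrite mul_mx_scalar mul_scalar_mx.
Qed.

Lemma expmx_conj (F : fieldType) n (P A B : 'M[F]_n) k :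
  P *m A = B *m P -> P *m A ^+ k = B ^+ k *m P.
Proof.
move=> PA; elim: k => [|k IHk]; first by rewrite !expr0 mulmx1 mul1mx.
by rewrite !exprS -!mulmxE mulmxA PA -mulmxA IHk mulmxA.
Qed.

Lemma mxtrace_conj (F : fieldType) n (P A B : 'M[F]_n) :
  P \in unitmx -> P *m A = B *m P -> \tr A = \tr B.
Proof.
move=> uP PA; rewrite -(mulKmx uP A) PA mulmxA mxtrace_mulC mulmxA.
by rewrite mulmxV // mul1mx.
Qed.

Lemma char_poly_lblock (F : fieldType) n1 n2 (a : 'M[F]_n1) c (d : 'M[F]_n2) :
  char_poly (block_mx a 0 c d) = char_poly a * char_poly d.
Proof.
rewrite /char_poly -(det_lblock _ (- map_mx polyC c)); congr (\det _); rewrite /char_poly_mx.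
rewrite map_block_mx scalar_mx_block opp_block_mx add_block_mx map_mx0 subr0.
by congr block_mx; rewrite add0r.
Qed.

Lemma exp_lblock_mx (F : fieldType) n1 n2 (a : 'M[F]_n1) c (d : 'M[F]_n2) k :
  exists c', block_mx a 0 c d ^+ k = block_mx (a ^+ k) 0 c' (d ^+ k).
Proof.
elim: k => [|k [c' IHk]]; first by exists 0; rewrite !expr0 -scalar_mx_block.
eexists; rewrite !exprS IHk -mulmxE mulmx_block !(mul0mx, mulmx0, addr0, add0r).
by [].
Qed.

(** Completing an eigenvector to a basis makes the matrix block triangular with
    a block of size 1, and taking powers respects the blocks. *)
Lemma mxtrace_exp_roots (F : fieldType) n (A : 'M[F]_n) (s : seq F) k :
  char_poly A = \prod_(x <- s) ('X - x%:P) ->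
  \tr (A ^+ k) = \sum_(x <- s) x ^+ k.
Proof.
elim: n A s => [|n IHn] A s.
  rewrite /char_poly !det_mx00 /mxtrace big_ord0.
  case: s => [|x s]; first by rewrite !big_nil.
  move=> e; have := size_prod_XsubC (x :: s) id; rewrite -e size_poly1. done.
case: s => [|x s] charA.
  by have := size_char_poly A; rewrite charA big_nil size_poly1.
have /eigenvalueP[v vA v0] : eigenvalue A x.
  by rewrite eigenvalue_root_char charA root_prod_XsubC mem_head.
have r1 : \rank v = 1%N.
  by apply/eqP; rewrite eqn_leq rank_leq_row lt0n mxrank_eq0.
(* The first row of row_ebase v is a multiple of v, so P completes v to a basis.
   *)
set P := row_ebase v; have uP : P \in unitmx := row_ebase_unit v.
have rP : row 0 P *m A = x *: row 0 P.
  have uc : col_ebase v \in unitmx := col_ebase_unit v.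
  have -> : row 0 P = invmx (col_ebase v) *m v.
    transitivity (invmx (col_ebase v) *m
        (col_ebase v *m pid_mx (\rank v) *m row_ebase v)); last by rewrite mulmx_ebase.
    rewrite r1 -!mulmxA mulKmx // rowE; congr (_ *m _); apply/matrixP=> i j; rewrite !ord1 !mxE /= andbT.
    by rewrite eq_sym -val_eqE.
  by rewrite -mulmxA vA scalemxAr.
have [B B_def] : exists B : 'M_(1 + n), B = P *m A *m invmx P by exists (P *m A *m invmx P).
have PA : P *m A = B *m P by rewrite B_def mulmxKV.
have BE : B = block_mx x%:M 0 (dlsubmx B) (drsubmx B).
  rewrite -[B in LHS]submxK; suff e : usubmx B = row_mx x%:M 0.
    by congr block_mx; rewrite /ulsubmx /ursubmx e ?row_mxKl ?row_mxKr.
  have -> : usubmx B = row 0 B.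
    by apply/rowP=> j; rewrite !mxE; congr (B _ j); apply: val_inj.
  rewrite B_def !row_mul rP -scalemxAl -row_mul mulmxV //.
  apply/rowP=> j; rewrite !mxE; case: splitP => i ji; rewrite !mxE -val_eqE /= ji.
    by rewrite !ord1 mulr_natr.
  by rewrite mulr0.
have charB : char_poly A = char_poly (x%:M : 'M_1) * char_poly (drsubmx B).
  by rewrite (char_poly_conj uP PA) ; have := char_poly_lblock x%:M (dlsubmx B) (drsubmx B); rewrite -BE.
have char1 : char_poly (x%:M : 'M_1) = 'X - x%:P.
  by rewrite char_poly_trig ?scalar_mx_is_trig // big_ord1 mxE.
have /mulfI charD : ('X - x%:P) * char_poly (drsubmx B) = ('X - x%:P) * \prod_(y <- s) ('X - y%:P).
  by rewrite -char1 -charB charA big_cons char1.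
rewrite (mxtrace_conj uP (expmx_conj k PA)) BE.
have [c' ->] := exp_lblock_mx x%:M (dlsubmx B) (drsubmx B) k.
apply: (etrans (@mxtrace_block _ 1 n _ _ _ _)); rewrite (IHn _ s (charD (negbT (polyXsubC_eq0 x)))) big_cons; congr (_ + _).
have -> m : (x%:M : 'M[F]_1) ^+ m = (x ^+ m)%:M.
  by elim: m => [|m IHm]; rewrite ?expr0 // !exprS scalar_mxM -mulmxE IHm.
by rewrite mxtrace_scalar mulr1n.
Qed.

Section TraceNil.
Variables (L : fieldType) (char0 : [pchar L] =i pred0).

Lemma natr_eq0_char0 n : (n%:R == 0 :> L) = (n == 0)%N.
Proof. exact: (pcharf0P L).1. Qed.

(** An idempotent factors through its image as c r with r c = 1. *)
Lemma mxtrace_idem n (e : 'M[L]_n) : e *m e = e -> \tr e = (\rank e)%:R.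
Proof.
move=> ee; rewrite -[e in \tr e](mulmx_base e) mxtrace_mulC.
move: (mulmx_base e) (col_base_full e) (row_base_free e).
move: (row_base e) (col_base e) => r c cr c_full r_free.
suff -> : r *m c = 1%:M by rewrite mxtrace1.
apply: (row_full_inj c_full); apply: (row_free_inj r_free) => /=.
by rewrite mulmx1 -!mulmxA cr mulmxA cr.
Qed.

(** The projector onto the part of the space on which A is invertible is a
    polynomial in A without constant term, so its trace is 0. In characteristic
    0 a projector of trace 0 vanishes, and A is nilpotent on the complementary
    part. *)
Lemma mxtrace_exp0_nilpotent n (A : 'M[L]_n) :
  (forall k, \tr (A ^+ k.+1) = 0) -> exists k, A ^+ k = 0.
Proof.
case: n A => [|n] A trA; first by exists 0%N; apply/matrixP=> -[].
have trX (p : {poly L}) : \tr (horner_mx A (p * 'X)) = 0.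
  rewrite -[p]coefK poly_def mulr_suml !linear_sum big1 // => i _.
  by rewrite -scalerAl -exprSr !linearZ rmorphXn /= horner_mx_X trA mulr0.
have [a [q qN0 chiE]] := multiplicity_XsubC (char_poly A) 0.
rewrite monic_neq0 ?char_poly_monic //= subr0 in qN0 chiE.
(* The exponent a.+1 instead of a makes e a multiple of X even if a = 0. *)
have /Bezout_eq1_coprimepP[[u v] /= uv1] : coprimep q ('X ^+ a.+1).
  by rewrite coprimep_expr // coprimepX.
pose e : 'M[L]_n.+1 := horner_mx A (v * 'X ^+ a.+1).
have qX0 : horner_mx A (q * 'X ^+ a.+1) = 0.
  by rewrite exprS mulrCA -chiE rmorphM /= Cayley_Hamilton mulr0.
have ee : e *m e = e.
  rewrite mulmxE -rmorphM /=; apply/eqP; rewrite -subr_eq0 -rmorphB.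
  set w := v * _; rewrite -[X in _ - X]mulr1 -uv1 mulrDr opprD addrCA subrr addr0.
  by rewrite mulrACA ['X^_ * q]mulrC rmorphN rmorphM /= qX0 mulr0 oppr0.
have e0 : e = 0.
  apply/eqP; rewrite -mxrank_eq0 -natr_eq0_char0 -mxtrace_idem //.
  by rewrite /e exprSr mulrA trX.
exists a.+1; rewrite -[A]horner_mx_X -rmorphXn -['X ^+ _]mul1r -uv1 mulrDl.
rewrite -mulrA rmorphD /= (rmorphM _ u) (rmorphM _ (v * _)) /= -/e.
by rewrite qX0 e0 mulr0 mul0r addr0.
Qed.
End TraceNil.

(** * Descent of integral multiplicities *)

Lemma sum_count_mem (V : nmodType) (T : eqType) (t a : seq T) (f : T -> V) :
  uniq t -> {subset a <= t} ->
  \sum_(x <- a) f x = \sum_(z <- t) f z *+ count_mem z a.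
Proof.
move=> ut; elim: a => [|x a IHa] a_t.
  by rewrite big_nil big1 // => z _; rewrite mulr0n.
rewrite big_cons IHa; last by move=> z za; apply: a_t; rewrite inE za orbT.
under [RHS]eq_bigr do rewrite /= mulrnDr.
rewrite big_split /=; congr (_ + _).
rewrite (bigD1_seq x) ?a_t ?mem_head //= eqxx big1 ?addr0 // => z.
by rewrite eq_sym => /negPf->.
Qed.

Lemma diag_mx_exp (R : comNzRingType) n (d : 'rV[R]_n) k :
  diag_mx d ^+ k = diag_mx (\row_i d 0 i ^+ k).
Proof.
elim: k => [|k IHk].
  rewrite expr0; apply/matrixP=> i j; rewrite !mxE.
  by rewrite expr0.
rewrite exprS IHk -mulmxE mul_diag_mx; apply/matrixP=> i j; rewrite !mxE.
by rewrite exprS mulrnAr.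
Qed.

Lemma map_mx_exp (R S : pzRingType) (f : {rmorphism R -> S}) n (A : 'M[R]_n) k :
  map_mx f (A ^+ k) = map_mx f A ^+ k.
Proof.
elim: k => [|k IHk]; first by rewrite !expr0 map_mx1.
by rewrite !exprS -!mulmxE map_mxM IHk.
Qed.

Section IntegralMultiplicities.
Variables (K E : fieldType) (iota : {rmorphism K -> E}).
Hypothesis char0 : [pchar K] =i pred0.

Lemma pchar0_ext : [pchar E] =i pred0.
Proof. by move=> p; rewrite (fmorph_pchar iota) char0. Qed.

(** In characteristic 0 the products of the X - n and of the X + n, for 0 < n <=
    N, are coprime: use a Bezout relation. *)
Lemma sign_separating_poly N : exists G : {poly K}, forall n, (0 < n <= N)%N ->
  G.[n%:R] = 1 /\ G.[- n%:R] = 0.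
Proof.
pose W (e : K) := \prod_(i < N) ('X - (e * i.+1%:R)%:P).
have W0 e n : (0 < n <= N)%N -> (W e).[e * n%:R] = 0.
  case: n => // n; rewrite horner_prod => ltnN.
  by rewrite (bigD1 (Ordinal ltnN)) //= hornerXsubC subrr mul0r.
have /Bezout_eq1_coprimepP[[u v] /= uv1] : coprimep (W 1) (W (-1)).
  have coprime_prod (I : finType) (f : I -> {poly K}) q :
      (forall i, coprimep (f i) q) -> coprimep (\prod_i f i) q.
    move=> fq; apply: (big_ind (fun p => coprimep p q)) => [||i _]; [exact: coprime1p| |exact: fq].
    by move=> p1 p2 p1q p2q; rewrite coprimepMl p1q.
  apply/coprime_prod => i; rewrite coprimep_sym; apply/coprime_prod => j.
  apply: coprimep_XsubC2; rewrite mul1r mulN1r opprK -natrD addnS.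
  by rewrite natr_eq0_char0.
exists (v * W (-1)) => n nN; split; last first.
  by rewrite hornerM -mulN1r W0 ?mulr0.
rewrite -[_ * _](addKr (u * W 1)) uv1 addrC !hornerE.
by rewrite -[X in (W 1).[X]]mul1r W0 // mulr0 subr0.
Qed.

(** Let lam_k be the distinct elements of a and b and m_k their multiplicities,
    counted negatively in b; the m_k are nonzero integers. With the Vandermonde
    matrix V of the lam_k, the matrices of power sums S = V diag(m) V^T and S' =
    V diag(m) diag(lam) V^T come from K. Hence so do C = S^-1 S', which is
    conjugate to diag(lam), and V V^T, whose entries are traces of powers of C.
    Solving a linear system over K then yields a polynomial U with U(lam_k) =
    m_k, and composing with a polynomial that separates positive from negative
    integers gives P. *)
Lemma integral_multiplicity_descent (a b : seq E) :
  (forall k, exists c, \sum_(x <- a) x ^+ k - \sum_(y <- b) y ^+ k = iota c) ->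
  (forall x, x \in a -> x \notin b) ->
  exists P : {poly K}, (forall x, x \in a -> (map_poly iota P).[x] = 1) /\
                       (forall y, y \in b -> (map_poly iota P).[y] = 0).
Proof.
move=> /choice[s sE] ab; pose t := undup (a ++ b).
have ut : uniq t by apply: undup_uniq.
have a_t : {subset a <= t} by move=> x xa; rewrite mem_undup mem_cat xa.
have b_t : {subset b <= t} by move=> x xa; rewrite mem_undup mem_cat xa orbT.
set r := size t; pose lam : 'rV[E]_r := \row_k t`_k.
pose m : 'rV[E]_r := \row_k ((count_mem t`_k a)%:R - (count_mem t`_k b)%:R).
have sumE (f : E -> E) : \sum_(x <- a) f x - \sum_(y <- b) f y =
    \sum_k m 0 k * f (lam 0 k).
  rewrite (sum_count_mem _ ut a_t) (sum_count_mem _ ut b_t) -sumrB.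
  rewrite (big_nth 0) big_mkord; apply: eq_bigr => k _; rewrite !mxE.
  by rewrite mulrBl !mulr_natl.
have mP (k : 'I_r) : exists2 n, (0 < n <= size (a ++ b))%N &
    (t`_k \in a /\ m 0 k = n%:R) \/ (t`_k \in b /\ m 0 k = - n%:R).
  have: t`_k \in t by apply: mem_nth.
  rewrite mem_undup mem_cat size_cat mxE; have [ka _|ka /= kb] := boolP (_ \in a).
    exists (count_mem t`_k a); last first.
      by left; rewrite (count_memPn (ab _ ka)) subr0.
    by rewrite -has_count has_pred1 ka (leq_trans (count_size _ _)) ?leq_addr.
  exists (count_mem t`_k b); last by right; rewrite (count_memPn ka) sub0r.
  by rewrite -has_count has_pred1 kb (leq_trans (count_size _ _)) ?leq_addl.
pose V : 'M[E]_r := Vandermonde r lam.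
have uV : V \in unitmx.
  rewrite unitmxE det_Vandermonde unitfE; apply/prodf_neq0 => i _.
  apply/prodf_neq0 => j ij; rewrite !mxE subr_eq0 nth_uniq //.
  by rewrite eq_sym neq_ltn ij.
have uVT : V^T \in unitmx by rewrite unitmx_tr.
have uD : diag_mx m \in unitmx.
  rewrite unitmxE det_diag unitfE; apply/prodf_neq0 => k _.
  have [n /andP[n0 _] [[_ ->]|[_ ->]]] := mP k; rewrite ?oppr_eq0;
  by rewrite natr_eq0_char0 ?lt0n_neq0 //; apply: pchar0_ext.
pose S : 'M[K]_r := \matrix_(i, j) s (i + j)%N.
pose S' : 'M[K]_r := \matrix_(i, j) s (i + j).+1.
have VdE (d : 'rV[E]_r) i j : (V *m diag_mx d *m V^T) i j =
    \sum_k d 0 k * lam 0 k ^+ (i + j).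
  rewrite mxE; apply: eq_bigr => k _; rewrite mul_mx_diag !mxE exprD.
  by rewrite mulrAC mulrA mulrC mulrA.
have SE : map_mx iota S = V *m diag_mx m *m V^T.
  by apply/matrixP=> i j; rewrite VdE !mxE -sE sumE.
have S'E : map_mx iota S' = V *m diag_mx m *m diag_mx lam *m V^T.
  apply/matrixP=> i j; rewrite -(mulmxA V) mulmx_diag VdE !mxE -sE sumE.
  by apply: eq_bigr => k _; rewrite !mxE exprS mulrA.
have uS : S \in unitmx by rewrite -(map_unitmx iota) SE !unitmx_mul uV uD uVT.
pose C := invmx S *m S'.
(* C is conjugate to diag(lam), which makes the traces of its powers power sums
   of the lam_k. *)
have CE : V^T *m map_mx iota C = diag_mx lam *m V^T.
  apply: (can_inj (mulKmx (_ : V *m diag_mx m \in unitmx))).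
    by rewrite unitmx_mul uV.
  by rewrite mulmxA -SE -map_mxM mulKVmx // S'E !mulmxA.
pose T : 'M[K]_r := \matrix_(i, j) \tr (C ^+ (i + j)).
have TE : map_mx iota T = V *m V^T.
  apply/matrixP=> i j; rewrite 2!mxE -trace_map_mx map_mx_exp.
  rewrite (mxtrace_conj uVT (expmx_conj _ CE)) diag_mx_exp mxtrace_diag mxE.
  by apply: eq_bigr => k _; rewrite !mxE exprD.
have uT : T \in unitmx by rewrite -(map_unitmx iota) TE unitmx_mul uV.
(* V^T e0 is the vector of ones, so (V V^T)^-1 S e0 is the solution U of V^T U =
   m. *)
pose e0 : 'cV[K]_r := \col_i (i == 0 :> nat)%:R.
pose U := rVpoly (invmx T *m S *m e0)^T.
have UE k : (map_poly iota U).[lam 0 k] = m 0 k.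
  have: V^T *m map_mx iota (invmx T *m S *m e0) = diag_mx m *m (V^T *m map_mx iota e0).
    apply: (can_inj (mulKmx uV)); rewrite [LHS]mulmxA -TE -map_mxM -mulmxA mulKVmx //.
    by rewrite map_mxM SE !mulmxA.
  move/matrixP/(_ k 0); rewrite mul_diag_mx 2!mxE.
  have -> : (V^T *m map_mx iota e0) k 0 = 1.
    rewrite mxE (bigD1 (Ordinal (leq_ltn_trans (leq0n k) (ltn_ord k)))) //= big1.
      by rewrite !mxE eqxx rmorph1 mulr1 addr0.
    by move=> i; rewrite -val_eqE /= => /negPf i0; rewrite !mxE i0 rmorph0 mulr0.
  rewrite mulr1 => <-; rewrite map_rVpoly horner_poly; apply: eq_bigr => i _.
  by rewrite valK mulrC !mxE.
have [G GP] := sign_separating_poly (size (a ++ b)).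
exists (G \Po U); split=> x xt.
  have xN : (index x t < r)%N by rewrite index_mem a_t.
  have xE : x = lam 0 (Ordinal xN) by rewrite mxE nth_index ?a_t.
  rewrite map_comp_poly horner_comp {1}xE UE.
  have [n nN [[_ ->]|[]]] := mP (Ordinal xN); last first.
    by rewrite /= nth_index ?a_t // => xb; have := ab _ xt; rewrite xb.
  by rewrite -(rmorph_nat iota) horner_map (GP n nN).1 rmorph1.
have xN : (index x t < r)%N by rewrite index_mem b_t.
have xE : x = lam 0 (Ordinal xN) by rewrite mxE nth_index ?b_t.
rewrite map_comp_poly horner_comp {1}xE UE.
have [n nN [[]|[_ ->]]] := mP (Ordinal xN).
  by rewrite /= nth_index ?b_t // => xa; have := ab _ xa; rewrite xt.
by rewrite -(rmorph_nat iota) -rmorphN horner_map (GP n nN).2 rmorph0.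
Qed.
End IntegralMultiplicities.

(** * Separating two matrices by a polynomial over a subfield *)

Section HornerSq.
Variables (F : fieldType).

(** Extends horner_mx, which requires a positive size, to matrices of size 0. *)
Definition horner_sq n : 'M[F]_n -> {poly F} -> 'M[F]_n :=
  if n is n'.+1 then fun A p => horner_mx A p else fun _ _ => 0.

Lemma horner_sqM n (A : 'M[F]_n) p q :
  horner_sq A (p * q) = horner_sq A p *m horner_sq A q.
Proof. by case: n A => [|n] A /=; rewrite ?mul0mx // rmorphM. Qed.

Lemma horner_sqD n (A : 'M[F]_n) p q :
  horner_sq A (p + q) = horner_sq A p + horner_sq A q.
Proof. by case: n A => [|n] A /=; rewrite ?addr0 // rmorphD. Qed.

Lemma horner_sq1 n (A : 'M[F]_n) : horner_sq A 1 = 1%:M.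
Proof.
by case: n A => [|n] A /=; rewrite ?rmorph1 //; apply/matrixP=> -[].
Qed.

Lemma horner_sqE n (A : 'M[F]_n) p :
  horner_sq A p = \sum_(i < size p) p`_i *: A ^+ i.
Proof.
case: n A => [|n] A /=; first by apply/matrixP=> -[].
rewrite -{1}[p]coefK poly_def linear_sum; apply: eq_bigr => i _.
by rewrite linearZ /= rmorphXn /= horner_mx_X.
Qed.

(** Each linear factor of the characteristic polynomial divides p, so the
    characteristic polynomial divides p ^+ n; apply Cayley-Hamilton. *)
Lemma horner_sq_roots n (A : 'M[F]_n) (s : seq F) p :
  char_poly A = \prod_(x <- s) ('X - x%:P) -> (forall x, x \in s -> p.[x] = 0) ->
  horner_sq A (p ^+ n) = 0.
Proof.
case: n A => [|n] A charA ps //=.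
have : char_poly A %| p ^+ n.+1.
  have sz : n.+1 = size s.
    apply: succn_inj; rewrite -(size_char_poly A) charA.
    exact: (size_prod_XsubC s id).
  rewrite charA [X in p ^+ X]sz; elim: s ps {charA sz} => [|x s IHs] ps; first by rewrite big_nil dvd1p.
  rewrite big_cons exprS dvdp_mul //; last by apply: IHs => y ys; rewrite ps ?inE ?ys ?orbT.
  by rewrite -root_factor_theorem; apply/eqP/ps/mem_head.
rewrite dvdp_eq => /eqP ->.
by rewrite rmorphM /= Cayley_Hamilton mulr0.
Qed.

End HornerSq.

Lemma map_horner_sq (F E : fieldType) (phi : {rmorphism F -> E}) n
    (A : 'M[F]_n) p :
  map_mx phi (horner_sq A p) = horner_sq (map_mx phi A) (map_poly phi p).
Proof. by case: n A => [|n] A /=; rewrite ?map_mx0 // map_horner_mx. Qed.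

(** If u is a column eigenvector of A and v a row eigenvector of B for the
    common eigenvalue, then u v is an intertwiner over E; a linear system over F
    with a nonzero solution over E has one over F. *)
Lemma common_eigenvalue_intertwiner (F E : fieldType) (phi : {rmorphism F -> E})
    n m (A : 'M[F]_n) (B : 'M[F]_m) x :
  root (char_poly (map_mx phi A)) x -> root (char_poly (map_mx phi B)) x ->
  exists2 h : 'M[F]_(n, m), h != 0 & A *m h = h *m B.
Proof.
have -> : char_poly (map_mx phi A) = char_poly (map_mx phi A)^T.
  rewrite /char_poly -det_tr; congr (\det _).
  by rewrite /char_poly_mx linearB /= tr_scalar_mx -!map_trmx.
rewrite -!eigenvalue_root_char => /eigenvalueP[u uA u0] /eigenvalueP[v vB v0].
pose S (G : fieldType) (a : 'M[G]_n) (b : 'M[G]_m) :=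
  lin_mx (mulmx a : 'M_(n, m) -> _) - lin_mx (mulmxr b).
have SE (G : fieldType) (a : 'M[G]_n) (b : 'M[G]_m) h :
    mxvec h *m S G a b = mxvec (a *m h - h *m b).
  by rewrite mulmxBr !mul_vec_lin linearB.
have mapS : map_mx phi (S F A B) = S E (map_mx phi A) (map_mx phi B).
  rewrite map_mxB; congr (_ - _); apply: map_lin_mx => h; exact: map_mxM.
have Nfree : ~~ row_free (S F A B).
  rewrite -(row_free_map phi) mapS -kermx_eq0; apply/rowV0Pn.
  exists (mxvec (u^T *m v)).
    apply/sub_kermxP; rewrite SE; apply/eqP; rewrite mxvec_eq0 subr_eq0.
    by rewrite mulmxA -[_ *m u^T]trmxK trmx_mul trmxK uA linearZ /= -scalemxAl -mulmxA vB scalemxAr.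
  rewrite mxvec_eq0; apply: contraNneq u0 => uv0.
  have [j vj] : exists j, v 0 j != 0 by apply/rV0Pn.
  apply/eqP/rowP=> i; move/matrixP/(_ i j)/eqP: uv0.
  by rewrite !mxE big_ord1 !mxE mulf_eq0 (negPf vj) orbF => /eqP.
move: Nfree; rewrite -kermx_eq0 => /rowV0Pn[w /sub_kermxP wS w0].
exists (vec_mx w); first by rewrite vec_mx_eq0.
by apply/eqP; rewrite -subr_eq0 -mxvec_eq0 -SE vec_mxK wS.
Qed.

(** In the absence of intertwiners A and B have no common eigenvalue, so the
    traces of their powers are signed power sums to which descent of
    multiplicities applies: some P over K is 1 on the spectrum of A and 0 on
    that of B. Then P(A) - 1 and P(B) are nilpotent, and a Bezout relation
    between (P - 1)^n and P^m turns P into an exact solution. *)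
Lemma separating_poly (K L : fieldType) (iota : {rmorphism K -> L}) n m
    (A : 'M[L]_n) (B : 'M[L]_m) : [pchar K] =i pred0 ->
  (forall k, exists c, \tr (A ^+ k) - \tr (B ^+ k) = iota c) ->
  (forall h : 'M[L]_(n, m), A *m h = h *m B -> h = 0) ->
  exists P : {poly K}, horner_sq A (map_poly iota P) = 1%:M /\
                       horner_sq B (map_poly iota P) = 0.
Proof.
move=> char0 trK noh.
have chi0 : char_poly A * char_poly B != 0.
  by rewrite mulf_neq0 ?monic_neq0 ?char_poly_monic.
have [E [phi [s]]] := splitting_field_exists chi0.
rewrite eqp_monic ?monic_prod_XsubC ?monic_map ?monicMl ?char_poly_monic // => /eqP.
rewrite rmorphM /= !map_char_poly => chiE.
have split_dvd (p : {poly E}) : p \is monic -> p %| \prod_(x <- s) ('X - x%:P) ->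
    exists a, p = \prod_(x <- a) ('X - x%:P).
  move=> mp /dvdp_prod_XsubC[mk]; rewrite eqp_monic ?monic_prod_XsubC // => /eqP ->.
  by eexists.
have [|a charA] := split_dvd _ (char_poly_monic (map_mx phi A)).
  by rewrite -chiE dvdp_mulr.
have [|b charB] := split_dvd _ (char_poly_monic (map_mx phi B)).
  by rewrite -chiE dvdp_mull.
have [||P [Pa Pb]] := @integral_multiplicity_descent K E (phi \o iota) char0 a b.
- move=> k; have [c cE] := trK k; exists c.
  by rewrite /= -cE -(mxtrace_exp_roots k charA) -(mxtrace_exp_roots k charB) rmorphB /=
     -!map_mx_exp !trace_map_mx.
- move=> x xa; apply/negP=> xb.
  have [||h h0 /noh hE] := @common_eigenvalue_intertwiner _ _ phi _ _ A B x.
  + by rewrite charA root_prod_XsubC.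
  + by rewrite charB root_prod_XsubC.
  by rewrite hE eqxx in h0.
have /Bezout_eq1_coprimepP[[u v] /= uv1] : coprimep ((P - 1) ^+ n) (P ^+ m).
  apply/coprimep_expl/coprimep_expr/Bezout_eq1_coprimepP.
  by exists (-1, 1); rewrite /= mulN1r mul1r opprB subrK.
have A0 : horner_sq A (map_poly iota ((P - 1) ^+ n)) = 0.
  apply: (@map_mx_inj _ _ phi); rewrite map_mx0 map_horner_sq -map_poly_comp.
  rewrite rmorphXn; apply: (horner_sq_roots charA) => x xa.
  by rewrite rmorphB rmorph1 hornerD hornerN hornerC Pa // subrr.
have B0 : horner_sq B (map_poly iota (P ^+ m)) = 0.
  apply: (@map_mx_inj _ _ phi); rewrite map_mx0 map_horner_sq -map_poly_comp.
  by rewrite rmorphXn; apply: (horner_sq_roots charB) => x xb; apply: Pb.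
exists (v * P ^+ m); split; last by rewrite rmorphM horner_sqM B0 mulmx0.
rewrite -[LHS]add0r -(mulmx0 _ (horner_sq A (map_poly iota u))) -A0 -horner_sqM.
by rewrite -horner_sqD -rmorphM -rmorphD uv1 rmorph1 horner_sq1.
Qed.

(** * Semisimplicity, bicommutants and the action of polynomials *)

Section PolyAction.
Variables (R : fieldType) (V : lmodType R) (f : V -> V).
Hypothesis lf : linear f.
Implicit Types (p q : {poly R}) (v : V).

(** The vector p(f) v. It is defined for a linear endomorphism f of any module
    because f will be a linear map of a vector space as well as composition with
    a morphism. *)
Definition papp (p : {poly R}) (v : V) : V := \sum_(i < size p) p`_i *: iter i f v.

Lemma papp_wide p n v : (size p <= n)%N ->
  papp p v = \sum_(i < n) p`_i *: iter i f v.
Proof.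
move=> le_p_n; rewrite /papp (big_ord_widen n (fun i => p`_i *: iter i f v)) //.
rewrite big_mkcond; apply: eq_bigr => i _ /=.
by case: ltnP => // le_p_i; rewrite nth_default ?scale0r.
Qed.

Lemma iter_linear i : linear (iter i f).
Proof. by elim: i => [|i IHi] a u v //=; rewrite IHi lf. Qed.

Lemma papp_linear p : linear (papp p).
Proof.
move=> a u v; rewrite /papp scaler_sumr -big_split; apply: eq_bigr => i _ /=.
by rewrite iter_linear scalerDr !scalerA mulrC.
Qed.

Lemma pappD p q v : papp (p + q) v = papp p v + papp q v.
Proof.
have le_pq := leq_maxl (size p) (size q); have le_qp := leq_maxr (size p) (size q).
rewrite (papp_wide v le_pq) (papp_wide v le_qp) (papp_wide v (size_polyD p q)).
by rewrite -big_split; apply: eq_bigr => i _ /=; rewrite coefD scalerDl.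
Qed.

Lemma pappZ c p v : papp (c *: p) v = c *: papp p v.
Proof.
rewrite (papp_wide v (size_scale_leq c p)) /papp scaler_sumr.
by apply: eq_bigr => i _; rewrite coefZ scalerA.
Qed.

Lemma pappC c v : papp c%:P v = c *: v.
Proof.
by rewrite (@papp_wide _ 1) ?size_polyC_leq1 // big_ord1 coefC.
Qed.

Lemma papp1 v : papp 1 v = v.
Proof. by rewrite -polyC1 pappC scale1r. Qed.

Lemma papp0 v : papp 0 v = 0.
Proof. by rewrite -polyC0 pappC scale0r. Qed.

Lemma pappMX p v : papp (p * 'X) v = papp p (f v).
Proof.
rewrite (@papp_wide _ (size p).+1); last by have [->|p0] := eqVneq p 0; rewrite ?mul0r ?size_poly0 ?size_mulX.
rewrite big_ord_recl coefMX eqxx scale0r add0r; apply: eq_bigr => i _.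
by rewrite coefMX /= -iterSr.
Qed.

Lemma pappXn n v : papp 'X^n v = iter n f v.
Proof.
elim: n v => [|n IHn] v; first by rewrite expr0 papp1.
by rewrite exprSr pappMX IHn iterSr.
Qed.

Lemma pappM p q v : papp (p * q) v = papp p (papp q v).
Proof.
elim/poly_ind: q v => [|q c IHq] v.
  by rewrite mulr0 !papp0 (linear_fun0 (papp_linear p)).
rewrite mulrDr mulrA !pappD !pappMX IHq (linear_funD _ _ (papp_linear p)).
by rewrite [p * c%:P]mulrC mul_polyC pappZ pappC (linear_funZ _ _ (papp_linear p)).
Qed.

Lemma papp_comm (g : V -> V) p v : linear g -> (forall u, g (f u) = f (g u)) ->
  g (papp p v) = papp p (g v).
Proof.
move=> lg fg; rewrite /papp (linear_fun_sum _ _ lg); apply: eq_bigr => i _.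
rewrite (linear_funZ _ _ lg); congr (_ *: _).
by elim: (i : nat) => // k IHk; rewrite iterS fg IHk.
Qed.

Lemma papp_eigen p v : f v = v -> papp p v = p.[1] *: v.
Proof.
move=> fv; rewrite /papp horner_coef scaler_suml; apply: eq_bigr => i _.
by rewrite expr1n mulr1; congr (_ *: _); elim: (i : nat) => // k IHk; rewrite iterSr fv.
Qed.

End PolyAction.

Section SemisimpleEnd.
Variables (L : fieldType) (V : vectType L).
Implicit Types (U W : {vspace V}) (f g : 'End(V)).

Lemma lfun_linear f : linear f.
Proof. by move=> a u v; rewrite linearP. Qed.
Hint Resolve lfun_linear : core.

(** For p = X^n the map D is the sum of the f^i pi f^(n-1-i): a noncommutative
    difference quotient of p, which measures how far pi is from commuting with
    p(f) and restricts to the derivative of p at f on U. *)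
Lemma divided_difference f U (pi : V -> V) (p : {poly L}) :
  linear pi -> (forall v, pi v \in U) -> {in U, forall u, pi u = u} ->
  (forall u, u \in U -> f u \in U) ->
  exists D : V -> V, [/\ linear D,
    forall v, f (D v) - D (f v) = papp f p (pi v) - pi (papp f p v),
    forall v, D v \in U & {in U, forall u, D u = papp f p^`() u}].
Proof.
move=> lpi piU piu fU.
have pU q u : u \in U -> papp f q u \in U.
  move=> uU; apply: memv_suml => i _; apply: memvZ.
  by elim: (i : nat) => //= k IHk; apply: fU.
elim/poly_ind: p => [|p c [D [lD Df DU Du]]].
  exists (fun=> 0); split=> [a u v|v|v|u _].
  - by rewrite scaler0 addr0.
  - by rewrite !papp0 // linear0 (linear_fun0 lpi).
  - exact: mem0v.
  - by rewrite deriv0 papp0.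
(* Leibniz rule for the product p * 'X. *)
exists (fun v => D (f v) + papp f p (pi v)); split=> [a u v|v|v|u uU].
- rewrite linearP lD lpi papp_linear // scalerDr.
  by rewrite addrACA.
- rewrite !pappD // !pappMX // !pappC // (linear_funD _ _ lpi) (linear_funZ _ _ lpi).
  rewrite linearD /= opprD addrACA Df (papp_comm (g := f)) //.
  rewrite [LHS]addrC [LHS]addrA subrK; apply/esym.
  by rewrite opprD addrACA subrr addr0.
- by rewrite memvD // pU.
by rewrite derivMXaddC pappD // pappMX // Du ?fU // piu // addrC.
Qed.

(** When p(f) = 0 the difference quotient D built from a projector onto U
    commutes with f. Dividing it by the derivative of p at f, which is
    invertible as p is separable, makes it an equivariant projector onto U; its
    kernel is the complement. *)
Lemma separable_semisimple f (p : {poly L}) : separable_poly p ->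
  (forall v, papp f p v = 0) -> semisimple_end f.
Proof.
rewrite unlock => /Bezout_eq1_coprimepP[[a b] /= ab1] pf U /subvP fU.
have fU' u : u \in U -> f u \in U by move=> uU; apply/fU/memv_img.
have [D [lD Df DU Du]] := divided_difference p (lfun_linear (projv U)) (memv_proj U)
  (fun u => @projv_id _ _ U u) fU'.
pose E v := papp f b (D v).
have lE : linear E by apply: linear_comp lD; apply: papp_linear.
have fD v : f (D v) = D (f v).
  by apply/eqP; rewrite -subr_eq0 Df !pf linear0 subrr.
have EU v : E v \in U.
  apply: memv_suml => i _; apply: memvZ.
  by elim: (i : nat) => //= k IHk; apply: fU'.
have Eu u : u \in U -> E u = u.
  move=> uU; rewrite /E Du // -pappM // -[RHS](papp1 f) -ab1.
  by rewrite pappD // (pappM (lfun_linear f) a) pf (linear_fun0 (papp_linear _ _)) // add0r.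
have EE v : linfun E v = E v by apply: linfun_apply.
exists (lker (linfun E)); split.
- apply/subvP=> _ /memv_imgP[v vE ->]; move: vE; rewrite !memv_ker !EE => /eqP vE.
  by rewrite /E -fD -(papp_comm (g := f)) // -/(E v) vE linear0.
- apply/eqP; rewrite eqEsubv subvf; apply/subvP=> v _.
  rewrite -[v](subrK (E v)) addrC memv_add // memv_ker EE.
  by rewrite -scaleN1r addrC lE (Eu _ (EU v)) scaleN1r addNr.
apply/eqP; rewrite -subv0; apply/subvP=> u /memv_capP[uU].
by rewrite memv_ker EE Eu // memv0.
Qed.

(** A subspace of maximal dimension among those contained in S is all of S. *)
Lemma vspace_of_pred (S : V -> Prop) : S 0 ->
  (forall a u v, S u -> S v -> S (a *: u + v)) ->
  exists U, forall v, v \in U <-> S v.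
Proof.
move=> S0 SZD.
pose P n := `[< exists2 U, \dim U = n & forall v, v \in U -> S v >].
have exP : exists n, P n.
  exists 0%N; apply/asboolP; exists 0%VS; first exact: dimv0.
  by move=> v; rewrite memv0 => /eqP ->.
have leP n : P n -> (n <= \dim {:V})%N.
  by move=> /asboolP[U <- _]; rewrite dimvS ?subvf.
case: (ex_maxnP exP leP) => n /asboolP[U dU US] maxn.
exists U => v; split=> [/US //|Sv].
have : P (\dim (U + <[v]>)).
  apply/asboolP; exists (U + <[v]>)%VS => // _ /memv_addP[u uU [_ /vlineP[a ->] ->]].
  by rewrite addrC; apply: SZD => //; apply: US.
move=> /maxn; rewrite -dU => le_dim.
have /eqP-> : U == (U + <[v]>)%VS by rewrite eqEdim addvSl.
exact: (subvP (addvSr _ _)) (memv_line v).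
Qed.

Lemma cyclic_subspace f x : exists U, forall v, v \in U <-> exists p, v = papp f p x.
Proof.
apply: vspace_of_pred => [|a _ _ [p ->] [q ->]]; first by exists 0; rewrite papp0.
by exists (a *: p + q); rewrite pappD // pappZ.
Qed.

Lemma semisimple_projection f U : semisimple_end f ->
  (forall u, u \in U -> f u \in U) ->
  exists pi : 'End(V), [/\ forall v, pi (f v) = f (pi v),
    forall v, pi v \in U & forall v, v \in U -> pi v = v].
Proof.
move=> ss fU; have [|W [/subvP fW UW dUW]] := ss U.
  by apply/subvP=> _ /memv_imgP[v vU ->]; apply: fU.
exists (daddv_pi U W); split=> [v|v|v]; [|exact: memv_pi|exact: daddv_pi_id].
have vE w : daddv_pi U W w + daddv_pi W U w = w.
  by apply: daddv_pi_add => //; rewrite UW memvf.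
have piW w : w \in W -> daddv_pi U W w = 0.
  move=> wW; have := vE w; rewrite [daddv_pi W U _]daddv_pi_id 1?capvC //.
  by move=> /(canRL (addrK _)) ->; rewrite subrr.
rewrite -{1}[v]vE !linearD /= [X in _ + X]piW ?addr0.
  exact: daddv_pi_id dUW (fU _ (memv_pi _ _ _)).
by apply: fW; apply: memv_img; apply: memv_pi.
Qed.

(** By semisimplicity g preserves cyclic subspaces. Let x have a cyclic subspace
    C of maximal dimension, with equivariant projector pi, and let g x = p(f) x.
    If pi u = 0, maximality forces pi to be injective on the cyclic subspace of
    x + u; then g (x + u) = q(f) (x + u), with q(f) x = p(f) x, implies that
    q(f) and p(f) agree on x + u, hence g u = p(f) u. *)
Lemma bicommutant f g : semisimple_end f ->
  (forall h : 'End(V), (forall v, h (f v) = f (h v)) ->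
     forall v, g (h v) = h (g v)) ->
  exists p, forall v, g v = papp f p v.
Proof.
move=> ss gC; have [C CP] := choice (cyclic_subspace f).
have self x : x \in C x by apply/CP; exists 1; rewrite papp1.
have proj x : exists pi : 'End(V), [/\ forall v, pi (f v) = f (pi v),
    forall v, pi v \in C x & forall v, v \in C x -> pi v = v].
  apply: semisimple_projection => // _ /CP[p ->]; apply/CP; exists (p * 'X).
  by rewrite pappMX // papp_comm.
have g_stable x : exists p, g x = papp f p x.
  have [pi [fpi piC piid]] := proj x; apply/CP; rewrite -[x in g x]piid ?self //.
  by rewrite gC.
have [x xmax] : exists x, forall y, (\dim (C y) <= \dim (C x))%N.
  pose P n := `[< exists x, \dim (C x) = n >].
  have exP : exists n, P n by exists (\dim (C 0)); apply/asboolP; exists 0.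
  have leP n : P n -> (n <= \dim {:V})%N.
    by move=> /asboolP[x <-]; rewrite dimvS ?subvf.
  case: (ex_maxnP exP leP) => n /asboolP[x dx] maxn; exists x => y; rewrite dx.
  by apply: maxn; apply/asboolP; exists y.
have fg v : g (f v) = f (g v) by apply: gC.
have [p gx] := g_stable x; exists p => y.
have [pi [fpi piC piid]] := proj x.
suff on_compl u : pi u = 0 -> g u = papp f p u.
  have [q yq] : exists q, pi y = papp f q x by apply/CP.
  have u0 : pi (y - pi y) = 0 by rewrite linearB /= [pi (pi y)]piid ?subrr.
  rewrite -[y](subrK (pi y)) (linear_funD _ _ (lfun_linear g)) (linear_funD _ _ (papp_linear _ _)) //.
  rewrite (on_compl _ u0) yq; congr (_ + _).
  rewrite (papp_comm (g := g)) // gx -!pappM // mulrC //.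
move=> piu; have [q gq] := g_stable (x + u).
have piP r v : pi (papp f r v) = papp f r (pi v) by rewrite (papp_comm (g := pi)).
have pix : pi x = x by rewrite piid ?self.
have pix_z r : pi (papp f r (x + u)) = papp f r x by rewrite piP linearD /= pix piu addr0.
(* Apply pi to g (x + u): it commutes with g and kills u. *)
have pq_x : papp f q x = papp f p x.
  by rewrite -pix_z -gq -gC // linearD /= pix piu addr0.
have piC_inj : (C (x + u)%R :&: lker pi)%VS = 0%VS.
  apply/eqP; rewrite -dimv_eq0 -leqn0 -(leq_add2r (\dim (pi @: C (x + u)%R))).
  rewrite limg_ker_dim add0n (leq_trans (xmax _)) // dimvS //.
  apply/subvP=> v /CP[r ->]; rewrite -pix_z; apply: memv_img.
  by apply/CP; exists r.
have : papp f (q - p) (x + u) \in (C (x + u)%R :&: lker pi)%VS.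
  rewrite memv_cap memv_ker pix_z; apply/andP; split; first by apply/CP; exists (q - p).
  by rewrite pappD // -scaleN1r pappZ pq_x scaleN1r subrr.
rewrite piC_inj memv0 pappD // -scaleN1r pappZ scaleN1r -gq subr_eq0 => /eqP.
by rewrite (linear_funD _ _ (lfun_linear g)) (linear_funD _ _ (papp_linear _ _)) // gx => /addrI.
Qed.

End SemisimpleEnd.

(** * Traces of endomorphisms of vector spaces *)

Section EndTrace.
Variable L : fieldType.
Implicit Types V W U : vectType L.

Definition lfun_trace V (f : 'End(V)) : L := \sum_i vcrd i (f (vbas i)).

Definition lfun_pow V (f : 'End(V)) k : 'End(V) := iter k (comp_lfun f) \1%VF.

Lemma lfun_powE V (f : 'End(V)) k v : lfun_pow f k v = iter k f v.
Proof. by elim: k => [|k IHk]; rewrite /= ?id_lfunE // comp_lfunE IHk. Qed.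

Definition mx_of V W (f : 'Hom(V, W)) := passmx.mxof (vbasis {:V}) (vbasis {:W}) f.

(** Coordinates with respect to the basis that lfun_trace uses, so that results
    on matrices apply. *)
Definition rv_of V (v : V) := passmx.rVof (vbasis {:V}) v.

Lemma rv_of_app V W (f : 'Hom(V, W)) v : rv_of (f v) = rv_of v *m mx_of f.
Proof. by apply: passmx.rVof_app; apply: vbasisP. Qed.

Lemma rv_of_inj V : injective (@rv_of V).
Proof. exact/can_inj/passmx.rVofK/vbasisP. Qed.

Lemma rv_of_linear V : linear (@rv_of V).
Proof. exact: passmx.rVof_linear. Qed.

Lemma mx_of_comp V W U (f : 'Hom(V, W)) (g : 'Hom(W, U)) :
  mx_of (g \o f)%VF = mx_of f *m mx_of g.
Proof. exact/passmx.mxof_comp/vbasisP. Qed.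

Lemma mx_of1 V : mx_of (\1%VF : 'End(V)) = 1%:M.
Proof. exact/passmx.mxof1/basis_free/vbasisP. Qed.

Lemma mx_of_pow V (f : 'End(V)) k : mx_of (lfun_pow f k) = mx_of f ^+ k.
Proof.
elim: k => [|k IHk]; first exact: mx_of1.
by rewrite exprSr -mulmxE -IHk -mx_of_comp.
Qed.

Lemma lfun_traceE V (f : 'End(V)) : lfun_trace f = \tr (mx_of f).
Proof. by apply: eq_bigr => i _; rewrite !mxE /= passmx.vecof_delta. Qed.

Lemma papp_mx V (f : 'End(V)) p v :
  rv_of (papp f p v) = rv_of v *m horner_sq (mx_of f) p.
Proof.
rewrite horner_sqE mulmx_sumr (linear_fun_sum _ _ (@rv_of_linear _)).
apply: eq_bigr => i _; rewrite (linear_funZ _ _ (@rv_of_linear _)).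
by rewrite -scalemxAr -mx_of_pow -rv_of_app lfun_powE.
Qed.

Lemma lfun_trace_exp0_nilpotent V (f : 'End(V)) : [pchar L] =i pred0 ->
  (forall k, lfun_trace (lfun_pow f k.+1) = 0) -> exists k, forall v, iter k f v = 0.
Proof.
move=> char0 trf; have [k fk] : exists k, mx_of f ^+ k = 0.
  by apply: mxtrace_exp0_nilpotent => // k; rewrite -mx_of_pow -lfun_traceE.
exists k => v; apply: rv_of_inj; rewrite -lfun_powE rv_of_app mx_of_pow fk mulmx0.
by rewrite (linear_fun0 (@rv_of_linear _)).
Qed.

(** Matrices act on rows here, so intertwiners of f and g are intertwiners of
    their matrices in the same order. *)
Lemma separating_poly_lfun (K : fieldType) (iota : {rmorphism K -> L}) V W
    (f : 'End(V)) (g : 'End(W)) : [pchar K] =i pred0 ->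
  (forall k, exists c, lfun_trace (lfun_pow f k) - lfun_trace (lfun_pow g k) = iota c) ->
  (forall h : 'Hom(V, W), (forall v, h (f v) = g (h v)) -> h = 0) ->
  exists P : {poly K}, (forall v, papp f (map_poly iota P) v = v) /\
                       (forall w, papp g (map_poly iota P) w = 0).
Proof.
move=> char0 trK noh.
have [||P [Pf Pg]] := @separating_poly K L iota _ _ (mx_of f) (mx_of g) char0.
- by move=> k; have [c cE] := trK k; exists c; rewrite -cE !lfun_traceE !mx_of_pow.
- move=> h hE; pose h' := passmx.hommx (vbasis {:V}) (vbasis {:W}) h.
  have hK : mx_of h' = h by apply: passmx.hommxK; apply: vbasisP.
  rewrite -hK (noh h'); first exact: linear_fun0 (@passmx.mxof_linear _ _ _ _ _).
  move=> v; apply: rv_of_inj.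
  by rewrite !rv_of_app -!mulmxA hK hE.
exists P; split=> v; apply: rv_of_inj; rewrite papp_mx.
  by rewrite Pf mulmx1.
by rewrite Pg mulmx0 (linear_fun0 (@rv_of_linear _)).
Qed.

End EndTrace.

(** * Elements of the realisation of an object *)

#[local] Opaque stens sid scmp stensm sassoc sassoci slunit srunit sbraid.

Section Elements.
Variables (K L : fieldType) (iota : {rmorphism K -> L}) (A : rigidCat K).
Variable (H : tensorFunctor iota A (svect L)).
Implicit Types M N P Q : A.
Local Notation one := (@unit_ob K A).

(** The arguments below are carried out on elements of the total space of H(M),
    odd part included. On elements, happ is the action of a morphism, ten x y
    the image of x (x) y in H(M (x) N), and hone the image of 1 in H(1). *)
Definition tot M : vectType L := stot (H M : supervect L).

Definition happ M N (f : mor M N) : tot M -> tot N :=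
  sapp (fmap H f : shom (H M) (H N)).

Definition ten M N (x : tot M) (y : tot N) : tot (M \ox N) :=
  sapp (tfun_mu H M N : shom (stens (H M) (H N)) (H (M \ox N))) (spure x y).

Definition hone : tot one :=
  sapp (tfun_eta H : shom (sone L) (H one)) ((1, 0) : stot (sone L)).

Lemma happ_linear M N (f : mor M N) : linear (happ f).
Proof. exact: sapp_linear. Qed.

Lemma happ_id M x : happ (idm M) x = x.
Proof. by rewrite /happ fmap_id; exact: sapp_id. Qed.

Lemma happ_cmp M N P (g : mor N P) (f : mor M N) x :
  happ (g \oc f) x = happ g (happ f x).
Proof. by rewrite /happ fmap_cmp; exact: sapp_cmp. Qed.

Lemma happ_lin M N a (f g : mor M N) x :
  happ (a *: f + g) x = iota a *: happ f x + happ g x.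
Proof. by rewrite /happ (tfun_linear H a f g); exact: sapp_linear2. Qed.

Lemma happ_inj M N (f g : mor M N) : faithful H ->
  (forall x, happ f x = happ g x) -> f = g.
Proof. by move=> fH fg; apply: fH; apply: sapp_ext. Qed.

Lemma ten_linl M N (y : tot N) : linear (fun x : tot M => ten x y).
Proof. by move=> a u v; rewrite /ten spure_linl sapp_linear. Qed.

Lemma ten_linr M N (x : tot M) : linear (@ten M N x).
Proof. by move=> a u v; rewrite /ten spure_linr sapp_linear. Qed.

Lemma ten_ext M N (U : lmodType L) (f g : tot (M \ox N) -> U) :
  linear f -> linear g -> (forall x y, f (ten x y) = g (ten x y)) -> f =1 g.
Proof.
move=> lf lg fg z; have [nu [_ numu]] := tfun_mu_iso H M N.
have lmu := sapp_linear (tfun_mu H M N : shom (stens (H M) (H N)) (H (M \ox N))).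
have -> : z = sapp (tfun_mu H M N : shom (stens (H M) (H N)) (H (M \ox N))) (sapp (nu : shom (H (M \ox N)) (stens (H M) (H N))) z).
  by rewrite -sapp_cmp [scmp _ _]numu; exact: esym (sapp_id _).
exact: (stens_ext (linear_comp lf lmu) (linear_comp lg lmu) fg).
Qed.

(** As H(M) (x) H(N) = H(M (x) N), the universal property of the tensor product
    holds for ten. *)
Lemma ten_lift M N (U : lmodType L) (b : tot M -> tot N -> U) : bilin b ->
  exists f : tot (M \ox N) -> U, linear f /\ forall x y, f (ten x y) = b x y.
Proof.
move=> bb; have [nu [numu _]] := tfun_mu_iso H M N.
exists (fun z => slift b (sapp (nu : shom (H (M \ox N)) (stens (H M) (H N))) z)).
split; first exact: linear_comp (slift_linear _) (sapp_linear _).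
move=> x y; rewrite -(sliftE x y bb) /ten -sapp_cmp [scmp _ _]numu.
by congr (slift _ _); exact: sapp_id.
Qed.

Lemma happ_ten M M' N N' (f : mor M M') (g : mor N N') x y :
  happ (f \om g) (ten x y) = ten (happ f x) (happ g y).
Proof.
have e : scmp (tfun_mu H M' N') (stensm (fmap H f) (fmap H g)) =
    scmp (fmap H (f \om g)) (tfun_mu H M N) := tfun_mu_nat H f g.
by rewrite /happ /ten -stensmE -!sapp_cmp e.
Qed.

Lemma happ_assoc M N P x y z :
  happ (assoc M N P) (ten (ten x y) z) = ten x (ten y z).
Proof.
have e : scmp (scmp (fmap H (assoc M N P)) (tfun_mu H (M \ox N) P))
      (stensm (tfun_mu H M N) (sid (H P))) =
    scmp (scmp (tfun_mu H M (N \ox P)) (stensm (sid (H M)) (tfun_mu H N P)))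
      (sassoc (H M) (H N) (H P)) := tfun_assoc H M N P.
have e' := congr1 (fun h => sapp h (spure (spure x y) z)) e; move: e' {e} => /=.
rewrite sapp_cmp.
rewrite sapp_cmp.
rewrite stensmE.
rewrite sapp_id.
rewrite sapp_cmp.
rewrite sapp_cmp.
rewrite sassocE.
rewrite stensmE.
rewrite sapp_id.
move=> e.
exact: e.
Qed.

Lemma happ_associ M N P x y z :
  happ (associ M N P) (ten x (ten y z)) = ten (ten x y) z.
Proof. by rewrite -happ_assoc -happ_cmp assocK happ_id. Qed.

Lemma happ_lunit M x : happ (lunit M) (ten hone x) = x.
Proof.
have e : scmp (scmp (fmap H (lunit M)) (tfun_mu H unit_ob M))
      (stensm (tfun_eta H) (sid (H M))) = slunit (H M) := tfun_lunit H M.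
move/(congr1 (fun h => sapp h (spure ((1, 0) : stot (sone L)) x))): e.
by rewrite !sapp_cmp !stensmE sapp_id slunitE scale1r.
Qed.

Lemma happ_runit M x : happ (runit M) (ten x hone) = x.
Proof.
have e : scmp (scmp (fmap H (runit M)) (tfun_mu H M unit_ob))
      (stensm (sid (H M)) (tfun_eta H)) = srunit (H M) := tfun_runit H M.
move/(congr1 (fun h => sapp h (spure x ((1, 0) : stot (sone L))))): e.
by rewrite !sapp_cmp !stensmE sapp_id srunitE scale1r.
Qed.

Lemma happ_braid M N (x : tot M) (y : tot N) : happ (braid M N) (ten x y) =
  ten ((y.1, 0) : tot N) x + ten ((0, y.2) : tot N) ((x.1, - x.2) : tot M).
Proof.
have e : scmp (fmap H (braid M N)) (tfun_mu H M N) =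
    scmp (tfun_mu H N M) (sbraid (H M) (H N)) := tfun_braid H M N.
move/(congr1 (fun h => sapp h (spure x y))): e.
by rewrite !sapp_cmp sbraidE (linear_funD _ _ (sapp_linear _)).
Qed.

Lemma happ_par M N (f : mor M N) p (x : tot M) :
  spar p x -> spar p (happ f x : tot N).
Proof. exact: sapp_par. Qed.

Lemma ten_par M N p q (x : tot M) (y : tot N) :
  spar p x -> spar q y -> spar (p (+) q) (ten x y : tot (M \ox N)).
Proof. by move=> px qy; apply: sapp_par; apply: spure_par. Qed.

Lemma hone_par : spar false (hone : tot one).
Proof. exact: (@sapp_par _ _ _ _ false). Qed.

Definition eta_inv : shom (H one) (sone L) := sval (cid (tfun_eta_iso H)).

Lemma eta_invP : scmp eta_inv (tfun_eta H) = sid (sone L) /\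
                 scmp (tfun_eta H : shom (sone L) (H one)) eta_inv = sid (H one).
Proof. exact: svalP (cid (tfun_eta_iso H)). Qed.

(** H(1) has dimension 1|0: sc is the coordinate on hone. *)
Definition sc (z : tot one) : L := (sapp eta_inv z).1.

Lemma sc_linear a u v : sc (a *: u + v) = a * sc u + sc v.
Proof. by rewrite /sc sapp_linear. Qed.

Lemma sc_one z : sc z *: hone = z.
Proof.
rewrite -[RHS](@sapp_id _ (H one)) -eta_invP.2 sapp_cmp.
rewrite /hone -(linear_funZ _ _ (sapp_linear _)); congr sapp.
apply: (etrans _ (esym (surjective_pairing _))); congr (_, _); first exact: mulr1.
exact: (etrans (thinmx0 _) (esym (thinmx0 _))).
Qed.

Lemma sc1 : sc hone = 1.
Proof. by rewrite /sc /hone -sapp_cmp eta_invP.1 sapp_id. Qed.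

Lemma sc_odd (z : tot one) : z.1 = 0 -> sc z = 0.
Proof. move=> z1; exact: (@sapp_par _ _ _ eta_inv true z z1). Qed.

End Elements.

(** * Duality on elements *)

Section Duality.
Variables (K L : fieldType) (iota : {rmorphism K -> L}) (A : rigidCat K).
Variable (H : tensorFunctor iota A (svect L)).
Implicit Types M N P Q : A.
Local Notation one := (@unit_ob K A).
Local Notation tot := (tot H).
Local Notation hone := (hone H).

Definition coevv M : tot (M \ox dual M) := happ (coev M) hone.

Definition evv M (xi : tot (dual M)) (x : tot M) : L := sc (happ (ev M) (ten xi x)).

Lemma evv_linl M (x : tot M) a u v : evv (a *: u + v) x = a * evv u x + evv v x.
Proof. by rewrite /evv ten_linl happ_linear sc_linear. Qed.

Lemma evv_linr M (xi : tot (dual M)) a u v :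
  evv xi (a *: u + v) = a * evv xi u + evv xi v.
Proof. by rewrite /evv ten_linr happ_linear sc_linear. Qed.

Lemma evvDl M (x : tot M) u v : evv (u + v) x = evv u x + evv v x.
Proof. by rewrite -[u in LHS]scale1r evv_linl mul1r. Qed.

Lemma evvDr M (xi : tot (dual M)) u v : evv xi (u + v) = evv xi u + evv xi v.
Proof. by rewrite -[u in LHS]scale1r evv_linr mul1r. Qed.

Lemma happ_ev M (xi : tot (dual M)) (x : tot M) :
  happ (ev M) (ten xi x) = evv xi x *: hone.
Proof. by rewrite sc_one. Qed.

(** The first snake identity: if coev is the sum of the y_i (x) eta_i, then x is
    the sum of the eta_i(x) y_i. The linear map k stands for the contraction, so
    that no decomposition of coev has to be chosen. *)
Lemma coev_contractr M (U : lmodType L) (x : tot M) (g : tot M -> U)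
    (k : tot (M \ox dual M) -> U) : linear g -> linear k ->
  (forall y eta, k (ten y eta) = evv eta x *: g y) -> k (coevv M) = g x.
Proof.
move=> lg lk kE.
pose S z := happ (runit M \oc (idm M \om ev M) \oc assoc M (dual M) M) (ten z x).
have Sx : S (coevv M) = x.
  rewrite /S /coevv -[x in ten _ x](happ_id (H := H)) -happ_ten -happ_cmp snake1.
  exact: happ_lunit.
rewrite -[in RHS]Sx; move: (coevv M); apply: ten_ext => //.
  apply: linear_comp lg _; apply: linear_comp (happ_linear _) _.
  exact: ten_linl.
move=> y eta; rewrite kE /S !happ_cmp happ_assoc happ_ten happ_id happ_ev.
rewrite (linear_funZ _ _ (ten_linr _)) (linear_funZ _ _ (happ_linear _)).
by rewrite happ_runit (linear_funZ _ _ lg).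
Qed.

(** The second snake identity, in the form of the previous lemma. *)
Lemma coev_contractl M (U : lmodType L) (xi : tot (dual M)) (g : tot (dual M) -> U)
    (k : tot (M \ox dual M) -> U) : linear g -> linear k ->
  (forall y eta, k (ten y eta) = evv xi y *: g eta) -> k (coevv M) = g xi.
Proof.
move=> lg lk kE.
pose S z := happ (lunit (dual M) \oc (ev M \om idm (dual M))
      \oc associ (dual M) M (dual M)) (ten xi z).
have Sx : S (coevv M) = xi.
  rewrite /S /coevv -[xi in ten xi _](happ_id (H := H)) -happ_ten -happ_cmp snake2.
  exact: happ_runit.
rewrite -[in RHS]Sx; move: (coevv M); apply: ten_ext => //.
  apply: linear_comp lg _; apply: linear_comp (happ_linear _) _.
  exact: ten_linr.
move=> y eta; rewrite kE /S !happ_cmp happ_associ happ_ten happ_id happ_ev.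
rewrite (linear_funZ _ _ (ten_linl _)) (linear_funZ _ _ (happ_linear _)).
by rewrite happ_lunit (linear_funZ _ _ lg).
Qed.

Lemma evv_par M p (xi : tot (dual M)) (x : tot M) :
  spar p xi -> spar (~~ p) x -> evv xi x = 0.
Proof.
move=> pxi px; apply: sc_odd; have := ten_par pxi px.
rewrite addbN addbb => px'.
exact: (@happ_par _ _ _ _ H _ _ (ev M) true _ px').
Qed.

Definition even_part M (x : tot M) : tot M := (x.1, 0).
Definition odd_part M (x : tot M) : tot M := (0, x.2).

Lemma even_part_linear M : linear (@even_part M).
Proof. by move=> a u v; congr (_, _); rewrite /= scaler0 addr0. Qed.
Lemma even_odd M (x : tot M) : even_part x + odd_part x = x.
Proof. exact: esym (stot_split x). Qed.

(** The trace involves ev o braid; by the Koszul rule this is the evaluation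
    twisted by the grading. *)
Lemma happ_ev_braid M (x : tot M) (xi : tot (dual M)) :
  happ (ev M \oc braid M (dual M)) (ten x xi) =
  (evv xi (even_part x) - evv xi (odd_part x)) *: hone.
Proof.
rewrite happ_cmp happ_braid (linear_funD _ _ (happ_linear _)) !happ_ev -scalerDl.
congr (_ *: _); rewrite [in RHS]/even_part.
have gamma : evv ((0, xi.2) : tot (dual M)) ((x.1, - x.2) : tot M) =
    - evv ((0, xi.2) : tot (dual M)) (odd_part x).
  have -> : ((x.1, - x.2) : tot M) = (-1) *: odd_part x + even_part x.
    by congr (_, _); rewrite /= ?scaler0 ?add0r ?addr0 ?scaleN1r.
  by rewrite evv_linr mulN1r [X in _ + X](@evv_par _ true) ?addr0.
rewrite gamma; congr (_ - _).
  have -> : evv xi (even_part x) = evv (even_part xi) (even_part x).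
    by rewrite -[xi in LHS]even_odd evvDl [X in _ + X](@evv_par _ true) ?addr0.
  by rewrite -[x in LHS]even_odd evvDr [X in _ + X](@evv_par _ false) ?addr0.
by rewrite -[xi in RHS]even_odd evvDl [X in _ = X + _](@evv_par _ false) ?add0r.
Qed.

End Duality.

(** * The categorical trace as a supertrace *)

Section Trace.
Variables (K L : fieldType) (iota : {rmorphism K -> L}) (A : rigidCat K).
Variable (H : tensorFunctor iota A (svect L)).
Implicit Types M N P Q : A.
Local Notation one := (@unit_ob K A).
Local Notation tot := (tot H).
Local Notation hone := (hone H).

Definition hplus M N (f : mor M N) : 'Hom(svp (H M), svp (H N)) :=
  (fmap H f : shom (H M) (H N)).1.
Definition hminus M N (f : mor M N) : 'Hom(svm (H M), svm (H N)) :=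
  (fmap H f : shom (H M) (H N)).2.

Lemma happE M N (f : mor M N) x : happ f x = (hplus f x.1, hminus f x.2) :> tot N.
Proof. by []. Qed.

(** By the snake identity coev stands for the identity of H(M). Pairing (f (x)
    1)(coev) by means of ev o braid therefore gives the trace of f on the even
    part, and minus the trace of f on the odd part because of the braiding. *)
Lemma happ_tr M (f : mor M M) :
  sc (happ (tr f) hone) = lfun_trace (hplus f) - lfun_trace (hminus f).
Proof.
pose theta (z : tot (M \ox dual M)) : L^o :=
  sc (happ (ev M \oc braid M (dual M)) (happ (f \om idm (dual M)) z)).
have ltheta : linear theta by move=> a u v; rewrite /theta !happ_linear sc_linear.
have thetaE y eta : theta (ten y eta) =
    evv eta (even_part (happ f y)) - evv eta (odd_part (happ f y)).
  rewrite /theta happ_ten happ_id happ_ev_braid -[_ *: hone]addr0 sc_linear sc1.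
  by rewrite sc_odd // addr0 mulr1.
have -> : sc (happ (tr f) hone) = theta (coevv H M).
  by rewrite /theta /coevv -!happ_cmp /tr -!cmpA.
(* The diagonal coefficients of the even and of the odd part of f, as bilinear
   forms to be contracted with coev. *)
pose bp k (y : tot M) (eta : tot (dual M)) : L^o :=
  evv eta ((vbas k, 0) : tot M) * vcrd k (hplus f y.1).
pose bm k (y : tot M) (eta : tot (dual M)) : L^o :=
  evv eta ((0, vbas k) : tot M) * vcrd k (hminus f y.2).
have bbp k : bilin (bp k).
  split=> [eta|y] a u v; rewrite /bp.
    by rewrite [_.1]/= linearP vcrd_linear mulrDr mulrCA.
  by rewrite evv_linl mulrDl -mulrA.
have bbm k : bilin (bm k).
  split=> [eta|y] a u v; rewrite /bm.
    by rewrite [_.2]/= linearP vcrd_linear mulrDr mulrCA.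
  by rewrite evv_linl mulrDl -mulrA.
have [kp kpP] := choice (fun k => ten_lift (bbp k)).
have [km kmP] := choice (fun k => ten_lift (bbm k)).
have -> : lfun_trace (hplus f) = \sum_k kp k (coevv H M).
  apply: eq_bigr => k _; have [lk kE] := kpP k; apply/esym.
  apply: (coev_contractr (x := (vbas k, 0)) (g := fun y => vcrd k (hplus f y.1) : L^o)) => //.
  by move=> a u v; rewrite [_.1]/= linearP vcrd_linear.
have -> : lfun_trace (hminus f) = \sum_k km k (coevv H M).
  apply: eq_bigr => k _; have [lk kE] := kmP k; apply/esym.
  apply: (coev_contractr (x := (0, vbas k)) (g := fun y => vcrd k (hminus f y.2) : L^o)) => //.
  by move=> a u v; rewrite [_.2]/= linearP vcrd_linear.
apply: (ten_ext (g := fun z => \sum_k kp k z - \sum_k km k z) ltheta) => [a u v|y eta].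
  rewrite scalerBr scaler_sumr scaler_sumr addrACA -opprD -!big_split /=.
  congr (_ - _); apply: eq_bigr => k _; first exact: (kpP k).1.
  exact: (kmP k).1.
have evsum n (c : 'I_n -> L) (x : 'I_n -> tot M) :
    evv eta (\sum_i c i *: x i) = \sum_i c i * evv eta (x i).
  have lev : linear (evv eta : tot M -> L^o) by move=> a u v; rewrite evv_linr.
  rewrite (linear_fun_sum _ _ lev); apply: eq_bigr => i _.
  exact: (linear_funZ _ _ lev).
rewrite thetaE; congr (_ - _).
  under eq_bigr do rewrite (kpP _).2.
  under eq_bigr do rewrite /bp mulrC.
  rewrite -evsum; congr (evv eta); rewrite /even_part happE [in LHS](vect_sum (hplus f y.1)).
  rewrite [LHS](linear_fun_sum _ _ (inl_linear (V := H M))); apply: eq_bigr => k _.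
  exact: (linear_funZ _ _ (inl_linear (V := H M))).
under eq_bigr do rewrite (kmP _).2.
under eq_bigr do rewrite /bm mulrC.
rewrite -evsum; congr (evv eta); rewrite /odd_part happE [in LHS](vect_sum (hminus f y.2)).
rewrite [LHS](linear_fun_sum _ _ (inr_linear (V := H M))); apply: eq_bigr => k _.
exact: (linear_funZ _ _ (inr_linear (V := H M))).
Qed.
End Trace.

(** * Numerical triviality and nilpotence *)

Section EndHorner.
Variables (R : fieldType) (C : linCat R).
Implicit Types X Y : C.

Lemma cmp_linear X Y Z (f : mor Y Z) : linear (cmp f : mor X Y -> mor X Z).
Proof. exact: cmp_linearr. Qed.

Lemma end_powE X Y (f : mor X X) (g : mor Y X) k : iter k (cmp f) g = end_pow f k \oc g.
Proof. by elim: k => [|k IHk] /=; rewrite ?cmp1m // IHk cmpA. Qed.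

Lemma papp_end_horner X Y (f : mor X X) p (g : mor Y X) :
  papp (cmp f) p g = end_horner f p \oc g.
Proof.
rewrite /papp /end_horner (linear_fun_sum _ _ (cmp_linearl g)).
by apply: eq_bigr => i _; rewrite end_powE cmpZl.
Qed.

Lemma end_hornerE X (f : mor X X) p : end_horner f p = papp (cmp f) p (idm X).
Proof. by rewrite papp_end_horner cmpm1. Qed.

Lemma end_hornerM X (f : mor X X) p q :
  end_horner f (p * q) = end_horner f p \oc end_horner f q.
Proof. by rewrite !end_hornerE pappM ?papp_end_horner ?cmpm1 //; apply: cmp_linear. Qed.

Lemma end_horner_nat X Y (fX : mor X X) (fY : mor Y Y) (g : mor X Y) p :
  fY \oc g = g \oc fX -> end_horner fY p \oc g = g \oc end_horner fX p.
Proof.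
move=> fg; rewrite /end_horner (linear_fun_sum _ _ (cmp_linearl g)).
rewrite (linear_fun_sum _ _ (cmp_linear g)); apply: eq_bigr => i _.
rewrite cmpZl cmpZr; congr (_ *: _).
elim: (i : nat) => [|k IHk] /=; first by rewrite cmp1m cmpm1.
by rewrite -cmpA IHk !cmpA fg.
Qed.

Lemma end_pow_nat X Y (fX : mor X X) (fY : mor Y Y) (g : mor X Y) k :
  fY \oc g = g \oc fX -> end_pow fY k \oc g = g \oc end_pow fX k.
Proof.
move=> fg; elim: k => [|k IHk] /=; first by rewrite cmp1m cmpm1.
by rewrite -cmpA IHk !cmpA fg.
Qed.

Lemma end_horner_comb X (f : mor X X) n (k : 'I_n -> R) :
  exists2 q : {poly R}, (size q <= n)%N & end_horner f q = \sum_i k i *: end_pow f i.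
Proof.
exists (\poly_(i < n) (if insub i is Some j then k j else 0)); first exact: size_poly.
rewrite end_hornerE (@papp_wide _ _ _ _ n) ?size_poly //.
by apply: eq_bigr => i _; rewrite coef_poly ltn_ord valK end_powE cmpm1.
Qed.

Lemma end_horner_id X p : end_horner (idm X) p = p.[1] *: idm X.
Proof.
by rewrite end_hornerE papp_eigen ?cmp1m.
Qed.

End EndHorner.

(** Write X = c r with c of full column rank and r of full row rank: X X = 0
    forces r c = 0. *)
Lemma mxtrace_sqr0 (F : fieldType) n (X : 'M[F]_n) : X *m X = 0 -> \tr X = 0.
Proof.
move=> XX; rewrite -[X in \tr X](mulmx_base X) mxtrace_mulC.
move: (mulmx_base X) (col_base_full X) (row_base_free X).
move: (row_base X) (col_base X) => r c cr c_full r_free.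
suff -> : r *m c = 0 by rewrite mxtrace0.
apply: (row_full_inj c_full); apply: (row_free_inj r_free) => /=.
by rewrite mulmx0 mul0mx -!mulmxA cr mulmxA cr.
Qed.

Section NumericallyTrivial.
Variables (K : fieldType) (A : rigidCat K).
Implicit Types M N : A.

Lemma numtrivZ M N a (f : mor M N) : f \in @numtriv K A M N -> a *: f \in @numtriv K A M N.
Proof. by move=> /numtrivP fN; apply/numtrivP=> g; rewrite cmpZr trZ fN scaler0. Qed.

Lemma numtrivD M N (f g : mor M N) :
  f \in @numtriv K A M N -> g \in @numtriv K A M N -> f + g \in @numtriv K A M N.
Proof.
by move=> /numtrivP fN /numtrivP gN; apply/numtrivP=> h; rewrite cmpDr trD fN gN addr0.
Qed.

Lemma numtrivB M N (f g : mor M N) :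
  f \in @numtriv K A M N -> g \in @numtriv K A M N -> f - g \in @numtriv K A M N.
Proof. by move=> fN gN; rewrite -scaleN1r numtrivD ?numtrivZ. Qed.

End NumericallyTrivial.

Section TraceScalar.
Variables (K L : fieldType) (iota : {rmorphism K -> L}) (A : rigidCat K).
Variable (H : tensorFunctor iota A (svect L)).
Implicit Types M N P Q : A.
Local Notation one := (@unit_ob K A).
Local Notation tot := (tot H).
Local Notation numtriv M N := (@numtriv K A M N).
Local Notation hone := (hone H).

Lemma happ0 M N (x : tot M) : happ (0 : mor M N) x = 0 :> tot N.
Proof.
have := happ_lin (H := H) (-1) 0 (0 : mor M N) x.
by rewrite scaler0 addr0 rmorphN1 scaleN1r addNr.
Qed.

Lemma happZ M N a (f : mor M N) (x : tot M) :
  happ (a *: f) x = iota a *: happ f x :> tot N.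
Proof. by rewrite -[a *: f]addr0 happ_lin happ0 addr0. Qed.

Lemma happD M N (f g : mor M N) (x : tot M) :
  happ (f + g) x = happ f x + happ g x :> tot N.
Proof. by rewrite -[f in LHS]scale1r happ_lin rmorph1 scale1r. Qed.

Lemma happ_sum (n : nat) M N (c : 'I_n -> K) (g : 'I_n -> mor M N) (x : tot M) :
  happ (\sum_i c i *: g i) x = \sum_i iota (c i) *: happ (g i) x :> tot N.
Proof.
elim: n c g => [|n IHn] c g.
  by rewrite !big_ord0 happ0.
by rewrite !big_ord_recr /= -IHn addrC happ_lin addrC.
Qed.

Lemma happ_pow M (f : mor M M) k (x : tot M) : happ (end_pow f k) x = iter k (happ f) x.
Proof. by elim: k => [|k IHk] /=; rewrite ?happ_id // happ_cmp IHk. Qed.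

Lemma happ_horner M (f : mor M M) p (x : tot M) :
  happ (end_horner f p) x = papp (happ f) (map_poly iota p) x.
Proof.
rewrite /end_horner happ_sum (@papp_wide _ _ _ _ (size p)) ?size_poly //.
by apply: eq_bigr => i _; rewrite coef_map happ_pow.
Qed.

Lemma hplus_cmp M N P (g : mor N P) (f : mor M N) :
  hplus H (g \oc f) = (hplus H g \o hplus H f)%VF.
Proof. by rewrite /hplus fmap_cmp. Qed.

Lemma hminus_cmp M N P (g : mor N P) (f : mor M N) :
  hminus H (g \oc f) = (hminus H g \o hminus H f)%VF.
Proof. by rewrite /hminus fmap_cmp. Qed.

Lemma hplus0 M N : hplus H (0 : mor M N) = 0.
Proof.
apply/lfunP=> v; rewrite zero_lfunE.
by have /(congr1 (fun z : tot N => z.1)) := @happ0 M N ((v, 0) : tot M).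
Qed.

Lemma hminus0 M N : hminus H (0 : mor M N) = 0.
Proof.
apply/lfunP=> v; rewrite zero_lfunE.
by have /(congr1 (fun z : tot N => z.2)) := @happ0 M N ((0, v) : tot M).
Qed.

Lemma hplus_pow M (f : mor M M) k : hplus H (end_pow f k) = lfun_pow (hplus H f) k.
Proof.
elim: k => [|k IHk] /=; first by rewrite /hplus fmap_id.
by rewrite hplus_cmp IHk.
Qed.

Lemma hminus_pow M (f : mor M M) k : hminus H (end_pow f k) = lfun_pow (hminus H f) k.
Proof.
elim: k => [|k IHk] /=; first by rewrite /hminus fmap_id.
by rewrite hminus_cmp IHk.
Qed.

Lemma tr_scalar M (f : mor M M) : exists c, tr f = c *: idm one /\
  iota c = lfun_trace (hplus H f) - lfun_trace (hminus H f).
Proof.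
have [t _ tK] := end_unit A; exists (t (tr f)); split; first by rewrite tK.
rewrite -happ_tr -{2}(tK (tr f)) happZ happ_id -[_ *: hone]addr0 sc_linear sc1.
by rewrite sc_odd // addr0 mulr1.
Qed.

Lemma tr_eq0 M (f : mor M M) :
  (tr f = 0) <-> lfun_trace (hplus H f) = lfun_trace (hminus H f).
Proof.
have [c [-> cE]] := tr_scalar f; split=> [c0|/eqP].
  apply/eqP; rewrite -subr_eq0 -cE; have : c = 0.
    have [t Kt tK] := end_unit A; rewrite -[c]Kt c0.
    by rewrite -[0 in LHS](scale0r (idm one)) Kt.
  by move=> ->; rewrite rmorph0.
by rewrite -subr_eq0 -cE fmorph_eq0 => /eqP->; rewrite scale0r.
Qed.

Section Nilpotence.
Hypotheses (char0 : [pchar K] =i pred0) (Hfaith : faithful H).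

Lemma end_pow_eq0 M (f : mor M M) k : end_pow f k = 0 <-> forall x : tot M, iter k (happ f) x = 0.
Proof.
split=> [fk x|fk]; first by rewrite -happ_pow fk happ0.
by apply: (happ_inj Hfaith) => x; rewrite happ_pow fk happ0.
Qed.

(** Let p realise the projector onto the even part. As p f^k and f^k have trace
    0 for k > 0, the traces of f^k on the even and on the odd part are both 0,
    so f acts nilpotently on both. *)
Lemma numtriv_nilpotent M (f : mor M M) : sign_conjecture H M ->
  f \in numtriv M M -> exists k, end_pow f k = 0.
Proof.
move=> [p pE] fN.
have fkN k : end_pow f k.+1 \in numtriv M M.
  elim: k => [|k IHk] /=; first by rewrite cmpm1.
  exact: numtriv_cmpr.
have plus0 k : lfun_trace (lfun_pow (hplus H f) k.+1) = 0.
  have /numtrivP/(_ p)/tr_eq0 := fkN k.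
  have -> : hplus H (p \oc end_pow f k.+1) = hplus H (end_pow f k.+1).
    by rewrite hplus_cmp {1}/hplus pE comp_lfun1l.
  have -> : hminus H (p \oc end_pow f k.+1) = 0.
    by rewrite hminus_cmp {1}/hminus pE comp_lfun0l.
  rewrite hplus_pow => ->; rewrite /lfun_trace big1 // => i _.
  by rewrite zero_lfunE /vcrd linear0.
have minus0 k : lfun_trace (lfun_pow (hminus H f) k.+1) = 0.
  have /numtrivP/(_ (idm M))/tr_eq0 := fkN k.
  by rewrite cmp1m hplus_pow hminus_pow plus0.
have [k1 f1] := lfun_trace_exp0_nilpotent (pchar0_ext iota char0) plus0.
have [k2 f2] := lfun_trace_exp0_nilpotent (pchar0_ext iota char0) minus0.
have iter0 V (g : 'End(V)) i j : (forall v, iter i g v = 0) -> forall v, iter (j + i) g v = 0.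
  by move=> gi v; rewrite iterD gi; elim: j => //= j ->; rewrite linear0.
exists (k1 + k2)%N; apply/end_pow_eq0 => x.
have -> k : iter k (happ f) x = (iter k (hplus H f) x.1, iter k (hminus H f) x.2).
  by elim: k => [|k IHk]; [case: (x)|rewrite /= IHk].
by rewrite [in LHS]addnC iter0 // addnC iter0.
Qed.

(** As f is central, g f has square 0 for every g, so its even and odd traces
    vanish. *)
Lemma numtriv_sqr0 M (f : mor M M) :
  (forall g : mor M M, f \oc g = g \oc f) -> f \oc f = 0 -> f \in numtriv M M.
Proof.
move=> fC ff; apply/numtrivP=> g; apply/tr_eq0.
have gf2 : (g \oc f) \oc (g \oc f) = 0.
  by rewrite -cmpA [f \oc _]cmpA fC -cmpA ff !cmp0r.
have tr0 (V : vectType L) (u : 'End(V)) : (u \o u)%VF = 0 -> lfun_trace u = 0.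
  move=> uu; rewrite lfun_traceE mxtrace_sqr0 // -mx_of_comp uu.
  exact: linear_fun0 (@passmx.mxof_linear _ _ _ _ _).
by rewrite !tr0 // -?hplus_cmp -?hminus_cmp gf2 ?hplus0 ?hminus0.
Qed.

End Nilpotence.

End TraceScalar.

(** * Descent of linear relations between morphisms *)

(** On the vectors c over K for which the sum of the l_i c_i lies in K, this sum
    is a K-linear functional; k is an extension of it. It serves as a K-linear
    retraction of L onto K, defined on the span of the l_i only. *)
Lemma finite_retraction (K L : fieldType) (iota : {rmorphism K -> L}) n
    (l : 'I_n -> L) :
  exists k : 'I_n -> K, forall (c : 'I_n -> K) c0,
    \sum_i l i * iota (c i) = iota c0 -> \sum_i k i * c i = c0.
Proof.
pose S (c : 'rV[K]_n) := exists c0, \sum_i l i * iota (c 0 i) = iota c0.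
have [|a u v [cu uE] [cv vE]|W WP] := @vspace_of_pred K 'rV[K]_n S.
- by exists 0; rewrite big1 ?rmorph0 // => i _; rewrite mxE rmorph0 mulr0.
- exists (a * cu + cv); rewrite rmorphD rmorphM /= -uE -vE mulr_sumr -big_split.
  by apply: eq_bigr => i _; rewrite !mxE rmorphD rmorphM /= mulrDr mulrCA.
have phi_ex c : exists c0, c \in W -> \sum_i l i * iota (c 0 i) = iota c0.
  by have [/WP[c0 cE]|cW] := boolP (c \in W); [exists c0|exists 0].
have [phi phiP] := choice phi_ex.
have lphi a u v : u \in W -> v \in W -> phi (a *: u + v) = a * phi u + phi v.
  move=> uW vW; apply: (fmorph_inj iota).
  rewrite -phiP ?memvD ?memvZ // rmorphD rmorphM /= -!phiP // mulr_sumr -big_split.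
  by apply: eq_bigr => i _; rewrite !mxE rmorphD rmorphM /= mulrDr mulrCA.
have lpsi : linear (fun c => phi (projv W c) : K^o).
  by move=> a u v; rewrite linearP lphi // memv_proj.
exists (fun i => phi (projv W (delta_mx 0 i))) => c c0 cE.
have cW : (\row_i c i) \in W.
  by apply/WP; exists c0; rewrite -cE; apply: eq_bigr => i _; rewrite mxE.
apply: (fmorph_inj iota); rewrite -cE.
have -> : \sum_i l i * iota (c i) = iota (phi (\row_i c i)).
  by rewrite -phiP //; apply: eq_bigr => i _; rewrite mxE.
congr (iota _); rewrite -[in RHS](projv_id cW) (row_sum_delta (\row_i c i)).
rewrite [RHS](linear_fun_sum _ _ lpsi); apply: eq_bigr => i _.
by rewrite [RHS](linear_funZ _ _ lpsi) mxE mulrC.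
Qed.

Section Descent.
Variables (K L : fieldType) (iota : {rmorphism K -> L}) (A : rigidCat K).
Variable (H : tensorFunctor iota A (svect L)).
Implicit Types M N P Q : A.
Local Notation one := (@unit_ob K A).
Local Notation tot := (tot H).
Local Notation hone := (hone H).
Local Notation numtriv M N := (@numtriv K A M N).

Lemma lfun_trace_comb (V W : vectType L) (h : 'Hom(W, V)) n (l : 'I_n -> L)
    (g : 'I_n -> 'Hom(V, W)) f : f = \sum_i l i *: g i ->
  lfun_trace (h \o f)%VF = \sum_i l i * lfun_trace (h \o g i)%VF.
Proof.
move=> ->; rewrite /lfun_trace; under [RHS]eq_bigr do rewrite mulr_sumr.
rewrite exchange_big; apply: eq_bigr => k _ /=.
rewrite comp_lfunE sum_lfunE !linear_sum /= /vcrd linear_sum; apply: eq_bigr => i _.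
by rewrite scale_lfunE !linearZ comp_lfunE.
Qed.

(** Morphisms f are detected by the traces of the h f, which lie in K. The
    relation between realisations gives the same relation between traces, to
    which the retraction of L onto K is applied. In particular, morphisms that
    are independent over K have realisations that are independent over L. *)
Lemma numtriv0_descent M N n (g : 'I_n -> mor M N) f (l : 'I_n -> L) :
  (forall h, h \in numtriv M N -> h = 0) ->
  (forall x : tot M, happ f x = \sum_i l i *: happ (g i) x) ->
  exists k : 'I_n -> K, f = \sum_i k i *: g i.
Proof.
move=> N0 fE; have [k kP] := finite_retraction iota l; exists k.
have fp : hplus H f = \sum_i l i *: hplus H (g i).
  apply/lfunP=> v; rewrite sum_lfunE.
  have /(congr1 (fun z : tot N => z.1)) := fE ((v, 0) : tot M).
  rewrite (linear_fun_sum _ _ (f := fun z : tot N => z.1)) // happE /= => ->.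
  by apply: eq_bigr => i _; rewrite scale_lfunE.
have fm : hminus H f = \sum_i l i *: hminus H (g i).
  apply/lfunP=> v; rewrite sum_lfunE.
  have /(congr1 (fun z : tot N => z.2)) := fE ((0, v) : tot M).
  rewrite (linear_fun_sum _ _ (f := fun z : tot N => z.2)) // happE /= => ->.
  by apply: eq_bigr => i _; rewrite scale_lfunE.
have [t tP] := choice (fun h => tr_scalar H (h : mor M M)).
apply/eqP; rewrite -subr_eq0; apply/eqP/N0/numtrivP => h.
have fhE : \sum_i l i * iota (t (h \oc g i)) = iota (t (h \oc f)).
  under eq_bigr do rewrite (tP _).2 hplus_cmp hminus_cmp mulrBr.
  by rewrite (tP _).2 hplus_cmp hminus_cmp (lfun_trace_comb _ fp) (lfun_trace_comb _ fm) sumrB.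
rewrite cmpBr (linear_fun_sum _ _ (cmp_linear h)) -scaleN1r addrC tr_linear.
rewrite (linear_fun_sum _ _ (@tr_linear K A M)).
rewrite (tP _).1 -(kP _ _ fhE) scaler_suml scaleN1r; apply/eqP.
rewrite addrC subr_eq0; apply/eqP; apply: eq_bigr => i _.
by rewrite cmpZr trZ (tP _).1 scalerA.
Qed.
End Descent.

(** * The Tate conjecture and copies of the unit object *)

Lemma quot_end_horner (R : fieldType) (C : linCat R) (I : cat_ideal C) (X : C)
    (f : mor X X) p :
  end_horner (qpi I f : @mor _ (quot_cat I) X X) p = qpi I (end_horner f p).
Proof.
rewrite /end_horner (linear_fun_sum _ _ (@qpi_linear _ _ I X X)).
apply: eq_bigr => i _; rewrite (linear_funZ _ _ (@qpi_linear _ _ I X X)).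
congr (_ *: _); elim: (i : nat) => //= k ->; exact: quot_cmpE.
Qed.

Section UnitPart.
Variables (K L : fieldType) (iota : {rmorphism K -> L}) (A : rigidCat K).
Variables (H : tensorFunctor iota A (svect L)) (F : tensor_aut A).
Hypotheses (char0 : [pchar K] =i pred0) (Hfaith : faithful H).
Implicit Types M N P Q X Y : A.
Local Notation one := (@unit_ob K A).
Local Notation tot := (tot H).
Local Notation hone := (hone H).
Local Notation numtriv M N := (@numtriv K A M N).

Lemma hone_neq0 : hone != 0.
Proof.
apply: contra_eq_neq (sc1 H) => ->.
by rewrite sc_odd // eq_sym oner_neq0.
Qed.

Lemma end_one (f : mor one one) : exists c, f = c *: idm one.
Proof. by have [t _ tK] := end_unit A; exists (t f); rewrite tK. Qed.

Lemma scale_idm_one_eq0 c : c *: idm one = 0 :> mor one one -> c = 0.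
Proof.
have [t Kt _] := end_unit A => c0.
by rewrite -[c]Kt c0 -[0 in LHS](scale0r (idm one)) Kt.
Qed.

(** F acts on the unit by a nonzero scalar c, and c = c c since the unit is
    isomorphic to its tensor square. *)
Lemma taut_one : F one = idm one.
Proof.
have [c cE] := end_one (F one).
have Fh : happ (F one) hone = iota c *: hone by rewrite cE happZ happ_id.
have c_sqr : iota c *: hone = iota (c * c) *: hone.
  rewrite -{1}Fh -[in LHS](happ_lunit hone) -happ_cmp taut_nat happ_cmp taut_tens happ_ten.
  rewrite Fh (linear_funZ _ _ (ten_linl _)) (linear_funZ _ _ (ten_linr _)).
  by rewrite scalerA -rmorphM (linear_funZ _ _ (happ_linear _)) happ_lunit.
have c0 : c != 0.
  have [g [gF _]] := taut_iso F one.
  apply: contraNneq hone_neq0 => c0.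
  by rewrite -[hone](happ_id (H := H)) -gF happ_cmp Fh c0 rmorph0 scale0r (linear_fun0 (happ_linear _)).
suff c1 : c = 1 by rewrite cE c1 scale1r.
apply: (mulfI c0); rewrite mulr1; apply: (fmorph_inj iota); apply/esym.
have scZ a : sc (a *: hone) = a.
  by rewrite -[_ *: _]addr0 sc_linear sc1 sc_odd // addr0 mulr1.
by rewrite -[LHS]scZ c_sqr scZ.
Qed.

Lemma numtriv_one_eq0 (f : mor one one) : sign_conjecture H one ->
  f \in numtriv one one -> f = 0.
Proof.
move=> sign1 /(numtriv_nilpotent char0 Hfaith sign1)[k].
have [c ->] := end_one f.
have -> : end_pow (c *: idm one) k = c ^+ k *: idm one.
  elim: k => [|k IHk] /=; first by rewrite scale1r.
  by rewrite IHk cmpZl cmp1m scalerA exprS.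
by move/scale_idm_one_eq0/eqP; rewrite expf_eq0 => /andP[_ /eqP ->]; rewrite scale0r.
Qed.

Hypothesis cond_i : tate_conjecture (num_aut F).
Hypothesis cond_iii : forall M, sign_conjecture H M.

(** The projector onto the unit of X (+) 1 is central modulo N, since no nonzero
    morphism links X and the unit there. By the Tate conjecture it is a
    polynomial P in F modulo N; F is the identity on the unit, so P(1) = 1,
    while P(F) is numerically trivial on X. *)
Lemma tate_no_unit X :
  (forall (a : mor one X) (b : mor X one), b \oc a = 0) ->
  exists P : {poly K}, P.[1] = 1 /\ end_horner (F X) P \in numtriv X X.
Proof.
move=> ba0.
have [Y [iX [i1 [pX [p1 [pXiX p1i1 pXi1 p1iX ipY]]]]]] := (rcat_additive A).2 X one.
have aN (a : mor one X) : a \in numtriv one X.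
  by apply/numtrivP=> b; rewrite ba0 tr0.
have bN (b : mor X one) : b \in numtriv X one.
  by apply/numtrivP=> a; rewrite tr_cyclic ba0 tr0.
pose e := i1 \oc p1.
(* Modulo N, an endomorphism of Y commutes with e up to terms that factor
   through morphisms between X and the unit. *)
have eC : @is_central _ (num_quot A) Y (qpi (num_ideal A) e).
  move=> g; rewrite -(qpi_reprK g); move: (quot_repr g) => {}g.
  rewrite /= !quot_cmpE; apply: (iffRL (qpiP (num_ideal A) _ _)).
  have -> : e \oc g - g \oc e = e \oc g \oc (iX \oc pX) - iX \oc pX \oc (g \oc e).
    rewrite -{1}[e \oc g]cmpm1 -{1}[g \oc e]cmp1m -ipY cmpDr cmpDl -/e.
    by rewrite [e \oc (g \oc e)]cmpA opprD addrACA subrr addr0.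
  apply: numtrivB.
    rewrite /e cmpA; apply: numtriv_cmpr; rewrite -!cmpA; apply: numtriv_cmpl.
    by rewrite cmpA; apply: bN.
  rewrite -cmpA; apply: numtriv_cmpl; rewrite !cmpA; apply: numtriv_cmpr.
  by apply: aN.
have [P PE'] := (cond_i _).1 eC.
have PE : e - end_horner (F Y) P \in numtriv Y Y.
  have /qpiP : qpi (num_ideal A) e = qpi (num_ideal A) (end_horner (F Y) P).
    by rewrite -quot_end_horner.
  by [].
have FX : end_horner (F Y) P \oc iX = iX \oc end_horner (F X) P.
  exact/end_horner_nat/taut_nat.
have F1 : end_horner (F Y) P \oc i1 = P.[1] *: i1.
  by rewrite (end_horner_nat P (taut_nat F i1)) taut_one end_horner_id cmpZr cmpm1.
exists P; split.
  have /(numtriv_one_eq0 (cond_iii one))/scale_idm_one_eq0/eqP :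
      (1 - P.[1]) *: idm one \in numtriv one one.
    have := numtriv_cmpl p1 (numtriv_cmpr i1 PE).
    rewrite cmpBl F1 -cmpA p1i1 cmpm1 cmpBr cmpZr p1i1.
    by rewrite scalerBl scale1r.
  by rewrite subr_eq0 eq_sym => /eqP.
have := numtriv_cmpl pX (numtriv_cmpr iX PE).
rewrite cmpBl FX -cmpA p1iX cmp0r sub0r -[- _]scaleN1r cmpZr cmpA pXiX cmp1m.
by move/(numtrivZ (-1)); rewrite scalerA mulrNN mulr1 scale1r.
Qed.

(** The realisation of an element of Hom(M, N) (x) L, the latter being written
    as a list of pairs. *)
Definition comb M N (s : seq (L * mor M N)) (x : tot M) : tot N :=
  \sum_(t <- s) t.1 *: happ t.2 x.

Hypothesis pab : pseudo_abelian A.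

(** By induction on the dimension of H(X), split copies of the unit off X until
    every composite 1 -> X -> 1 vanishes. On what remains some P(F) with P(1) =
    1 is nilpotent; as F is the identity on the unit and on invariants, there
    are neither invariants nor morphisms from or to the unit left. *)
Lemma tate_unit_part X :
  [/\ forall h : mor one X, h \in numtriv one X -> h = 0,
      forall h : mor X one, h \in numtriv X one -> h = 0
    & forall v : tot X, happ (F X) v = v ->
        exists s : seq (L * mor one X), v = comb s hone].
Proof.
have [n] := ubnP (\dim {:tot X}); elim: n X => // n IHn X; rewrite ltnS => leXn.
have [ba0|] := pselect (forall (a : mor one X) (b : mor X one), b \oc a = 0).
  have [P [P1 PN]] := tate_no_unit ba0.
  have [k gk0] := numtriv_nilpotent char0 Hfaith (cond_iii X) PN.
  set g := end_horner (F X) P in gk0.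
  split=> [h _|h _|v Fv].
  - have gh : g \oc h = h \oc idm one.
      by rewrite (end_horner_nat P (taut_nat F h)) taut_one end_horner_id P1 scale1r.
    have := end_pow_nat k gh; rewrite gk0 cmp0l => /esym.
    suff -> : end_pow (idm one) k = idm one by rewrite cmpm1.
    by elim: k {gk0} => //= k ->; rewrite cmp1m.
  - have gh : idm one \oc h = h \oc g.
      by rewrite -(end_horner_nat P (taut_nat F h)) taut_one end_horner_id P1 scale1r.
    have := end_pow_nat k gh; rewrite gk0 cmp0r.
    suff -> : end_pow (idm one) k = idm one by rewrite cmp1m.
    by elim: k {gk0} => //= k ->; rewrite cmp1m.
  exists [::]; rewrite /comb big_nil.
  have gv : happ g v = v.
    by rewrite happ_horner papp_eigen // -(rmorph1 iota) horner_map P1 rmorph1 scale1r.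
  have -> : v = iter k (happ g) v by elim: k {gk0} => //= k <-.
  by rewrite -happ_pow gk0 happ0.
move=> /existsNP[a /existsNP[b ba_neq0]].
have [c cE] := end_one (b \oc a).
have c0 : c != 0 by apply: contra_not_neq ba_neq0 => c0; rewrite cE c0 scale0r.
have {b cE c0 ba_neq0} [b ba1] : exists b : mor X one, b \oc a = idm one.
  by exists (c^-1 *: b); rewrite cmpZl cE scalerA mulVf // scale1r.
have ee : (idm X - a \oc b) \oc (idm X - a \oc b) = idm X - a \oc b.
  rewrite cmpBl cmp1m cmpBr cmpm1 -[a \oc b \oc (a \oc b)]cmpA [b \oc (a \oc b)]cmpA.
  by rewrite ba1 cmp1m subrr subr0.
have [Y [r [s [rs sr]]]] := pab ee.
have bs : b \oc s = 0.
  have -> : s = (idm X - a \oc b) \oc s by rewrite -sr -cmpA rs cmpm1.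
  by rewrite cmpA cmpBr cmpm1 cmpA ba1 cmp1m subrr cmp0l.
have idX : idm X = a \oc b + s \oc r by rewrite sr addrC subrK.
have [|hN bN hF] := IHn Y.
  (* The realisation of Y is a proper subspace of that of X, as it misses a
     hone. *)
  apply: leq_trans leXn; pose S := linfun (happ s : tot Y -> tot X).
  have SE y : S y = happ s y by apply/linfun_apply/happ_linear.
  have kerS : lker S == 0%VS.
    apply/lker0P => y z; rewrite !SE => /(congr1 (happ r)).
    by rewrite -!happ_cmp rs !happ_id.
  rewrite -(limg_dim_eq (f := S)); last by rewrite (eqP kerS) capv0.
  rewrite ltn_neqAle dimvS ?subvf // andbT; apply: contraNneq hone_neq0 => dimE.
  have : limg S == fullv by rewrite eqEdim subvf dimE leqnn.
  move=> /eqP imS; have : happ a hone \in limg S by rewrite imS memvf.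
  move=> /memv_imgP[y _ ay]; rewrite -[hone](happ_id (H := H)) -ba1 happ_cmp ay SE.
  by rewrite -happ_cmp bs happ0.
split=> [h hNX|h hNX|v Fv].
- rewrite -[h]cmp1m idX cmpDl -!cmpA (hN (r \oc h)) ?numtriv_cmpl // cmp0r addr0.
  by rewrite (numtriv_one_eq0 (cond_iii one) (numtriv_cmpl b hNX)) cmp0r.
- rewrite -[h]cmpm1 idX cmpDr !cmpA (bN (h \oc s)) ?numtriv_cmpr // cmp0l addr0.
  by rewrite (numtriv_one_eq0 (cond_iii one) (numtriv_cmpr a hNX)) cmp0l.
have [|t tE] := hF (happ r v).
  by rewrite -happ_cmp taut_nat happ_cmp Fv.
exists ((sc (happ b v), a) :: [seq (u.1, s \oc u.2) | u <- t]).
rewrite -[v in LHS](happ_id (H := H)) idX happD !happ_cmp tE /comb big_cons big_map /=.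
rewrite -[in LHS](sc_one (happ b v)) (linear_funZ _ _ (happ_linear _)); congr (_ + _).
rewrite (linear_fun_sum _ _ (happ_linear _)); apply: eq_bigr => u _.
by rewrite (linear_funZ _ _ (happ_linear _)) happ_cmp.
Qed.
End UnitPart.

(** * Morphisms as elements of the realisation *)

Section Transpose.
Variables (K L : fieldType) (iota : {rmorphism K -> L}) (A : rigidCat K).
Variables (H : tensorFunctor iota A (svect L)) (F : tensor_aut A).
Implicit Types M N P Q X Y : A.
Local Notation one := (@unit_ob K A).
Local Notation tot := (tot H).
Local Notation hone := (hone H).

(** The linear map H(M) -> H(N) that an element of H(N (x) M^v) defines. *)
Definition contract M N (z : tot (N \ox dual M)) (x : tot M) : tot N :=
  happ (runit N \oc (idm N \om ev M) \oc assoc N (dual M) M) (ten z x).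

Lemma contractE M N (y : tot N) (eta : tot (dual M)) x :
  contract (ten y eta) x = evv eta x *: y.
Proof.
rewrite /contract !happ_cmp happ_assoc happ_ten happ_id happ_ev.
rewrite (linear_funZ _ _ (ten_linr _)) (linear_funZ _ _ (happ_linear _)).
by rewrite happ_runit.
Qed.

Lemma contract_linearl M N (x : tot M) : linear (fun z : tot (N \ox dual M) => contract z x).
Proof. by move=> a u v; rewrite /contract ten_linl happ_linear. Qed.

Lemma even_part_ten M N (x : tot M) (y : tot N) : even_part (ten x y) =
  ten (even_part x) (even_part y) + ten (odd_part x) (odd_part y).
Proof.
have even_id P (z : tot P) : spar false z -> even_part z = z.
  by case: z => z1 z2 /= ->.
have even_0 P (z : tot P) : spar true z -> even_part z = 0 by case: z => z1 z2 /= ->.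
rewrite -[x in LHS]even_odd -[y in LHS]even_odd.
rewrite (linear_funD _ _ (ten_linl _)) !(linear_funD _ _ (ten_linr _)).
rewrite !(linear_funD _ _ (@even_part_linear _ _ _ _ _ _)).
rewrite (even_id _ (ten (even_part x) _)); last exact: (@ten_par _ _ _ _ _ _ _ false false).
rewrite (even_0 _ (ten (even_part x) _)); last exact: (@ten_par _ _ _ _ _ _ _ false true).
rewrite (even_0 _ (ten (odd_part x) _)); last exact: (@ten_par _ _ _ _ _ _ _ true false).
rewrite (even_id _ (ten (odd_part x) _)); last exact: (@ten_par _ _ _ _ _ _ _ true true).
by rewrite addr0 add0r.
Qed.

(** The element w is (h (x) 1)(coev). As coev is even and invariant, w is
    invariant if h is equivariant, and odd if h is odd. *)
Lemma transpose_vec M N (h : tot M -> tot N) : linear h ->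
  exists w : tot (N \ox dual M), [/\ forall x, contract w x = h x,
    (forall x, h (happ (F M) x) = happ (F N) (h x)) -> happ (F (N \ox dual M)) w = w
  & (forall p x, spar p x -> spar (~~ p) (h x)) -> w.1 = 0].
Proof.
move=> lh; pose b (x : tot M) (eta : tot (dual M)) := ten (h x) eta.
have bb : bilin b by split=> [eta|x] a u v; rewrite /b ?lh ?ten_linl ?ten_linr.
have [T [lT TE]] := ten_lift bb; exists (T (coevv H M)).
split=> [x|hF|hodd].
- apply: (coev_contractr (k := fun z => contract (T z) x)) => // [|y eta].
    exact: linear_comp (contract_linearl _) lT.
  by rewrite TE contractE.
- have -> : happ (F (N \ox dual M)) (T (coevv H M)) = T (happ (F (M \ox dual M)) (coevv H M)).
    move: (coevv H M); apply: ten_ext => [||x eta].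
    + exact: linear_comp (happ_linear _) lT.
    + exact: linear_comp lT (happ_linear _).
    by rewrite !TE !taut_tens !happ_ten TE /b hF.
  by rewrite /coevv -happ_cmp taut_nat happ_cmp (taut_one H F) happ_id.
have coev_even : even_part (coevv H M) = coevv H M.
  have : (coevv H M).2 = 0 by exact: (@happ_par _ _ _ _ _ _ _ (coev M) false _ (hone_par H)).
  by case: (coevv H M) => c1 c2 /= ->.
rewrite -coev_even; move: (coevv H M).
apply: (ten_ext (f := fun z => (T (even_part z)).1) (g := fun=> 0)).
- by move=> a u v; rewrite even_part_linear lT.
- by move=> a u v; rewrite scaler0 addr0.
move=> x eta; rewrite even_part_ten (linear_funD _ _ lT) !TE /b.
have /= e1 := @ten_par _ _ _ _ H _ _ true false _ _ (hodd false (even_part x) erefl) (erefl : spar false (even_part eta)).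
have /= e2 := @ten_par _ _ _ _ H _ _ false true _ _ (hodd true (odd_part x) erefl) (erefl : spar true (odd_part eta)).
by rewrite e1 e2 addr0.
Qed.

(** Adjunction between M and its dual: k is the contraction of a, and the second
    snake identity recovers a from k. *)
Lemma unit_hom_mate M N (a : mor one (N \ox dual M)) : faithful H ->
  exists k : mor M N, a = (k \om idm (dual M)) \oc coev M /\
    forall x, happ k x = contract (happ a hone) x.
Proof.
move=> Hfaith; have [l' [l'l ll']] := lunit_iso M.
pose c := runit N \oc (idm N \om ev M) \oc assoc N (dual M) M.
pose k := c \oc (a \om idm M) \oc l'.
have kE x : happ k x = contract (happ a hone) x.
  have -> : x = happ (lunit M) (ten hone x) by rewrite happ_lunit.
  by rewrite /k -happ_cmp -cmpA l'l cmpm1 happ_cmp happ_ten happ_id happ_lunit.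
exists k; split=> //; apply: (happ_inj Hfaith) => z.
rewrite -(sc_one z) !(linear_funZ _ _ (happ_linear _)); congr (_ *: _).
rewrite happ_cmp -/(coevv H M).
(* G z (x (x) xi) = contract z x (x) xi, so contracting w = coev recovers z. *)
pose G z w := happ ((c \om idm (dual M)) \oc associ (N \ox dual M) M (dual M))
   (ten z w : tot ((N \ox dual M) \ox (M \ox dual M))).
have GE z' x xi : G z' (ten x xi) = ten (contract z' x) xi.
  by rewrite /G happ_cmp happ_associ happ_ten happ_id.
transitivity (G (happ a hone) (coevv H M)); last first.
  move: (coevv H M); apply: ten_ext => [||x xi].
  - exact: linear_comp (happ_linear _) (ten_linr _).
  - exact: happ_linear.
  by rewrite GE happ_ten happ_id kE.
move: (happ a hone) => {z}z; apply/esym; move: z; apply: ten_ext => [||y eta] //.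
  by apply: linear_comp (happ_linear _) _; exact: ten_linl.
apply: (coev_contractl (g := fun xi => ten y xi)) => [||x xi].
- exact: ten_linr.
- exact: linear_comp (happ_linear _) (ten_linr _).
by rewrite GE contractE (linear_funZ _ _ (ten_linl _)).
Qed.

End Transpose.

(** * Invariants, the sign conjecture and equivariant maps *)

Section Conditions.
Variables (K L : fieldType) (iota : {rmorphism K -> L}) (A : rigidCat K).
Variables (H : tensorFunctor iota A (svect L)) (F : tensor_aut A).
Hypotheses (char0 : [pchar K] =i pred0) (Hfaith : faithful H).
Implicit Types M N P Q X Y : A.
Local Notation one := (@unit_ob K A).
Local Notation tot := (tot H).
Local Notation hone := (hone H).
Local Notation numtriv M N := (@numtriv K A M N).

(** An equivariant map from the even to the odd part of H(M) is an odd invariant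
    of H(M (x) M^v), hence 0. As the traces of the powers of F lie in K, some
    polynomial P over K takes F to the identity on the even part and to 0 on the
    odd part, so that P(F) realises the projector. *)
Lemma odd_invariants_sign : (forall M, odd_invariants H F M = 0%VS) ->
  forall M, sign_conjecture H M.
Proof.
move=> inv0 M.
have [||P [Pp Pm]] := @separating_poly_lfun L K iota _ _
    (hplus H (F M)) (hminus H (F M)) char0.
- move=> k; have [c [_ cE]] := tr_scalar H (end_pow (F M) k).
  by exists c; rewrite cE hplus_pow hminus_pow.
(* h, extended by 0 to the odd part. *)
- move=> h hF; pose g (x : tot M) : tot M := (0, h x.1).
  have lg : linear g.
    by move=> a u v; congr (_, _); rewrite /= ?scaler0 ?addr0 ?linearP.
  have [|w [wg wF wodd]] := @transpose_vec K L iota A H F M M g.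
    exact: lg.
  have gF x : g (happ (F M) x) = happ (F M) (g x).
    by rewrite /g !happE /= linear0 hF.
  have godd p (x : tot M) : spar p x -> spar (~~ p) (g x).
    by case: p => //= x1; rewrite x1 linear0.
  have w0 : w = 0.
    have : w.2 \in odd_invariants H F (M \ox dual M).
      by apply/fixedSpaceP; have /(congr1 (fun z : tot _ => z.2)) := wF gF.
    by rewrite inv0 memv0; move: (wodd godd); case: (w) => w1 w2 /= -> /eqP ->.
  apply/lfunP=> v; have /(congr1 (fun z : tot M => z.2)) := wg (v, 0).
  rewrite w0 (linear_fun0 (contract_linearl _)) zero_lfunE /g /= => <- //.
exists (end_horner (F M) P); apply: sapp_ext => x.
apply: (etrans (happ_horner (H := H) (F M) P x)).
have iterE k : iter k (happ (F M)) x =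
    (iter k (hplus H (F M)) x.1, iter k (hminus H (F M)) x.2).
  by elim: k => [|k IHk]; [case: (x)|rewrite /= IHk].
set q := map_poly iota P in Pp Pm *.
have pappE : papp (happ (F M)) q x =
    (papp (hplus H (F M)) q x.1, papp (hminus H (F M)) q x.2).
  rewrite [LHS]surjective_pairing; congr pair; rewrite /papp.
    rewrite (linear_fun_sum _ _ (f := fun z : tot M => z.1)) //.
    by apply: eq_bigr => i _; rewrite iterE.
  rewrite (linear_fun_sum _ _ (f := fun z : tot M => z.2)) //.
  by apply: eq_bigr => i _; rewrite iterE.
by rewrite pappE Pp Pm /sapp /= id_lfunE zero_lfunE.
Qed.

Hypothesis pab : pseudo_abelian A.
Hypothesis cond_i : tate_conjecture (num_aut F).
Hypothesis cond_iii : forall M, sign_conjecture H M.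

(** The transpose M (x) N^v -> 1 of a numerically trivial f is numerically
    trivial, because morphisms 1 -> M (x) N^v are transposes of morphisms N ->
    M. This reduces to the case of the unit. *)
Lemma tate_numtriv0 M N (f : mor M N) : f \in numtriv M N -> f = 0.
Proof.
move=> /numtrivP fN.
pose b := ev N \oc braid N (dual N) \oc (f \om idm (dual N)).
have b0 : b = 0.
  have [_ unitN0 _] := tate_unit_part char0 Hfaith cond_i cond_iii pab (M \ox dual N).
  apply/unitN0/numtrivP=> a; rewrite tr_cyclic; suff -> : b \oc a = 0 by rewrite tr0.
  have [k [-> _]] := unit_hom_mate (H := H) a Hfaith.
  have -> : b \oc ((k \om idm (dual N)) \oc coev N) = tr (f \oc k).
    by rewrite /b /tr tensm_cmpl !cmpA.
  by rewrite -tr_cyclic fN.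
apply: (happ_inj Hfaith) => x; rewrite happ0.
have evf xi : evv xi (even_part (happ f x)) - evv xi (odd_part (happ f x)) = 0.
  have : happ b (ten x xi) = 0 by rewrite b0 happ0.
  rewrite /b happ_cmp happ_ten happ_id happ_ev_braid => /eqP.
  by rewrite scaler_eq0 (negPf (hone_neq0 H)) orbF => /eqP.
have : even_part (happ f x) - odd_part (happ f x) = 0.
  apply/esym; apply: (coev_contractr (g := id) (k := fun=> 0)) => [//|a u v|y eta].
    by rewrite scaler0 addr0.
  by rewrite addrC -scaleN1r evv_linr mulN1r addrC evf scale0r.
move: (happ f x) => y e.
have : y.1 - 0 = 0 := congr1 (fun z : tot N => z.1) e.
have : 0 - y.2 = 0 := congr1 (fun z : tot N => z.2) e.
by rewrite subr0 sub0r => /eqP; rewrite oppr_eq0; case: (y) => y1 y2 /= /eqP -> ->.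
Qed.

(** The transpose of h is an invariant of H(N (x) M^v), hence a combination of
    morphisms from the unit, which are transposes of morphisms M -> N. The
    degree of h is arbitrary; in particular odd equivariant maps vanish. *)
Lemma tate_equivariant_comb M N (h : tot M -> tot N) : linear h ->
  (forall x, h (happ (F M) x) = happ (F N) (h x)) ->
  exists s : seq (L * mor M N), forall x, h x = comb s x.
Proof.
move=> lh hF; have [w [wh /(_ hF) wF _]] := transpose_vec F lh.
have [_ _ /(_ w wF)[s sE]] := tate_unit_part char0 Hfaith cond_i cond_iii pab (N \ox dual M).
have [k kP] := choice (fun a : mor one (N \ox dual M) => unit_hom_mate (H := H) a Hfaith).
exists [seq (t.1, k t.2) | t <- s] => x.
rewrite -wh sE /comb (linear_fun_sum _ _ (contract_linearl _)) big_map.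
apply: eq_bigr => t _; rewrite (linear_funZ _ _ (contract_linearl _)).
by rewrite (kP t.2).2.
Qed.

End Conditions.

(** * Semisimplicity of the action of F *)

(** If S is the set of polynomials annihilating an endomorphism, sq_closed says
    that this endomorphism has no nilpotent polynomial other than 0. Minimality
    then makes R square-free, hence separable in characteristic 0. *)
Lemma minimal_poly_separable (F : fieldType) (S : {poly F} -> Prop) R :
  [pchar F] =i pred0 -> R != 0 -> 
  (forall u w, u * u * w = R -> S (u * w)) ->
  (forall q, q != 0 -> S q -> (size R <= size q)%N) -> separable_poly R.
Proof.
move=> char0 R0 sq_closed Rmin; apply/separable_polyP; split=> [u v uvR|u uR u1].
  have /dvdpP[w wE] : gcdp u v * gcdp u v %| R.
    by apply: dvdp_trans uvR; rewrite dvdp_mul ?dvdp_gcdl ?dvdp_gcdr.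
  move: (gcdp u v) wE (coprimep_def u v) => g wE ->.
  have g0 : g != 0 by apply: contraNneq R0 => g0; rewrite wE g0 !mulr0.
  have w0 : w != 0 by apply: contraNneq R0 => w0; rewrite wE w0 mul0r.
  have := Rmin (g * w); rewrite mulf_neq0 // wE mulrA => /(_ isT) le_gg.
  have /le_gg : S (g * w) by apply: sq_closed; rewrite wE mulrC.
  rewrite [w * g]mulrC size_mul ?mulf_neq0 // -ltnS prednK; last first.
    by rewrite addn_gt0 size_poly_gt0 mulf_neq0.
  move: g0; rewrite -size_poly_gt0; case: (size g) => // n _.
  by rewrite addnS ltnS -[X in (_ <= X)%N]addn0 leq_add2l leqn0 => /eqP ->.
apply: contraTneq u1 => u'0; rewrite -leqNgt leqNgt; apply/negP => u1.
have u0 : u != 0 by rewrite -size_poly_gt0 ltnW.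
have := coef_deriv u (size u).-2; rewrite u'0 coef0 => /esym/eqP.
rewrite -mulr_natr mulf_eq0 natr_eq0_char0 // orbF.
by case: (size u) (lead_coefE u) u1 => [|[|k]] //= <- _; rewrite lead_coef_eq0 (negPf u0).
Qed.

Lemma horner_sq_char_poly (F : fieldType) n (B : 'M[F]_n) :
  horner_sq B (char_poly B) = 0.
Proof. by case: n B => [|n] B //; apply: Cayley_Hamilton. Qed.

Section Semisimplicity.
Variables (K L : fieldType) (iota : {rmorphism K -> L}) (A : rigidCat K).
Variables (H : tensorFunctor iota A (svect L)) (F : tensor_aut A).
Hypotheses (char0 : [pchar K] =i pred0) (Hfaith : faithful H).
Implicit Types M N P Q X Y : A.
Local Notation one := (@unit_ob K A).
Local Notation tot := (tot H).
Local Notation numtriv M N := (@numtriv K A M N).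
Hypothesis N0 : forall M N (f : mor M N), f \in numtriv M N -> f = 0.

(** By Cayley-Hamilton the realisation of a power of f is an L-combination of
    those of the lower powers, and such a relation descends to K. *)
Lemma end_pow_dep M (f : mor M M) : exists2 R : {poly K}, R != 0 & end_horner f R = 0.
Proof.
pose g := stot_map (fmap H f : shom (H M) (H M)).
have gE k (x : tot M) : iter k g x = happ (end_pow f k) x.
  by rewrite happ_pow; elim: k => //= k ->; rewrite stot_mapE.
set d := \dim {:tot M}; pose chi := char_poly (mx_of g).
have chi_d : size chi = d.+1 by apply: size_char_poly.
have gd (x : tot M) : papp g chi x = 0.
  apply: rv_of_inj; rewrite papp_mx (linear_fun0 (@rv_of_linear _ _)).
  by rewrite horner_sq_char_poly mulmx0.
have fd (x : tot M) : happ (end_pow f d) x = \sum_(i < d) - chi`_i *: happ (end_pow f i) x.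
  have := gd x; rewrite (@papp_wide _ _ _ _ d.+1) ?chi_d // big_ord_recr /=.
  have -> : chi`_d = 1.
    by have /monicP := char_poly_monic (mx_of g); rewrite lead_coefE -/chi chi_d.
  rewrite scale1r gE => /eqP; rewrite addrC addr_eq0 => /eqP ->.
  by rewrite -sumrN; apply: eq_bigr => i _; rewrite gE scaleNr.
have [k kE] := numtriv0_descent (H := H) (N0 (N := M)) fd.
have [q lt_q_d qE] := end_horner_comb f k; exists ('X^d - q).
  rewrite -lead_coef_eq0 lead_coefDl ?lead_coefXn ?oner_eq0 // size_polyN size_polyXn.
  by rewrite ltnS.
rewrite -scaleN1r addrC end_hornerE pappD pappZ scaleN1r pappXn -end_hornerE qE.
by rewrite end_powE cmpm1 kE addNr.
Qed.

(** If u u w annihilates F, then (u w)(F) is central of square 0, hence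
    numerically trivial, hence 0. *)
Lemma taut_separable M : exists2 R : {poly K}, separable_poly R & end_horner (F M) R = 0.
Proof.
pose P n := `[< exists R : {poly K}, [/\ R != 0, end_horner (F M) R = 0 & size R = n] >].
have exP : exists n, P n.
  have [R R0 FR] := end_pow_dep (F M); exists (size R); apply/asboolP.
  by exists R.
case: (ex_minnP exP) => n /asboolP[R [R0 FR szR]] minn.
exists R => //.
apply: (minimal_poly_separable (S := fun q => end_horner (F M) q = 0)) => // [u w uwR|q q0 Fq].
  have FC q (g : mor M M) : end_horner (F M) q \oc g = g \oc end_horner (F M) q.
    exact/end_horner_nat/taut_nat.
  apply/N0/(numtriv_sqr0 H) => [g|]; first exact: FC.
  rewrite -end_hornerM mulrACA mulrA uwR.
  by rewrite end_hornerM FR cmp0l.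
by rewrite szR; apply: minn; apply/asboolP; exists q.
Qed.

Lemma frob_semisimple M : semisimple_end (stot_map (frob H F M)).
Proof.
have [R sepR FR] := taut_separable M.
apply: (separable_semisimple (p := map_poly iota R)); first by rewrite separable_map.
move=> x; have -> : papp (stot_map (frob H F M)) (map_poly iota R) x =
    papp (happ (F M)) (map_poly iota R) x.
  apply: eq_bigr => i _; congr (_ *: _).
  by elim: (i : nat) => //= k ->; rewrite stot_mapE.
by rewrite -happ_horner FR happ0.
Qed.
End Semisimplicity.

(** * Extension of scalars of a linear functor *)

Lemma inj_surj_bij (T U : Type) (f : T -> U) :
  injective f -> (forall y, exists x, f x = y) -> bijective f.
Proof.
move=> injf /choice[g fg]; exists g => // x.
by apply: injf; rewrite fg.
Qed.

Section ExtLift.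
Variables (K L : fieldType) (iota : {rmorphism K -> L}).
Variables (C : linCat K) (D : linCat L) (G : functor C D).
Hypothesis linG : linear_functor iota G.
Implicit Types X Y Z : C.

Definition fmap_lin X Y : {linear mor X Y -> mor (G X) (G Y) | iota \; *:%R} :=
  HB.pack_for {linear mor X Y -> mor (G X) (G Y) | iota \; *:%R}
    (@fmap _ _ _ _ G X Y) (GRing.isLinear.Build _ _ _ _ _ (linG (X := X) (Y := Y))).

Definition lift_mor X Y (x : ext_hom iota X Y) : mor (G X) (G Y) :=
  ext_eval (fmap_lin X Y) (repr x).

Lemma lift_morE X Y s : lift_mor (ext_pi iota s) = ext_eval (fmap_lin X Y) s.
Proof. exact: ext_eval_repr. Qed.

Lemma lift_mor_id X : lift_mor (ext_id iota X) = idm (G X).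
Proof. by rewrite lift_morE /ext_eval big_seq1 scale1r /= fmap_id. Qed.

Lemma lift_mor_cmp X Y Z (g : ext_hom iota Y Z) (f : ext_hom iota X Y) :
  lift_mor (ext_cmp g f) = lift_mor g \oc lift_mor f.
Proof.
rewrite lift_morE ext_eval_seq_cmp /lift_mor /ext_eval.
rewrite [RHS](linear_fun_sum _ _ (cmp_linearl _)); apply: eq_bigr => p _.
rewrite cmpZl; congr (_ *: _); rewrite (linear_fun_sum _ _ (cmp_linear _)).
by apply: eq_bigr => q _; rewrite cmpZr /= fmap_cmp.
Qed.

Definition ext_lift : functor (ext_cat iota C) D :=
  @Functor _ _ (ext_cat iota C) D G lift_mor lift_mor_id lift_mor_cmp.

Lemma lift_mor_linear X Y : linear (@lift_mor X Y).
Proof.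
move=> a x y; rewrite -(ext_reprK x) -(ext_reprK y) ext_pi_linear !lift_morE.
by rewrite ext_eval_cat ext_evalZ.
Qed.

Hypothesis descent : forall X Y n (g : 'I_n -> mor X Y) f (l : 'I_n -> L),
  fmap G f = \sum_i l i *: fmap G (g i) ->
  exists k : 'I_n -> K, f = \sum_i k i *: g i.
Hypothesis comb_full : forall X Y (h : mor (G X) (G Y)),
  exists s : seq (L * mor X Y), h = \sum_(t <- s) t.1 *: fmap G t.2.

(** Induction on the number of terms: a morphism with nonzero coefficient is, by
    descent, a K-combination of the following ones, into which its term can be
    absorbed. *)
Lemma ext_eval_lift_eq0 X Y (s : seq (mor X Y * L)) :
  ext_eval (fmap_lin X Y) s = 0 -> ext_pi iota s = 0.
Proof.
move=> s0; suff: forall (W : lmodType L) (phi : {linear mor X Y -> W | iota \; *:%R}),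
    ext_eval phi s = 0.
  by move=> H; apply/ext_piP => W phi; rewrite H /ext_eval big_nil.
have [n] := ubnP (size s); elim: n s s0 => // n IHn [|[f l] s] s0 lesn W phi.
  by rewrite /ext_eval big_nil.
have [l0|l0] := eqVneq l 0.
  rewrite /ext_eval big_cons l0 scale0r add0r; apply: IHn => //.
  by move: s0; rewrite /ext_eval big_cons l0 scale0r add0r.
pose t i := nth (f, l) s i.
have sE (V : lmodType L) (psi : {linear mor X Y -> V | iota \; *:%R}) :
    ext_eval psi s = \sum_(i < size s) (t i).2 *: psi (t i).1.
  by rewrite /ext_eval (big_nth (f, l)) big_mkord.
have fE : fmap G f = \sum_(i < size s) (- (l^-1 * (t i).2)) *: fmap G (t i).1.
  move: s0; rewrite /ext_eval big_cons -/(ext_eval _ s) sE /= => /eqP.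
  rewrite addr_eq0 => /eqP /(congr1 (fun z => l^-1 *: z)).
  rewrite scalerA mulVf // scale1r => ->.
  rewrite scalerN scaler_sumr -sumrN; apply: eq_bigr => i _.
  by rewrite scalerA scaleNr.
have [k kE] := descent fE.
pose s' := [seq ((t i).1, (t i).2 + l * iota (k i)) | i : 'I_(size s)].
have s'E (V : lmodType L) (psi : {linear mor X Y -> V | iota \; *:%R}) :
    ext_eval psi ((f, l) :: s) = ext_eval psi s'.
  rewrite /ext_eval big_cons -/(ext_eval _ s) sE /= kE linear_sum scaler_sumr.
  rewrite -big_split /s' big_map big_enum /=; apply: eq_bigr => i _.
  by rewrite linearZ /= scalerA scalerDl addrC.
rewrite s'E; apply: IHn; first by rewrite -s'E.
by rewrite size_map size_enum_ord.
Qed.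

Lemma ext_lift_fully_faithful : fully_faithful ext_lift.
Proof.
move=> X Y; apply: inj_surj_bij => [x y xy|h].
  apply/eqP; rewrite -subr_eq0 -(ext_reprK (x - y)); apply/eqP/ext_eval_lift_eq0.
  have : lift_mor (x - y) = 0.
    rewrite -scaleN1r addrC lift_mor_linear scaleN1r.
    by move: xy => /= ->; rewrite addNr.
  by [].
have [s ->] := comb_full h; exists (ext_pi iota [seq (t.2, t.1) | t <- s]).
by apply: (etrans (lift_morE _)); rewrite /ext_eval big_map.
Qed.

End ExtLift.

(** * From the Tate and sign conjectures to full faithfulness *)

Section QuotInverse.
Variables (K : fieldType) (A : rigidCat K).
Hypothesis N0 : forall (M N : A) (f : mor M N), f \in @numtriv K A M N -> f = 0.
Implicit Types M N : A.

(** When N = 0 a class has only one representative, so representatives define an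
    inverse of the projection. *)
Lemma num_reprK M N (f : mor M N) : quot_repr (qpi (num_ideal A) f) = f.
Proof.
have /qpiP/N0/eqP := qpi_reprK (qpi (num_ideal A) f).
by rewrite subr_eq0 => /eqP.
Qed.

Definition num_section_cmp (M N P : num_quot A) (g : mor N P) (f : mor M N) :
  quot_repr (g \oc f) = quot_repr g \oc quot_repr f := num_reprK _.

Definition num_section : functor (num_quot A) A :=
  @Functor _ _ (num_quot A) A id (fun M N (f : @mor _ (num_quot A) M N) => quot_repr f)
    (fun M => num_reprK (idm M)) num_section_cmp.

Lemma num_proj_equivalence : is_equivalence (num_proj A).
Proof.
exists num_section; split.
  exists (fun M => idm M); split=> [M|M N f]; first exact: is_iso_id.
  by rewrite cmp1m cmpm1; exact: num_reprK.
exists (fun M => idm (M : num_quot A)); split=> [M|M N f]; first exact: is_iso_id.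
by rewrite cmp1m cmpm1; exact: qpi_reprK.
Qed.

End QuotInverse.

Lemma equivalence_numtriv0 (K : fieldType) (A : rigidCat K) :
  is_equivalence (num_proj A) ->
  forall (M N : A) (f : mor M N), f \in @numtriv K A M N -> f = 0.
Proof.
move=> [G [[t [t_iso t_nat]] _]] M N f fN.
have qf0 : fmap (num_proj A) f = fmap (num_proj A) 0.
  by apply/qpiP; rewrite subr0.
apply: (cmp_isor (t_iso M)); rewrite cmp0l.
have e0 := t_nat _ _ (0 : mor M N); rewrite [X in _ = X]cmp0l in e0.
rewrite -[RHS]e0; apply: (etrans (esym (t_nat _ _ f))).
by congr (_ \oc fmap G _).
Qed.

Section ConditionTwo.
Variables (K L : fieldType) (iota : {rmorphism K -> L}) (A : rigidCat K).
Variables (H : tensorFunctor iota A (svect L)) (F : tensor_aut A).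
Implicit Types M N P Q X Y : A.
Local Notation tot := (tot H).
Local Notation numtriv M N := (@numtriv K A M N).

Section FromTate.
Hypotheses (char0 : [pchar K] =i pred0) (Hfaith : faithful H).
Hypothesis N0 : forall M N (f : mor M N), f \in numtriv M N -> f = 0.
Hypothesis equivariant_comb : forall M N (h : tot M -> tot N), linear h ->
  (forall x, h (happ (F M) x) = happ (F N) (h x)) ->
  exists s : seq (L * mor M N), forall x, h x = comb s x.
Variable ss : forall M, semisimple_end (stot_map (frob H F M)).

Let G := rep_functor ss.

Lemma rep_valE M N (f : mor M N) x : sub_val (fmap G f) x = happ f x.
Proof. exact: stot_mapE. Qed.

Lemma rep_linear : linear_functor iota G.
Proof.
move=> M N a f g; apply: val_inj; apply/lfunP=> x.
rewrite [LHS]rep_valE happ_lin [RHS]add_lfunE scale_lfunE.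
by rewrite -!rep_valE.
Qed.

Lemma sub_val_sum (V : lmodType L) (S : submod V) I (r : seq I) (f : I -> sub_lmod S) :
  sub_val (\sum_(i <- r) f i) = \sum_(i <- r) sub_val (f i).
Proof. by apply: (big_morph (@sub_val _ _ S)). Qed.

Lemma rep_descent M N n (g : 'I_n -> mor M N) f (l : 'I_n -> L) :
  fmap G f = \sum_i l i *: fmap G (g i) ->
  exists k : 'I_n -> K, f = \sum_i k i *: g i.
Proof.
move=> e; apply: (numtriv0_descent (H := H) (N0 (N := N))) => x.
rewrite -rep_valE e sub_val_sum sum_lfunE; apply: eq_bigr => i _.
by rewrite [LHS]scale_lfunE rep_valE.
Qed.

Lemma rep_comb_full M N (h : mor (G M) (G N)) :
  exists s : seq (L * mor M N), h = \sum_(t <- s) t.1 *: fmap G t.2.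
Proof.
have [||s sE] := @equivariant_comb M N (sub_val h).
- by move=> a u v; exact: linearP.
- move=> x; have /lfunP/(_ x) := frep_homP h.
  by rewrite !comp_lfunE /frep_act !stot_mapE.
exists s; apply: val_inj; apply/lfunP=> x; rewrite [LHS]sE.
rewrite [X in _ = fun_of_lfun X x]sub_val_sum sum_lfunE; apply: eq_bigr => t _.
by rewrite [RHS]scale_lfunE rep_valE.
Qed.

Definition rep_ext := ext_lift rep_linear.

Lemma rep_ext_ff : fully_faithful rep_ext.
Proof. exact: ext_lift_fully_faithful rep_descent rep_comb_full. Qed.

Let Gq := comp_functor G (num_section N0).

Lemma rep_quot_linear : linear_functor iota Gq.
Proof.
move=> M N a f g; rewrite -rep_linear; congr (fmap G _).
by rewrite -{1}(qpi_reprK f) -{1}(qpi_reprK g) -qpi_linear /= num_reprK.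
Qed.

Lemma tate_induces_fully_faithful : induces_fully_faithful H F.
Proof.
exists ss, (ext_lift rep_quot_linear); split.
- by move=> M N; exact: lift_mor_linear.
- exists (fun M => idm (G M)); split=> [M|M N f]; first exact: is_iso_id.
  rewrite cmp1m cmpm1 [LHS]lift_morE /ext_eval big_seq1 scale1r.
  by rewrite /= num_reprK.
apply: ext_lift_fully_faithful => [M N n g f l e|M N h].
  have [k kE] := rep_descent (g := fun i => quot_repr (g i)) (f := quot_repr f) e.
  exists k; rewrite -[LHS]qpi_reprK kE (linear_fun_sum _ _ (@qpi_linear _ _ _ _ _)).
  apply: eq_bigr => i _.
  by rewrite (linear_funZ _ _ (@qpi_linear _ _ _ _ _)) qpi_reprK.
have [s ->] := rep_comb_full h; exists [seq (t.1, qpi (num_ideal A) t.2) | t <- s].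
by rewrite big_map; apply: eq_bigr => t _; rewrite /= num_reprK.
Qed.

End FromTate.
End ConditionTwo.

(** * From full faithfulness to the Tate conjecture *)

Lemma ext_pi_sum (K L : fieldType) (iota : {rmorphism K -> L}) (V : lmodType K)
    (s : seq (V * L)) : ext_pi iota s = \sum_(p <- s) p.2 *: ext_in iota p.1.
Proof.
elim: s => [|[v l] s IHs]; first by rewrite big_nil.
by rewrite big_cons -IHs ext_pi_linear /= mulr1.
Qed.

Section FromTwo.
Variables (K L : fieldType) (iota : {rmorphism K -> L}) (A : rigidCat K).
Variables (H : tensorFunctor iota A (svect L)) (F : tensor_aut A).
Implicit Types M N P Q X Y : A.
Local Notation tot := (tot H).
Local Notation hone := (hone H).
Local Notation one := (@unit_ob K A).
Local Notation numtriv M N := (@numtriv K A M N).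
Hypothesis N0 : forall M N (f : mor M N), f \in numtriv M N -> f = 0.
Hypothesis ff : induces_fully_faithful H F.

(** Conjugate h by the natural isomorphism t between the two functors. The maps
    t are only known to commute with F, and could be of mixed degree; but t is
    natural, so what comes back is a combination of realisations of morphisms.
    *)
Lemma fully_faithful_comb M N (h : tot M -> tot N) : linear h ->
  (forall x, h (happ (F M) x) = happ (F N) (h x)) ->
  exists s : seq (L * mor M N), forall x, h x = comb s x.
Proof.
move=> lh hF; have [ss [Ht [linHt [t [t_iso t_nat]] Ht_ff]]] := ff.
pose G := rep_functor ss.
have h_mem : linfun h \in @frep_mem L (G M) (G N).
  rewrite inE; apply/eqP/lfunP => x.
  by rewrite !comp_lfunE !(linfun_apply lh) /frep_act !stot_mapE; apply: hF.
pose h1 : mor (G M) (G N) := @SubLmod _ _ (Submod (frep_submod (G M) (G N))) _ h_mem.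
have [u [ut tu]] := t_iso M; have [u' [ut' tu']] := t_iso N.
have [g gK Kg] := Ht_ff M N.
pose y : @mor _ (ext_cat iota (num_quot A)) M N := g (u' \oc h1 \oc t M).
have h1E : h1 = t N \oc fmap Ht y \oc u.
  by rewrite Kg !cmpA tu' cmp1m -cmpA tu cmpm1.
have yE : y = \sum_(p <- repr y) p.2 *: ext_in iota p.1.
  by rewrite -ext_pi_sum ext_reprK.
exists [seq (p.2, quot_repr p.1) | p <- repr y] => x.
rewrite -(linfun_apply lh) -[linfun h]/(sub_val h1) h1E {1}yE.
rewrite (linear_fun_sum _ _ (linHt M N)) (linear_fun_sum _ _ (cmp_linear _)).
rewrite (linear_fun_sum _ _ (cmp_linearl _)).
rewrite [X in fun_of_lfun X x]sub_val_sum sum_lfunE /comb big_map.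
apply: eq_bigr => p _.
rewrite (linear_funZ _ _ (linHt M N)) (linear_funZ _ _ (cmp_linear _)).
rewrite (linear_funZ _ _ (cmp_linearl _)) [LHS]scale_lfunE; congr (_ *: _).
have -> : t N \oc fmap Ht (ext_in iota p.1) \oc u = fmap G (quot_repr p.1).
  have e : t N \oc fmap Ht (ext_in iota (qpi (num_ideal A) (quot_repr p.1))) =
      fmap G (quot_repr p.1) \oc t M := t_nat M N _.
  rewrite qpi_reprK in e; rewrite e.
  by rewrite -cmpA tu cmpm1.
exact: stot_mapE.
Qed.

(** An odd invariant v gives an equivariant map H(1) -> H(M) with hone |-> (0,
    v). It is a combination of realisations of morphisms, which are even, so v =
    0. *)
Lemma fully_faithful_odd_invariants M : odd_invariants H F M = 0%VS.
Proof.
apply/eqP; rewrite -subv0; apply/subvP => v /fixedSpaceP Fv; rewrite memv0.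
pose h (z : tot one) : tot M := sc z *: (0, v).
have lh : linear h by move=> a z z'; rewrite /h sc_linear scalerDl scalerA.
have [z|s /(_ hone)] := fully_faithful_comb lh.
  rewrite (taut_one H) happ_id /h (linear_funZ _ _ (happ_linear _)); congr (_ *: _).
  by rewrite happE /= linear0 -[in LHS]Fv.
rewrite /h sc1 scale1r => /(congr1 (fun z : tot M => z.2)) /= ->.
rewrite /comb (linear_fun_sum _ _ (f := fun z : tot M => z.2)) // big1 // => t _.
have -> : (t.1 *: happ t.2 hone).2 = t.1 *: (happ t.2 hone : tot M).2 by [].
by rewrite [_.2](@happ_par _ _ _ _ _ _ _ t.2 false _ (hone_par H)) scaler0.
Qed.

(** Equivariant endomorphisms are combinations of morphisms, so a central f
    commutes with all of them; by the bicommutant theorem it is a polynomial in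
    F with coefficients in L, and descent makes it one with coefficients in K.
    *)
Lemma fully_faithful_tate : tate_conjecture (num_aut F).
Proof.
move=> M f; split=> [fC|[p ->] g]; last first.
  exact/end_horner_nat/num_aut_nat.
have f0C (g : @mor K A M M) : quot_repr f \oc g = g \oc quot_repr f.
  have := fC (qpi (num_ideal A) g); rewrite -{1 2}(qpi_reprK f) /= !quot_cmpE.
  by move/(iffLR (qpiP (num_ideal A) _ _))/N0/eqP; rewrite subr_eq0 => /eqP.
have [ss _] := ff.
pose a := stot_map (frob H F M).
have [|p pE] := bicommutant (f := a) (g := stot_map (fmap H (quot_repr f) : shom (H M) (H M))) (ss M).
  move=> h hF v.
  have [|x|s sE] := @fully_faithful_comb M M h; first exact: lfun_linear.
    by have := hF x; rewrite /a !stot_mapE.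
  rewrite !stot_mapE !sE [LHS](linear_fun_sum _ _ (happ_linear _)).
  apply: eq_bigr => t _; rewrite (linear_funZ _ _ (happ_linear _)); congr (_ *: _).
  by rewrite -[RHS]happ_cmp -f0C happ_cmp.
have fE (x : tot M) : happ (quot_repr f) x = \sum_(i < size p) p`_i *: happ (end_pow (F M) i) x.
  have := pE x; rewrite stot_mapE => e; rewrite [LHS]e; apply: eq_bigr => i _.
  rewrite happ_pow; congr (_ *: _).
  by elim: (i : nat) => //= k ->; rewrite stot_mapE.
have [k kE] := numtriv0_descent (H := H) (N0 (N := M)) fE.
have [q _ qE] := end_horner_comb (F M) k; exists q.
by rewrite quot_end_horner qE -kE qpi_reprK.
Qed.

End FromTwo.

(** * Endomorphisms of simple objects *)

Section SimpleObjects.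
Variables (L : fieldType) (C : linCat L) (G : functor C (frep_cat L)).
Hypotheses (linG : linear_functor idfun G) (ffG : fully_faithful G).

(** S stands for an F-stable direct summand V of a realisation. The cyclic
    subspace of a nonzero x of V is the image of an equivariant idempotent,
    hence a nonzero subobject of S, hence V itself. An equivariant endomorphism
    of V is thus determined by its value at x, which is of the form p(F) x, and
    polynomials in F commute. *)
Lemma simple_end_commutative (S : kar_cat C) : is_simple S ->
  forall f g : mor S S, f \oc g = g \oc f.
Proof.
case: S => M e ee; set S := KarOb ee => -[idS0 simpleS] f g.
pose V := G M; pose act := frep_act V.
pose val_of (u : mor M M) : 'End(frep_tot V) := sub_val (fmap G u).
have val_of_inj u v : val_of u = val_of v -> u = v.
  by move=> uv; apply: (bij_inj (ffG M M)); apply: val_inj.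
have val_cmp u v x : val_of (u \oc v) x = val_of u (val_of v x).
  by rewrite /val_of fmap_cmp /= comp_lfunE.
have val_act u x : val_of u (act x) = act (val_of u x).
  by have /lfunP/(_ x) := frep_homP (fmap G u); rewrite !comp_lfunE.
have val_papp u p x : val_of u (papp act p x) = papp act p (val_of u x).
  by rewrite (papp_comm (g := val_of u)) //; apply: lfun_linear.
have val_full (h : 'End(frep_tot V)) : (forall x, h (act x) = act (h x)) ->
    exists u, val_of u = h.
  move=> hF; have hm : h \in @frep_mem L V V.
    by rewrite inE; apply/eqP/lfunP => x; rewrite !comp_lfunE; apply: hF.
  have [k kG Gk] := ffG M M.
  exists (k (@SubLmod _ _ (Submod (frep_submod V V)) _ hm)).
  by rewrite /val_of Gk.
have G0 : val_of 0 = 0.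
  by rewrite /val_of (linear_fun0 (linG (X := M) (Y := M))).
pose E := val_of e.
have EE x : E (E x) = E x by rewrite -val_cmp ee.
have [x0 Ex0] : exists x0, E x0 != 0.
  apply: contra_notP idS0 => /forallNP E0; apply: val_inj; apply: val_of_inj => /=.
  by rewrite G0; apply/lfunP=> x; rewrite zero_lfunE; apply/eqP/negPn/negP/E0.
pose x := E x0; have [U UP] := cyclic_subspace act x.
have [|pi [pi_act piU pi_id]] := semisimple_projection (f := act) (U := U) (@frep_ss L V).
  by move=> _ /UP[p ->]; apply/UP; exists (p * 'X); rewrite pappMX ?papp_comm //; apply: lfun_linear.
have EU u : u \in U -> E u = u by move=> /UP[p ->]; rewrite val_papp EE.
have xU : x \in U by apply/UP; exists 1; rewrite papp1.
have [e' e'E] : exists e', val_of e' = (pi \o E)%VF.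
  by apply: val_full => v; rewrite !comp_lfunE val_act pi_act.
have e'v v : val_of e' v = pi (E v) by rewrite e'E comp_lfunE.
have e'e' : e' \oc e' = e'.
  by apply: val_of_inj; apply/lfunP => v; rewrite val_cmp !e'v EU // pi_id.
have ee'e' : e \oc e' \oc e' = e'.
  by apply: val_of_inj; apply/lfunP => v; rewrite -cmpA e'e' val_cmp -/E e'v EU.
pose X : kar_cat C := KarOb e'e'.
have fm : e' \in @kar_mem _ C X S by rewrite inE /= ee'e'.
pose i : mor X S := @SubLmod _ _ (Submod (kar_submod X S)) _ fm.
have mono_i : is_mono i.
  move=> Z a b /(congr1 (@sub_val _ _ _)) /= ab; apply: val_inj.
  by rewrite /= -(kar_homl a) -(kar_homl b).
have im_E v : E v \in U.
  have [i0|[j [_ /(congr1 (@sub_val _ _ _)) /= ij]]] := simpleS X i mono_i.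
    have : val_of e' x = 0.
      by have /= -> := congr1 (@sub_val _ _ _) i0; rewrite G0 zero_lfunE.
    by rewrite e'v EE pi_id // => x_0; move/eqP: Ex0; case.
  by rewrite /E -ij val_cmp e'v piU.
have valE (h : kar_hom S S) v : E (val_of (sub_val h) v) = val_of (sub_val h) v.
  by rewrite -val_cmp; have /= -> := kar_homl h.
have valr (h : kar_hom S S) v : val_of (sub_val h) (E v) = val_of (sub_val h) v.
  by rewrite -val_cmp; have /= -> := kar_homr h.
have [p fx] : exists p, val_of (sub_val f) x = papp act p x by apply/UP; rewrite -valE.
have [q gx] : exists q, val_of (sub_val g) x = papp act q x by apply/UP; rewrite -valE.
apply: val_inj; apply: val_of_inj; apply/lfunP => v /=.
(* Every element of V is of the form r(F) x. *)
have [r Ev] : exists r, E v = papp act r x by apply/UP.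
rewrite !val_cmp -[val_of (sub_val g) v]valr -[val_of (sub_val f) v]valr Ev !val_papp.
rewrite fx gx !val_papp fx gx -!pappM; try exact: lfun_linear.
by rewrite mulrAC.
Qed.

End SimpleObjects.

(** * The sign conjecture and Kimura finiteness *)

(** The decomposition of a permutation on which perm_act is based. *)
Lemma lift_permE n (s : 'S_n.+1) : exists t, s = lift_perm ord0 (s ord0) t.
Proof.
pose f i := odflt i (unlift (s ord0) (s (lift ord0 i))).
have fE i : lift (s ord0) (f i) = s (lift ord0 i).
  rewrite /f; case: unliftP => [j -> //|/perm_inj/eqP].
  by rewrite eq_sym (negPf (neq_lift _ _)).
have injf : injective f.
  move=> i j fij; apply: (@lift_inj _ ord0); apply: (@perm_inj _ s).
  by rewrite -!fE fij.
exists (perm injf); apply/permP=> i.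
case: (unliftP ord0 i) => [j ->|->]; last by rewrite lift_perm_id.
by rewrite lift_perm_lift permE fE.
Qed.

Section PureTensors.
Variables (K L : fieldType) (iota : {rmorphism K -> L}) (A : rigidCat K).
Variable (H : tensorFunctor iota A (svect L)).
Implicit Types M N P : A.
Local Notation one := (@unit_ob K A).
Local Notation tot := (tot H).
Local Notation hone := (hone H).

Fixpoint hten M n : ('I_n -> tot M) -> tot (tpow M n) :=
  if n is n'.+1 then fun x => ten (x ord0) (hten (fun i => x (lift ord0 i)))
  else fun=> hone.

Lemma ten_neq0 M N (x : tot M) (y : tot N) : x != 0 -> y != 0 -> ten x y != 0.
Proof.
have nz (V : vectType L) (v : V) : v != 0 -> exists i, vcrd i v != 0.
  move=> v0; apply: contrapT => /forallNP v_0; case/eqP: v0.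
  by rewrite [v]vect_sum big1 // => i _; have /negP/negPn/eqP-> := v_0 i; rewrite scale0r.
move=> /nz[i xi] /nz[j yj].
pose b (u : tot M) (v : tot N) : L^o := vcrd i u * vcrd j v.
have bb : bilin b.
  by split=> [v|u] a s t; rewrite /b vcrd_linear ?mulrDl ?mulrDr -?mulrA // mulrCA.
have [g [lg gE]] := ten_lift bb.
apply: contraTneq (mulf_neq0 xi yj) => xy0.
by rewrite -[_ * _]/(b x y) -gE xy0 (linear_fun0 lg) eqxx.
Qed.

(** It suffices to test linear maps on pure tensors of basis vectors. This gives
    repeated factors as soon as there are more factors than basis vectors. *)
Lemma hten_ext M n (U : lmodType L) (g : tot (tpow M n) -> U) : linear g ->
  (forall i : 'I_n -> 'I_(\dim {:tot M}), g (hten (fun k => vbas (i k))) = 0) ->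
  forall z, g z = 0.
Proof.
elim: n g => [|n IHn] g lg gE z.
  rewrite -(sc_one z) (linear_funZ _ _ lg).
  have i : 'I_0 -> 'I_(\dim {:tot M}) by case.
  by have := gE i => /= ->; rewrite scaler0.
move: z; apply: (ten_ext (g := fun=> 0) lg) => [a u v|x y].
  by rewrite scaler0 addr0.
rewrite [x]vect_sum (linear_fun_sum _ _ (ten_linl _)) (linear_fun_sum _ _ lg) big1 // => j _.
rewrite (linear_funZ _ _ (ten_linl _)) (linear_funZ _ _ lg).
rewrite (IHn (fun y => g (ten (vbas j) y))) ?scaler0 //.
  exact: linear_comp lg (ten_linr _).
move=> i; have := gE (fun k => if unlift ord0 k is Some k' then i k' else j).
rewrite /= unlift_none => <-; congr (g (ten _ (hten _))).
by apply: funext => k; rewrite liftK.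
Qed.

Lemma happ_swap12 M N P (e : bool) (x : tot M) (y : tot N) (z : tot P) :
  spar e x -> spar e y ->
  happ (swap12 M N P) (ten x (ten y z)) = (-1) ^+ e *: ten y (ten x z).
Proof.
move=> ex ey; rewrite /swap12 !happ_cmp happ_associ happ_ten happ_id happ_braid.
have -> : ten ((y.1, 0) : tot N) x + ten ((0, y.2) : tot N) ((x.1, - x.2) : tot M) =
    (-1) ^+ e *: ten y x.
  case: e ex ey; case: x y => x1 x2 [y1 y2] /= -> ->.
    rewrite -[(0, 0)]/(0 : tot N) (linear_fun0 (ten_linl _)) add0r expr1.
    have -> : ((0, - x2) : tot M) = -1 *: ((0, x2) : tot M).
      by congr (_, _); rewrite ?scaler0 ?scaleN1r.
    by rewrite (linear_funZ _ _ (ten_linr _)).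
  rewrite -[(0, 0)]/(0 : tot N) (linear_fun0 (ten_linl _)) addr0 expr0 scale1r.
  by [].
rewrite (linear_funZ _ _ (ten_linl _)) (linear_funZ _ _ (happ_linear _)).
by rewrite happ_assoc.
Qed.

(** Each of the k exchanges of neighbouring factors contributes a sign if e is
    odd. *)
Lemma happ_first_to M n e (k : 'I_n.+1) (z : 'I_n.+1 -> tot M) :
  (forall i, spar e (z i)) ->
  happ (first_to M n k) (ten (z k) (hten (fun i => z (lift k i)))) =
  (-1) ^+ (e * k) *: hten z.
Proof.
elim: n k z => [|n IHn] k z ze.
  by rewrite happ_id !ord1 muln0 scale1r.
case: (unliftP ord0 k) => [k' ->|->]; last by rewrite /= happ_id muln0 scale1r.
rewrite lift0 /= happ_cmp.
have -> : lift (lift ord0 k') ord0 = ord0 by apply: val_inj.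
have -> : (fun i => z (lift (lift ord0 k') (lift ord0 i))) =
    (fun i => z (lift ord0 (lift k' i))).
  by apply: funext => i; congr z; apply: val_inj; rewrite /= /bump !leq0n !add1n ltnS addnS.
rewrite (happ_swap12 _ (ze _) (ze _)) (linear_funZ _ _ (happ_linear _)) happ_ten happ_id.
rewrite (IHn k' (fun i => z (lift ord0 i))) // (linear_funZ _ _ (ten_linr _)) scalerA.
by rewrite -exprD mulnS.
Qed.

(** On homogeneous factors of the same degree e the symmetry permutes the
    factors, up to the sign of the permutation if e is odd. *)
Lemma happ_perm_act M n e (s : 'S_n) (z : 'I_n -> tot M) :
  (forall i, spar e (z i)) ->
  happ (perm_act M s) (hten (fun i => z (s i))) = (-1) ^+ (e && s) *: hten z.
Proof.
elim: n s z => [|n IHn] s z ze.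
  rewrite happ_id; have -> : s = 1%g by apply/permP=> -[].
  by rewrite odd_perm1 andbF scale1r.
rewrite /= happ_cmp happ_ten happ_id.
set t := odflt _ _; have st : s = lift_perm ord0 (s ord0) t.
  rewrite /t; case: pickP => [t' /eqP //|no]; have [t' /eqP] := lift_permE s.
  by rewrite no.
have -> : (fun i => z (s (lift ord0 i))) = (fun i => z (lift (s ord0) (t i))).
  by apply: funext => i; rewrite {1}st lift_perm_lift.
rewrite (IHn t (fun i => z (lift (s ord0) i))) //.
rewrite (linear_funZ _ _ (ten_linr _)) (linear_funZ _ _ (happ_linear _)).
rewrite (happ_first_to _ ze) scalerA [in RHS]st odd_lift_perm /=.
congr (_ *: _); case: e {ze IHn} => /=; last by rewrite mul0n mulr1.
by rewrite mul1n signr_addb signr_odd mulrC.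
Qed.

Lemma happ_sum_fin (I : finType) M N (f : I -> mor M N) (x : tot M) :
  happ (\sum_i f i) x = \sum_i happ (f i) x.
Proof. by apply: (big_morph (fun g => happ g x)) => [g h|]; rewrite ?happD ?happ0. Qed.

(** The alternating projector if e is even and the symmetric one if e is odd: on
    factors of degree e, both have the signs of the permutations as
    coefficients. *)
Definition koszul_proj (e : bool) M n : mor (tpow M n) (tpow M n) :=
  n`!%:R^-1 *: \sum_(s : 'S_n) (-1) ^+ (~~ e && s) *: perm_act M s.

Lemma sym_projE M n : sym_proj M n = koszul_proj true M n.
Proof. by congr (_ *: _); apply: eq_bigr => s _; rewrite scale1r. Qed.

Hypotheses (char0 : [pchar K] =i pred0) (Hfaith : faithful H).

Lemma koszul_proj_hten e e' M n (z : 'I_n -> tot M) : (forall i, spar e' (z i)) ->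
  happ (koszul_proj e M n) (hten z) = iota (n`!%:R^-1) *:
    \sum_(s : 'S_n) (-1) ^+ ((~~ e (+) e') && s) *: hten (fun i => z (s i)).
Proof.
move=> ze; rewrite happZ happ_sum_fin; congr (_ *: _).
rewrite (reindex_inj invg_inj); apply: eq_bigr => s _.
rewrite happZ; have -> : hten z = hten (fun i => (fun j => z (s j)) (s^-1 i)%g).
  by congr hten; apply: funext => i; rewrite permKV.
rewrite (happ_perm_act s^-1%g (z := fun j => z (s j)) (e := e')) //.
rewrite scalerA rmorphXn rmorphN1 -signr_addb odd_permV; congr (_ *: _).
by case: (e) (e') (odd_perm s) => [] [] [].
Qed.

(** The sum of the permutations of a pure tensor, with their signs, is its own
    opposite if two factors are equal; among more than dim H(M) basis vectors
    two are equal. *)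
Lemma koszul_proj_pure e M : (forall x : tot M, spar e x) ->
  exists2 n, (0 < n)%N & koszul_proj e M n = 0.
Proof.
move=> Me; set d := \dim {:tot M}; exists d.+1 => //.
apply: (happ_inj Hfaith) => z; rewrite happ0; move: z; apply: hten_ext => [|i].
  exact: happ_linear.
rewrite (koszul_proj_hten e (e' := e)) //.
set S := \sum_s _; suff -> : S = 0 by rewrite scaler0.
have [a [b ab iab]] : exists a, exists2 b, a != b & i a = i b.
  have : ~~ injectiveb i.
    by apply/injectiveP => /leq_card; rewrite !card_ord ltnn.
  by move=> /injectivePn[a [b ab iab]]; exists a, b.
(* Composition with the transposition of a and b changes the signs only. *)
have : S = - S.
  rewrite {1}/S (reindex_inj (mulIg (tperm a b))) -sumrN; apply: eq_bigr => s _.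
  rewrite -scaleNr; congr (_ *: _).
    rewrite odd_permM odd_tperm ab addbT addNb addbb /=.
    by case: (odd_perm s); rewrite ?opprK.
  congr hten; apply: funext => k; rewrite permM.
  by case: tpermP => [->|->|//]; rewrite iab.
move=> /eqP; rewrite -addr_eq0 -mulr2n -scaler_nat scaler_eq0 natr_eq0_char0 //.
  by move=> /eqP.
exact: pchar0_ext iota char0.
Qed.

(** In degree opposite to e all coefficients are 1, so that v (x) ... (x) v is
    fixed by the projector. *)
Lemma koszul_proj_eq0 e M n : koszul_proj e M n = 0 ->
  forall v : tot M, spar (~~ e) v -> v = 0.
Proof.
move=> q0 v ve; have /esym/eqP := koszul_proj_hten e (n := n) (z := fun=> v) (fun=> ve).
rewrite q0 happ0 scaler_eq0 fmorph_eq0 invr_eq0 natr_eq0_char0 //.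
rewrite eqn0Ngt fact_gt0 /= addbb.
under eq_bigr do rewrite andFb scale1r.
rewrite sumr_const card_Sn -scaler_nat scaler_eq0 natr_eq0_char0; last first.
  exact: pchar0_ext iota char0.
rewrite eqn0Ngt fact_gt0 /= => hv0; apply/eqP; apply: contraTT hv0 => v0.
elim: n {q0} => [|n IHn] /=; last exact: ten_neq0.
by apply: contra_eq_neq (sc1 H) => ->; rewrite sc_odd // eq_sym oner_neq0.
Qed.

(** As H is faithful, p is idempotent; its image is purely even and that of 1 -
    p purely odd. *)
Lemma sign_kimura M : pseudo_abelian A -> sign_conjecture H M -> kimura_finite M.
Proof.
move=> pab [p pE].
have pv (x : tot M) : happ p x = (x.1, 0).
  by rewrite /happ pE /sapp /= id_lfunE zero_lfunE.
have pp : p \oc p = p.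
  by apply: (happ_inj Hfaith) => x; rewrite happ_cmp !pv.
have qq : (idm M - p) \oc (idm M - p) = idm M - p.
  by rewrite cmpBl cmp1m cmpBr cmpm1 pp subrr subr0.
have qv (x : tot M) : happ (idm M - p) x = (0, x.2).
  have := happD (idm M - p) p x; rewrite subrK happ_id pv => xE.
  have -> : happ (idm M - p) x = x - (x.1, 0).
    by apply: (canRL (addrK _)); rewrite -xE.
  by case: (x) => x1 x2; congr (_, _); rewrite /= ?subrr ?subr0.
have [Mp [r [s [rs sr]]]] := pab _ _ pp.
have [Mm [r' [s' [rs' sr']]]] := pab _ _ qq.
have pure (N : A) e (a : mor M N) (b : mor N M) : a \oc b = idm N ->
    (forall x : tot M, spar e (happ (b \oc a) x : tot M)) -> forall y : tot N, spar e y.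
  move=> ab ba y.
  have -> : y = happ a (happ (b \oc a) (happ b y)).
    have abv z : happ a (happ b z) = z by rewrite -happ_cmp ab happ_id.
    by rewrite happ_cmp !abv.
  exact: (happ_par a).
have Mp_even : forall x : tot Mp, spar false x.
  by apply: (pure _ false r s rs) => x; rewrite sr pv.
have Mm_odd : forall x : tot Mm, spar true x.
  by apply: (pure _ true r' s' rs') => x; rewrite sr' qv.
exists Mp, Mm; split; last 2 first.
- by have [n n0 qn] := koszul_proj_pure Mp_even; exists n.
- by have [n n0 qn] := koszul_proj_pure Mm_odd; exists n; rewrite ?sym_projE.
exists s, s', r, r'; split=> //.
- have -> : r = r \oc p by rewrite -sr cmpA rs cmp1m.
  have -> : s' = (idm M - p) \oc s' by rewrite -sr' -cmpA rs' cmpm1.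
  by rewrite -cmpA [p \oc _]cmpA cmpBr cmpm1 pp subrr cmp0l cmp0r.
- have -> : r' = r' \oc (idm M - p) by rewrite -sr' cmpA rs' cmp1m.
  have -> : s = p \oc s by rewrite -sr -cmpA rs cmpm1.
  by rewrite -cmpA [_ \oc (p \oc s)]cmpA cmpBl cmp1m pp subrr cmp0l cmp0r.
by rewrite sr sr' addrC subrK.
Qed.

(** A summand killed by an exterior power is purely even, and one killed by a
    symmetric power is purely odd; so the projector onto the former is p. *)
Lemma kimura_sign M : kimura_finite M -> sign_conjecture H M.
Proof.
move=> [Mp [Mm [[iX [iY [pX [pY [XX YY XY YX XYM]]]]] [n _ altn] [m _ symm]]]].
have Mp_even (x : tot Mp) : spar true x -> x = 0 := @koszul_proj_eq0 false Mp n altn x.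
have Mm_odd (x : tot Mm) : spar false x -> x = 0.
  by apply: (@koszul_proj_eq0 true Mm m); rewrite -sym_projE.
exists (iX \oc pX).
have pv (x : tot M) : happ (iX \oc pX) x = (x.1, 0).
  have even_x : happ (iX \oc pX) (even_part x) = even_part x.
    rewrite -[RHS](happ_id (H := H)) -XYM happD [in X in _ + X]happ_cmp.
    rewrite (Mm_odd (happ pY _)); first by rewrite (linear_fun0 (happ_linear _)) addr0.
    exact: (@happ_par _ _ _ _ _ _ _ pY false).
  have odd_x : happ (iX \oc pX) (odd_part x) = 0.
    rewrite happ_cmp (Mp_even (happ pX _)) ?(linear_fun0 (happ_linear _)) //.
    exact: (@happ_par _ _ _ _ _ _ _ pX true).
  by rewrite -[x in LHS]even_odd (linear_funD _ _ (happ_linear _)) even_x odd_x addr0.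
apply: sapp_ext => x; apply: (etrans (pv x)).
by rewrite /sapp /= id_lfunE zero_lfunE.
Qed.

End PureTensors.

(** * The equivalences *)

Theorem corollary6p10 (K L : fieldType) (iota : {rmorphism K -> L})
    (A : rigidCat K) (H : tensorFunctor iota A (svect L)) (F : tensor_aut A) :
  [pchar K] =i pred0 -> pseudo_abelian A -> faithful H ->
  let cond_i := tate_conjecture (num_aut F) in
  let cond_ii := is_equivalence (num_proj A) /\ induces_fully_faithful H F in
  let cond_iii := forall M : A, sign_conjecture H M in
  let cond_iv := forall M : A, odd_invariants H F M = 0%VS in
  [/\ cond_iii <-> (forall M : A, kimura_finite M),
      cond_iv -> cond_iii,
      cond_ii <-> cond_i /\ cond_iii,
      cond_ii <-> cond_i /\ cond_iv
    & [/\ cond_i, cond_ii, cond_iii & cond_iv] ->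
      forall S : kar_cat (ext_cat iota A), is_simple S ->
      forall f g : mor S S, f \oc g = g \oc f].
Proof.
move=> char0 pab Hfaith cond_i cond_ii cond_iii cond_iv.
have iv_iii : cond_iv -> cond_iii by exact: odd_invariants_sign.
have ii_iv : cond_ii -> cond_iv.
  by move=> [_ ff] M; apply: fully_faithful_odd_invariants ff M.
have ii_i : cond_ii -> cond_i.
  by move=> [/equivalence_numtriv0 N0 ff]; apply: fully_faithful_tate N0 ff.
have i_iii_ii : cond_i -> cond_iii -> cond_ii.
  move=> i iii; have N0 := tate_numtriv0 char0 Hfaith pab i iii.
  split; first exact: num_proj_equivalence N0.
  apply: (tate_induces_fully_faithful N0).
    exact: tate_equivariant_comb char0 Hfaith pab i iii.
  exact: frob_semisimple char0 N0.
split=> //.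
- split=> [iii M|kim M]; first exact: sign_kimura.
  exact: kimura_sign.
- split=> [ii|[i iii]]; last exact: i_iii_ii.
  by split; [exact: ii_i|apply/iv_iii/ii_iv].
- split=> [ii|[i iv]]; last exact/i_iii_ii/iv_iii.
  by split; [exact: ii_i|exact: ii_iv].
move=> [i _ iii _] S simpleS.
have N0 := tate_numtriv0 char0 Hfaith pab i iii.
have ss := frob_semisimple (H := H) (F := F) char0 N0.
have comb_ex := tate_equivariant_comb char0 Hfaith pab i iii.
apply: (simple_end_commutative (G := rep_ext ss)) simpleS.
  by move=> M N; exact: lift_mor_linear.
exact: rep_ext_ff N0 comb_ex ss.
Qed.
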